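(* Let $F_{\Psi}:\mathcal{R}\to\mathcal{R}$ be the $\Psi$-lift of an expanding interval map $F$. For the transient sets the following implications hold: \begin{itemize} \item if $\mu_{\delta\varphi}(\psi)\ge 0$, then $\dim_H(\mathbf{T}^-)=\delta_0$ and $\dim_H(\mathbf{T}^+)=\delta$; \item if $\mu_{\delta\varphi}(\psi)\le 0$, then $\dim_H(\mathbf{T}^+)=\delta_0$ and $\dim_H(\mathbf{T}^-)=\delta$, \end{itemize} where $\mathbf{T}^{\pm}$ may be chosen to be any one of the sets $\mathbf{T}_1^{\pm}$, $\mathbf{T}_2^{\pm}$ or $\mathbf{T}_3^{\pm}(r)$ for any $r\in\mathbb{R}$.
   Context: Setting. Let $I=\{1,\dots,m\}$, $m\ge 2$, and let $I_i\subset[0,1]$, $i\in I$, be pairwise disjoint intervals with non-empty interior. $F$ is an expanding interval map with $C^{1+\epsilon}$ full branches $F|_{I_i}:I_i\to[0,1]$: the continuous continuation $H_i$ of $F|_{I_i}$ to $\overline{I_i}$ is a $C^{1+\epsilon}$ diffeomorphism of $\overline{I_i}$ onto $[0,1]$ with $|H_i'|>1$. Put $h_i=H_i^{-1}:[0,1]\to\overline{I_i}$. Let $\Sigma=I^{\mathbb{N}}$ with left shift $\sigma$ and metric $d(\omega,\tau)=\exp(-\max\{k\ge0:\omega_1=\tau_1,\dots,\omega_k=\tau_k\})$, and let $\pi:\Sigma\to[0,1]$ be the coding map, $\{\pi(\omega)\}=\bigcap_{n}h_{\omega_1}\circ\cdots\circ h_{\omega_n}([0,1])$. Let $I^\star$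 be the set of all finite words over $I$ (including the empty word), $|\omega|$ the length of $\omega\in I^\star$, and $[\omega]=\{x\in\Sigma: x|_{|\omega|}=\omega\}$ the cylinder of $\omega$. Let $\mathcal{D}=\bigcup_{(\omega_1,\dots,\omega_n)\in I^\star}h_{\omega_1}\circ\cdots\circ h_{\omega_n}(\{0,1\})$ (the empty word contributing $\{0,1\}$) and $\mathcal{R}=(\pi(\Sigma)\setminus\mathcal{D})+\mathbb{Z}\subset\mathbb{R}$. Let $\Psi:[0,1]\to\mathbb{Z}$ be constant on each $I_i$. The $\Psi$-lift of $F$ is $F_\Psi:\mathcal{R}\to\mathcal{R}$, $F_\Psi(x)=\sum_{k\in\mathbb{Z}}\big(k+F(x-k)+\Psi(x-k)\big)\mathbf{1}_{[0,1]}(x-k)$. For $f:\Sigma\to\mathbb{R}$ put $S_nf=\sum_{k=0}^{n-1}f\circ\sigma^k$ and, for $\omega\in I^\star$, $S_\omega f=\sup_{x\in[\omega]}S_{|\omega|}f(x)$. The geometric potential $\varphi:\Sigma\to(-\infty,0)$ is the Hölder continuous function with $\varphi(\omega)=-\log|F'(\pi(\omega))|$ except possibly on a finite set (i.e. $\varphi(\omega)=-\log|H_{\omega_1}'(\pi(\omega))|$). The symbolic step length function $\psi:\Sigma\to\mathbb{Z}$ is constant on one-cylinder sets and equals $\Psi\circ\pi$ except possibly on a finite set (i.e. $\psi(\omega)$ is the value of $\Psi$ on $I_{\omega_1}$). The classical topological pressure of a continuous $f:\Sigma\to\mathbb{R}$ is $\mathfrak{P}(f)=\lim_{n\to\infty}\frac1n\log\sum_{\omega\in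 I^n}\exp(S_\omega f)$. The number $\delta>0$ is the unique $s$ with $\mathfrak{P}(s\varphi)=0$. For Hölder continuous $f$, $\mu_f$ is the Gibbs measure of $f$: the unique $\sigma$-invariant Borel probability measure on $\Sigma$ for which there is $c\ge1$ with $c^{-1}\le\mu_f([\omega])/\exp(S_nf(x)-n\mathfrak{P}(f))\le c$ for all $n\in\mathbb{N}$, $\omega\in I^n$, $x\in[\omega]$. Write $\mu(\psi)=\int\psi\,d\mu$. For $\alpha\in\mathbb{R}$ the $\alpha$-Poincaré exponent is $\delta_\alpha=\inf\{s\ge0:\sum_{\omega\in I^\star,\,|S_\omega(\psi-\alpha)|\le K}e^{s\,S_\omega\varphi}<\infty\}$, where $K>0$ is sufficiently large; $\delta_0$ is its value at $\alpha=0$. Transient sets: $\mathbf{T}_1^{\pm}=\{x\in\mathcal{R}:\lim_{n\to\infty}F_\Psi^n(x)=\pm\infty\}$; $\mathbf{T}_2^{\pm}=\{x\in\mathcal{R}:\limsup_{n\to\infty}\mp F_\Psi^n(x)<\infty\}$; $\mathbf{T}_3^{\pm}(r)=\{x\in\mathcal{R}:\forall n\ge0\ \ \pm F_\Psi^n(x)>r\}$ for $r\in\mathbb{R}$. $\dim_H$ is Hausdorff dimension, with $\dim_H\emptyset=0$.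
   Formalization: For T_1^± the claim is proved only if some branch has a step Ψ of the sign ±, or at most one branch has step 0; otherwise T_1^± is empty while δ_0 and δ are positive where claimed (e.g. Ψ = 0), so the claim fails. T_2^± and T_3^±(r) carry no such condition. *)

(* Defs.v *)
From HB Require Import structures.
From mathcomp Require Import all_boot all_order all_algebra.
From mathcomp Require Import all_classical all_reals all_analysis.
Import Order.TTheory GRing.Theory Num.Theory.
Import numFieldNormedType.Exports.

Set Implicit Arguments.
Unset Strict Implicit.
Unset Printing Implicit Defensive.

Local Open Scope classical_set_scope.
Local Open Scope ring_scope.

Section HausdorffDimension.
Variable R : realType.
Implicit Types (A U : set R) (s d : R).

Definition diam U : \bar R :=
  ereal_sup [set `|x - y|%:E | x in U & y in U].

(* Empty covering sets are skipped, so that they cost 0 also when s = 0. *)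
Definition hausdorff_premeasure s d A : \bar R :=
  ereal_inf [set (\sum_(0 <= n <oo | `[< U n !=set0 >]) poweR (diam (U n)) s)%E
            | U in [set U : nat -> set R |
                     A `<=` \bigcup_n U n /\
                     forall n, (diam (U n) <= d%:E)%E]].

Definition hausdorff_measure s A : \bar R :=
  ereal_sup [set hausdorff_premeasure s d A | d in [set d | 0 < d]].

Definition hausdorff_dim A : \bar R :=
  ereal_inf [set s%:E | s in [set s | 0 <= s /\ hausdorff_measure s A = 0%E]].

End HausdorffDimension.

Section IntervalMaps.
Variable R : realType.

(* Derivative relative to a set: one-sided at the end points of an interval. *)
Definition diff_quotient (f : R -> R) (x y : R) : R := (f y - f x) / (y - x).

Definition derivable_within (A : set R) (f : R -> R) (x : R) : Prop :=
  cvg (diff_quotient f x y @[y --> within A x^']).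

Definition derive_within (A : set R) (f : R -> R) (x : R) : R :=
  lim (diff_quotient f x y @[y --> within A x^']).

Definition C1_holder (eps : R) (A : set R) (f : R -> R) : Prop :=
  (forall x, A x -> derivable_within A f x) /\
  exists C : R, forall x y, A x -> A y ->
    `|derive_within A f x - derive_within A f y| <= C * `|x - y| `^ eps.

Definition C1_holder_diffeo (eps : R) (A B : set R) (f : R -> R) : Prop :=
  [/\ set_bij A B f, C1_holder eps A f & C1_holder eps B (pinv A f)].

(* The alphabet is 'I_m.+2, i.e. it has m + 2 >= 2 symbols 0, ..., m + 1.  Only the values of F on the union of
   the I_ i matter.  H i is the continuous extension of F from I_ i to its
   closure. *)
Record expanding_map (m : nat) (I_ : 'I_m.+2 -> set R) (F : R -> R)
    (H : 'I_m.+2 -> R -> R) : Prop := ExpandingMap {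
  branch_interval : forall i, is_interval (I_ i);
  branch_sub : forall i, I_ i `<=` `[0, 1];
  branch_interior : forall i, (I_ i)° !=set0;
  branch_disjoint : trivIset setT I_;
  branch_extends : forall i x, I_ i x -> H i x = F x;
  branch_diffeo : exists2 eps : R, 0 < eps &
    forall i, C1_holder_diffeo eps (closure (I_ i)) `[0, 1] (H i);
  branch_expanding : forall i x, closure (I_ i) x ->
    1 < `|derive_within (closure (I_ i)) (H i) x| }.

End IntervalMaps.

Section Shift.
Variables (R : realType) (m : nat).

(* One-sided sequences, indexed from 0: the letter omega_1 is [omega 0]. *)
Definition symbol_seq : Type := nat -> 'I_m.+2.

HB.instance Definition _ := Choice.on symbol_seq.
HB.instance Definition _ := isPointed.Build symbol_seq (fun=> ord0).

Definition shift (x : symbol_seq) : symbol_seq := fun n => x n.+1.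

Definition cylinder (w : seq 'I_m.+2) : set symbol_seq :=
  [set x | mkseq x (size w) = w].

(* exp(-max{k : x and y agree on the first k letters}), and 0 if x = y. *)
Definition seq_dist (x y : symbol_seq) : R :=
  inf [set expR (- k%:R) | k in [set k : nat | mkseq x k = mkseq y k]].

Definition seq_open : set (set symbol_seq) :=
  [set U | forall x, U x -> exists2 e : R, 0 < e &
             forall y, seq_dist x y < e -> U y].

Definition borel_symbol_seq := g_sigma_algebraType seq_open.

Definition birkhoff (f : symbol_seq -> R) (n : nat) (x : symbol_seq) : R :=
  \sum_(k < n) f (iter k shift x).

Definition sup_birkhoff (f : symbol_seq -> R) (w : seq 'I_m.+2) : R :=
  sup [set birkhoff f (size w) x | x in cylinder w].

Definition pressure (f : symbol_seq -> R) : R :=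
  limn (fun n : nat =>
    n%:R^-1 * ln (\sum_(w : n.-tuple 'I_m.+2) expR (sup_birkhoff f w))).

Definition is_gibbs (f : symbol_seq -> R) (mu : probability borel_symbol_seq R)
    : Prop :=
  (forall A : set borel_symbol_seq, measurable A -> mu (shift @^-1` A) = mu A) /\
  exists2 c : R, 1 <= c &
    forall (n : nat) (w : n.-tuple 'I_m.+2) (x : symbol_seq), cylinder w x ->
      let e := expR (birkhoff f n x - n%:R * pressure f) in
      ((c^-1)%:E <= mu (cylinder w) * (e^-1)%:E <= c%:E)%E.

Definition poincare_exponent (phi psi : symbol_seq -> R) (alpha K : R) : R :=
  inf [set s | 0 <= s /\
    (\esum_(w in [set w : seq 'I_m.+2 |
                   (`|sup_birkhoff (fun x => psi x - alpha) w| <= K)%R])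
        (expR (s * sup_birkhoff phi w))%:E < +oo)%E].

End Shift.

Section Lift.
Variables (R : realType) (m : nat).
Variables (I_ : 'I_m.+2 -> set R) (F : R -> R) (H : 'I_m.+2 -> R -> R).
Variable (Psi : R -> int).

Definition inv_branch (i : 'I_m.+2) : R -> R := pinv (closure (I_ i)) (H i).

Definition inv_branches (w : seq 'I_m.+2) (x : R) : R := foldr inv_branch x w.

Definition coding (x : symbol_seq m) : R :=
  get (\bigcap_n (inv_branches (mkseq x n) @` `[0, 1])).

Definition boundary_points : set R :=
  \bigcup_(w in [set: seq 'I_m.+2]) (inv_branches w @` [set 0; 1]).

Definition lift_domain : set R :=
  [set x + k%:~R | x in range coding `\` boundary_points & k in [set: int]].

(* The sum is finitely supported: at most two k satisfy x - k \in [0, 1]. *)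
Definition lift (x : R) : R :=
  \sum_(k \in [set: int])
    (k%:~R + F (x - k%:~R) + (Psi (x - k%:~R))%:~R) * \1_(`[0, 1]) (x - k%:~R).

Definition geometric_potential (x : symbol_seq m) : R :=
  - ln `|derive_within (closure (I_ (x 0%N))) (H (x 0%N)) (coding x)|.

(* The value of Psi on I_ i, on which Psi is constant. *)
Definition step_value (i : 'I_m.+2) : int := Psi (get (I_ i)).

Definition symbolic_step (x : symbol_seq m) : R := (step_value (x 0%N))%:~R.

Variant transient_kind := T1 | T2 | T3 of R.

(* e = 1 gives the sets T^+ and e = -1 the sets T^-. *)
Definition transient (e : R) (c : transient_kind) : set R :=
  match c with
  | T1 => [set x | lift_domain x /\ e * iter n lift x @[n --> \oo] --> +oo]
  | T2 => [set x | lift_domain x /\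
             (limn_esup (fun n => (- e * iter n lift x)%:E) < +oo)%E]
  | T3 r => [set x | lift_domain x /\ forall n, r < e * iter n lift x]
  end.

(* Fails exactly when no step has the sign of e and at least two letters have
   step 0.  Then T1 is empty, whereas the 0-Poincare exponent is positive
   (e.g. for Psi = 0), so T1 cannot have dimension the Poincare exponent. *)
Definition escapes (e : R) : Prop :=
  (exists i, 0 < e * (step_value i)%:~R) \/
  (forall i j, step_value i = 0 -> step_value j = 0 -> i = j).

End Lift.
Arguments T1 {R}.
Arguments T2 {R}.

(* Main.v *)
(* A set is null for H^s as soon as it is coded by words of total weight
   sum e^(s S_w phi) as small as we please, and by bounded distortion a set coded
   by concatenations of words from a finite family of equal length has positive
   H^s-measure when the weights of the family sum to more than a fixed constant.
   Both dimensions are therefore exponents of word sums.  If the mean step in the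
   direction of escape is nonnegative, invariance of the Gibbs measure makes the
   words with nonnegative walk have weight of order 1/n at exponent delta, hence
   exponentially large weight below delta.  If the mean is nonpositive, a point
   with unbounded walk has prefixes at every high level, and appending a word
   that descends again turns them into words returning near 0, which are summable
   above delta_0; conversely the words with bounded walk, when not summable, give
   Cantor sets of points whose orbits do not descend. *)
Require Import Defs.
From HB Require Import structures.
From mathcomp Require Import all_boot all_order all_algebra.
From mathcomp Require Import all_classical all_reals all_analysis.
From mathcomp Require Import ring lra zify.
Import Order.TTheory GRing.Theory Num.Theory.
Import numFieldNormedType.Exports.

Set Implicit Arguments.
Unset Strict Implicit.
Unset Printing Implicit Defensive.

Local Open Scope classical_set_scope.
Local Open Scope ring_scope.

(** * Hausdorff null sets *)

(** The lower bounds construct no measure on a Cantor set. A cheap cover is translated into a list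
    of forbidden prefixes of total Bernoulli probability below 1, and a sequence avoiding all of
    them is chosen letter by letter. The geometric obstacle is that the closures of neighbouring
    branches may share an end point, so differing letters do not separate points. Every block
    therefore ends with a two-letter word that keeps its points away from 0 and 1. This word must
    not spoil the walk: a step in the direction of escape compensates it, and without such a step it
    is built from letters of step 0. Polynomial losses in the word length are harmless, because any
    gap between two exponents gains an exponential factor. For the upper bounds all three kinds of
    transient set lie in countably many translates of contracted copies of one set, the points of
    nonnegative walk: an orbit is cut where its walk is minimal. Both directions of escape are one
    argument, applied to the step times a sign. *)

Section NullSets.
Variable R : realType.
Implicit Types (A B : set R) (s : R).

Lemma nneseries_pickle_inv (T : countType) (f : T -> \bar R) :
  (forall t, 0 <= f t)%E ->
  (\sum_(0 <= k <oo) oapp f 0 (pickle_inv k) = \esum_(t in [set: T]) f t)%E.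
Proof.
move=> f0; rewrite nneseries_esumT; last first.
  by move=> n; case: pickle_inv => [t|] //=.
have -> : (\esum_(i in [set: nat]) oapp f 0 (pickle_inv i) =
  \esum_(i in range (@pickle T)) oapp f 0 (pickle_inv i))%E.
  rewrite [RHS]esum_mkcond; apply: eq_esum => k _; case: ifPn => //.
  rewrite notin_setE => nk; case E: (pickle_inv k) => [t|] //=.
  by exfalso; apply: nk; exists t => //; have := @pickle_invK T k; rewrite /ocancel E.
rewrite (@reindex_esum R T nat setT (range (@pickle T)) pickle) /=.
  by apply: eq_esum => t _; rewrite pickleK_inv.
split; [by move=> t _; exists t| |by move=> k [t _ <-]; exists t].
by move=> x y _ _; apply: (pcan_inj pickleK).
Qed.

(* Covers with diameter bounds [d n], so that monotonicity and images under
   1-Lipschitz maps are immediate. *)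
Definition hausdorff_null s A := forall eps : R, 0 < eps ->
  exists U : nat -> set R, exists d : nat -> R,
  [/\ A `<=` \bigcup_n U n,
      forall n, 0 <= d n,
      forall n x y, U n x -> U n y -> `|x - y| <= d n &
      (\sum_(0 <= n <oo) (d n `^ s)%:E <= eps%:E)%E].

(** Indices that code no element of [T] receive the empty set with bound 0. This is free only
    because [0 < s]: [powR] gives 0 to the power 0 the value 1. *)
Lemma hausdorff_null_countable_cover (T : countType) s A : 0 < s ->
  (forall eps : R, 0 < eps ->
    exists U : T -> set R, exists d : T -> R,
    [/\ A `<=` \bigcup_t U t,
        forall t, 0 <= d t,
        forall t x y, U t x -> U t y -> `|x - y| <= d t &
        (\esum_(t in [set: T]) (d t `^ s)%:E <= eps%:E)%E]) ->
  hausdorff_null s A.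
Proof.
move=> s0 H eps /H[U [d [AU d0 Ud Sd]]].
exists (fun n => oapp U set0 (pickle_inv n)).
exists (fun n => oapp d 0 (pickle_inv n)); split.
- move=> x /AU[t _ Ux]; exists (pickle t) => //.
  by rewrite pickleK_inv.
- by move=> n; case: pickle_inv => //=.
- by move=> n x y; case: pickle_inv => [t|] //=; apply: Ud.
- rewrite (@eq_eseriesr _ _ (fun n =>
    oapp (fun t => (d t `^ s)%:E) 0%E (pickle_inv n))); last first.
    by move=> n _; case: pickle_inv => //=; rewrite powR0 ?gt_eqF.
  by rewrite nneseries_pickle_inv // => t; rewrite lee_fin powR_ge0.
Qed.

Lemma hausdorff_null_subset s A B : A `<=` B ->
  hausdorff_null s B -> hausdorff_null s A.
Proof.
move=> AB H eps /H[U [d [BU d0 Ud Sd]]]; exists U, d; split => //.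
exact: subset_trans BU.
Qed.

Lemma hausdorff_null_image s A (f : R -> R) :
  (forall x y, A x -> A y -> `|f x - f y| <= `|x - y|) ->
  hausdorff_null s A -> hausdorff_null s (f @` A).
Proof.
move=> fl H eps /H[U [d [AU d0 Ud Sd]]].
exists (fun n => f @` (A `&` U n)), d; split => //.
- by move=> _ [x Ax <-]; have [n _ Ux] := AU _ Ax; exists n => //; exists x.
- move=> n _ _ [x [Ax Ux] <-] [y [Ay Uy] <-].
  exact: le_trans (fl _ _ Ax Ay) (Ud _ _ _ Ux Uy).
Qed.

Lemma hausdorff_null_bigcup (T : countType) s (A : T -> set R) : 0 < s ->
  (forall t, hausdorff_null s (A t)) -> hausdorff_null s (\bigcup_t A t).
Proof.
move=> s0 H; apply: (@hausdorff_null_countable_cover (T * nat)%type) => // eps e0.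
have e2 n : 0 < eps / (2 ^ n.+1)%:R by rewrite divr_gt0 // ltr0n expn_gt0.
have /choice[U HU] : forall t, exists Ud : (nat -> set R) * (nat -> R),
  [/\ A t `<=` \bigcup_n Ud.1 n,
      forall n, 0 <= Ud.2 n,
      forall n x y, Ud.1 n x -> Ud.1 n y -> `|x - y| <= Ud.2 n &
      (\sum_(0 <= n <oo) (Ud.2 n `^ s)%:E <= (eps / (2 ^ (pickle t).+1)%:R)%:E)%E].
  by move=> t; have [U [d P]] := H t _ (e2 (pickle t)); exists (U, d).
exists (fun p => (U p.1).1 p.2), (fun p => (U p.1).2 p.2); split.
- move=> x [t _ Ax]; have [AU _ _ _] := HU t.
  by have [n _ Ux] := AU _ Ax; exists (t, n).
- by move=> [t n]; have [_ + _ _] := HU t; apply.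
- by move=> [t n] x y; have [_ _ + _] := HU t; apply.
- rewrite (_ : [set: T * nat] = [set p | setT p.1 /\ (fun=> setT) p.1 p.2]); last first.
    by apply/seteqP; split.
  rewrite -(@esum_esum _ _ _ setT (fun=> setT) (fun t n => ((U t).2 n `^ s)%:E)); last first.
    by move=> *; rewrite lee_fin powR_ge0.
  apply: (@le_trans _ _ (\esum_(t in [set: T]) (eps / (2 ^ (pickle t).+1)%:R)%:E)%E).
    apply: le_esum => t _; rewrite -nneseries_esumT; first by have [] := HU t.
    by move=> *; rewrite lee_fin powR_ge0.
  rewrite -nneseries_pickle_inv; last by move=> t; rewrite lee_fin ltW.
  apply: le_trans; last exact: (epsilon_trick0 xpredT (ltW e0)).
  apply: lee_nneseries => [n _ _|n _]; first by case: pickle_inv => //= t; rewrite lee_fin ltW.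
  case E: pickle_inv => [t|] /=; last by rewrite lee_fin ltW.
  by have := @pickle_invK T n; rewrite /ocancel E /= => ->.
Qed.

Lemma hausdorff_null_set1 s x : 0 < s -> hausdorff_null s [set x].
Proof.
move=> s0 eps e0; exists (fun=> [set x]), (fun=> 0); split => //.
- by move=> _ ->; exists 0%N.
- by move=> _ _ _ -> ->; rewrite subrr normr0.
- by rewrite powR0 ?gt_eqF // eseries0 // lee_fin ltW.
Qed.

Lemma hausdorff_nullU s A B : 0 < s ->
  hausdorff_null s A -> hausdorff_null s B -> hausdorff_null s (A `|` B).
Proof.
move=> s0 nA nB; apply: (@hausdorff_null_subset _ _ (\bigcup_b if b then A else B)).
  by move=> x [Ax|Bx]; [exists true|exists false].
by apply: hausdorff_null_bigcup => // -[].
Qed.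

Lemma diam_ge0 A x : A x -> (0 <= diam A)%E.
Proof.
move=> Ax; apply: ereal_sup_ubound; exists x => //; exists x => //.
by rewrite subrr normr0.
Qed.

(** One null exponent arbitrarily close above [t] suffices for an infimum. The application may have
    to keep these exponents below a second threshold. *)
Lemma hausdorff_null_dim_le (t : R) A : 0 <= t ->
  (forall u, t < u -> exists2 s, t < s <= u & hausdorff_null s A) ->
  (hausdorff_dim A <= t%:E)%E.
Proof.
move=> t0 H; apply/lee_addgt0Pr => e e0; rewrite -EFinD.
have [|s /andP[ts se] {}H] := H (t + e); first by rewrite ltrDl.
have s0 : 0 < s by exact: le_lt_trans ts.
apply: ge_ereal_inf; exists s%:E; last by rewrite lee_fin.
exists s => //; split; first exact: ltW.
apply/eqP; rewrite eq_le; apply/andP; split.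
  apply: ge_ereal_sup => _ [d /= d0 <-].
  apply/lee_addgt0Pr => eps eps0; rewrite add0e.
  (* A total cost of at most [d] to the power [s] bounds each single term, so every diameter is at
     most [d]: cheap covers are fine covers. *)
  pose eps' := Num.min eps (d `^ s).
  have e'0 : 0 < eps' by rewrite lt_min eps0 powR_gt0.
  have [U [r [AU r0 Ur Sr]]] := H _ e'0.
  have diamU n : (diam (U n) <= (r n)%:E)%E.
    by apply: ge_ereal_sup => _ [x Ux [y Uy <-]]; rewrite lee_fin Ur.
  have term n : ((r n `^ s)%:E <= eps'%:E)%E.
    apply: le_trans Sr.
    rewrite (@nneseriesD1 _ _ n) //=; last by move=> *; rewrite lee_fin powR_ge0.
    rewrite leeDl // nneseries_ge0 // => *; by rewrite lee_fin powR_ge0.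
  apply: (@le_trans _ _ (\sum_(0 <= n <oo | `[< U n !=set0 >]) (diam (U n) `^ s)%E)%E).
    apply: ereal_inf_lbound; exists U => //; split => // n.
    apply: le_trans (diamU n) _; rewrite lee_fin leNgt; apply/negP => dr.
    have := term n; rewrite lee_fin /eps' le_min => /andP[_].
    by apply/negP; rewrite -ltNge; apply: gt0_ltr_powR; rewrite ?nnegrE ?(ltW d0).
  apply: (@le_trans _ _ (\sum_(0 <= n <oo) (r n `^ s)%:E)%E); last first.
    by apply: le_trans Sr _; rewrite lee_fin ge_min lexx.
  rewrite eseries_mkcond.
  apply: lee_nneseries => [n _ _|n _]; first by case: ifP => // _; exact: poweR_ge0.
  case: ifP => [/asboolP[x Ux]|_]; last by rewrite lee_fin powR_ge0.
  rewrite -poweR_EFin gt0_ler_poweR // ?ltW // ?in_itv /= ?andbT ?leey ?lee_fin ?r0 //.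
  by rewrite (diam_ge0 Ux).
apply: le_ereal_sup_tmp.
exists (hausdorff_premeasure s 1 A); first by exists 1 => /=.
apply: le_ereal_inf_tmp => _ [U _ <-]; apply: nneseries_ge0 => *.
exact: poweR_ge0.
Qed.

Lemma hausdorff_null_dim_ge (t : R) A :
  (forall s, 0 < s -> s < t -> ~ hausdorff_null s A) -> (t%:E <= hausdorff_dim A)%E.
Proof.
move=> H; apply: le_ereal_inf_tmp => _ [s [s0 Hs] <-].
rewrite lee_fin leNgt; apply/negP => st.
(* [s] may be 0, while the midpoint is positive. Sets of diameter at most 1 cost no more at the
   larger exponent, hence the scale 1 below. *)
apply: (H ((s + t) / 2)); [lra|lra|] => eps e0.
set s' := (s + t) / 2; have ss' : s < s' by rewrite /s'; lra.
have s'0 : 0 < s' by lra.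
have : (hausdorff_premeasure s 1 A < eps%:E)%E.
  apply: (@le_lt_trans _ _ (hausdorff_measure s A)); last by rewrite Hs lte_fin.
  by apply: ereal_sup_ubound; exists 1 => //=.
move=> /ereal_inf_lt[_ [U [AU Ud] <-]] Sd.
pose d n := if `[< U n !=set0 >] then fine (diam (U n)) else 0.
have dE n x : U n x -> [/\ diam (U n) = (d n)%:E, 0 <= d n & d n <= 1].
  move=> Ux; have nU : `[< U n !=set0 >] by apply/asboolP; exists x.
  have dge := diam_ge0 Ux.
  have dle := Ud n.
  have : diam (U n) = (d n)%:E.
    rewrite /d nU fineK // fin_numE.
    by case: (diam (U n)) dge dle.
  by move=> dd; rewrite dd !lee_fin in dge dle.
exists U, d; split => //.
- move=> n; rewrite /d; case: ifPn => // /asboolP[x Ux].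
  by have [dd _ _] := dE _ _ Ux; rewrite fine_ge0 // dd lee_fin; have [] := dE _ _ Ux.
- move=> n x y Ux Uy; have [dd _ _] := dE _ _ Ux.
  by rewrite -lee_fin -dd; apply: ereal_sup_ubound; exists x => //; exists y.
apply: le_trans (ltW Sd); rewrite [leRHS]eseries_mkcond.
apply: lee_nneseries => [n _ _|n _]; first by rewrite lee_fin powR_ge0.
case: ifPn => [/asboolP[x Ux]|nU]; last by rewrite /d (negbTE nU) powR0 ?gt_eqF.
have [-> d0 d1] := dE _ _ Ux; rewrite poweR_EFin lee_fin.
move: d0; rewrite le_eqVlt => /predU1P[<-|d0].
  by rewrite powR0 ?gt_eqF ?powR_ge0.
by apply: ger_powR; [rewrite d0 d1|exact: ltW].
Qed.

End NullSets.

(** * Exponential growth and series of nonnegative reals *)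

Section RealSeries.
Variable R : realType.

(** The square serves the growth of nonnegative walks: one factor pays for a probability of order
    1/n, the other leaves a surplus linear in [n]. *)
Lemma linear_le_expR (k C : R) : 0 < k ->
  exists n, C * n.+1%:R ^+ 2 <= expR (k * n%:R).
Proof.
(* With this [a], [1 + k / 3 * n] is at least [a * (n + 1)], and its cube is at most [expR (k * n)].
   The third factor [n + 1] absorbs [C / a ^+ 3]. *)
move=> k0; pose a := Num.min (k / 3) 1.
have a0 : 0 < a by rewrite lt_min divr_gt0 //= ltr01.
pose n := Num.truncn (Num.max 0 (C / a ^+ 3)).
have nC : C / a ^+ 3 <= n.+1%:R.
  by rewrite (le_trans _ (ltW (truncnS_gt _))) // le_max lexx orbT.
exists n.
have h1 : a * n.+1%:R <= 1 + k / 3 * n%:R.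
  rewrite -natr1 mulrDr mulr1 addrC lerD // ?ge_min ?lexx ?orbT //.
  by rewrite ler_wpM2r // ge_min lexx.
have -> : k * n%:R = 3%:R * (k / 3 * n%:R) by field.
rewrite expRM_natl; apply: (@le_trans _ _ ((a * n.+1%:R) ^+ 3)); last first.
  rewrite lerXn2r ?nnegrE ?expR_ge0 ?mulr_ge0 ?(ltW a0) //.
  by apply: le_trans h1 _; exact: expR_ge1Dx.
have -> : (a * n.+1%:R) ^+ 3 = a ^+ 3 * n.+1%:R * n.+1%:R ^+ 2 by ring.
rewrite ler_wpM2r ?exprn_ge0 //.
by rewrite -ler_pdivrMl ?exprn_gt0 // mulrC.
Qed.

Lemma lee_series_bounded (u : nat -> R) (C : R) : (forall n, 0 <= u n) ->
  (forall n, \sum_(0 <= i < n) u i <= C) -> (\sum_(0 <= n <oo) (u n)%:E <= C%:E)%E.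
Proof.
move=> u0 H; apply: lime_le; first by apply: is_cvg_nneseries => n _ _; rewrite lee_fin.
by apply: nearW => n; rewrite sumEFin lee_fin.
Qed.

Lemma geometric_series_lt_pinfty (u : nat -> R) (C q : R) : 0 <= q -> q < 1 ->
  (forall n, 0 <= u n) -> (forall n, u n <= C * q ^+ n) ->
  (\sum_(0 <= n <oo) (u n)%:E < +oo)%E.
Proof.
move=> q0 q1 u0 H.
have C0 : 0 <= C by have := le_trans (u0 0%N) (H 0%N); rewrite expr0 mulr1.
apply: (@le_lt_trans _ _ (C / (1 - q))%:E); last exact: ltry.
apply: lee_series_bounded => // n.
apply: (@le_trans _ _ (C * \sum_(0 <= i < n) q ^+ i)); first by rewrite mulr_sumr ler_sum.
rewrite ler_wpM2l // -[leRHS]mul1r ler_pdivlMr ?subr_gt0 //.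
rewrite mulrC big_mkord -opprB mulNr -subrX1 opprB lerBlDr lerDl.
exact: exprn_ge0.
Qed.

Lemma small_term (u : nat -> R) : (forall n, 0 <= u n) ->
  (\sum_(0 <= n <oo) (u n)%:E < +oo)%E -> forall eps : R, 0 < eps ->
  exists n, u n <= eps.
Proof.
move=> u0 us eps e0; apply: contrapT => /forallNP H.
suff : (\sum_(0 <= n <oo) (u n)%:E = +oo)%E by move=> E; rewrite E ltxx in us.
apply/eqyP => A A0; apply: (@le_trans _ _ (\sum_(0 <= n < (Num.truncn (A / eps)).+1) (u n)%:E)%E).
  apply: (@le_trans _ _ (\sum_(0 <= n < (Num.truncn (A / eps)).+1) eps%:E)%E).
    rewrite sumEFin lee_fin sumr_const_nat subn0 -mulr_natl -ler_pdivrMr //.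
    exact: ltW (truncnS_gt _).
  by apply: lee_sum => n _; rewrite lee_fin; have /negP := H n; rewrite -ltNge => /ltW.
by apply: nneseries_lim_ge => n _ _; rewrite lee_fin.
Qed.

Lemma series_shift_le (u : nat -> R) r : (forall n, 0 <= u n) ->
  (\sum_(0 <= n <oo) (u (n + r)%N)%:E <= \sum_(0 <= n <oo) (u n)%:E)%E.
Proof.
move=> u0; rewrite (@nneseries_addn _ (fun n => (u n)%:E) r); last by move=> *; rewrite lee_fin.
rewrite [leRHS](@nneseries_split _ _ 0 r) ?add0n; last by move=> *; rewrite lee_fin.
by rewrite leeDr // sume_ge0 // => *; rewrite lee_fin.
Qed.

Lemma series_tail_small (u : nat -> R) (eps : R) : (forall n, 0 <= u n) ->
  (\sum_(0 <= n <oo) (u n)%:E < +oo)%E -> 0 < eps ->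
  exists J, forall r, (J <= r)%N -> (\sum_(0 <= n <oo) (u (n + r)%N)%:E <= eps%:E)%E.
Proof.
move=> u0 us e0.
have u0' n : (0 <= (u n)%:E)%E by rewrite lee_fin.
have /fine_cvgP[fin cv] := nneseries_tail_cvg us (fun n _ => u0' n).
have /cvgr0Pnorm_le /(_ _ e0) sm := cv.
have [J _ HJ] : \forall r \near \oo, (\sum_(r <= k <oo) (u k)%:E <= eps%:E)%E.
  near=> r.
  have fr : (\sum_(r <= k <oo) (u k)%:E)%E \is a fin_num by near: r.
  rewrite -(fineK fr) lee_fin; apply: le_trans (ler_norm _) _.
  by near: r.
exists J => r Jr; rewrite (@nneseries_addn _ (fun n => (u n)%:E) r) //.
exact: HJ.
Unshelve. all: by end_near.
Qed.

End RealSeries.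

(** * A sequence avoiding forbidden prefixes *)

Section PrefixAvoidance.
Variables (R : realType) (T : eqType) (W : seq T) (p : T -> R).
Hypothesis W_uniq : uniq W.
Hypothesis p_ge0 : forall v, 0 <= p v.
Hypothesis p_sum : \sum_(v <- W) p v = 1.

(* The probability, for the Bernoulli measure with weights [p], that a sequence
   starting with [b] also starts with [u]. *)
Fixpoint prefix_prob (u b : seq T) : R :=
  match u, b with
  | [::], _ => 1
  | v :: u', [::] => p v * prefix_prob u' [::]
  | v :: u', v' :: b' => (v == v')%:R * prefix_prob u' b'
  end.

Lemma prefix_prob_ge0 u b : 0 <= prefix_prob u b.
Proof. by elim: u b => [|v u IH] [|v' b] //=; rewrite mulr_ge0. Qed.

Lemma prefix_probE u : prefix_prob u [::] = \prod_(v <- u) p v.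
Proof. by elim: u => [|v u IH] /=; rewrite ?big_nil ?big_cons ?IH. Qed.

Lemma prefix_prob_refl u : prefix_prob u u = 1.
Proof. by elim: u => //= v u ->; rewrite eqxx mul1r. Qed.

(** Conditional probabilities form a martingale when a letter drawn from [p] is appended. In general
    only an inequality holds, because [u] may contain letters outside [W], which are never drawn. *)
Lemma prefix_prob_rcons u b :
  \sum_(v <- W) p v * prefix_prob u (rcons b v) <= prefix_prob u b.
Proof.
elim: u b => [|v u IH] [|v' b] /=.
- by under eq_bigr do rewrite mulr1; rewrite p_sum.
- by under eq_bigr do rewrite mulr1; rewrite p_sum.
- have [vW|vW] := boolP (v \in W).
    rewrite (bigD1_seq v) //= eqxx mul1r big1 ?addr0 // => w /negbTE wv.
    by rewrite eq_sym wv mul0r mulr0.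
  rewrite big_seq big1 ?mulr_ge0 ?prefix_prob_ge0 // => w wW.
  by rewrite (_ : (v == w) = false) ?mul0r ?mulr0 //; apply: contraNF vW => /eqP->.
- under eq_bigr do rewrite mulrCA.
  by rewrite -mulr_sumr ler_wpM2l.
Qed.

(* A sequence avoiding all the prefixes is chosen letter by letter, keeping
   the conditional expected number of hit prefixes below 1. *)
Lemma avoid_prefixes (u : nat -> seq T) :
  (\sum_(0 <= n <oo) (\prod_(v <- u n) p v)%:E < 1)%E ->
  exists beta : nat -> T, (forall k, 0 < p (beta k) /\ beta k \in W) /\
    forall n, mkseq beta (size (u n)) <> u n.
Proof.
move=> u1; pose Q b := (\sum_(0 <= n <oo) (prefix_prob (u n) b)%:E)%E.
have ge0 b n : (0 <= (prefix_prob (u n) b)%:E)%E by rewrite lee_fin prefix_prob_ge0.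
have Q0 b : (0 <= Q b)%E by exact: nneseries_ge0.
have Q_nil : (Q [::] < 1)%E.
  by rewrite /Q; under eq_eseriesr do rewrite prefix_probE.
have step b : exists v, (Q b < 1)%E -> [/\ 0 < p v, v \in W & (Q (rcons b v) < 1)%E].
  have [Qb|] := boolP (Q b < 1)%E; last first.
    have : W != [::] by apply: contra_eq_neq p_sum => ->; rewrite big_nil eq_sym oner_eq0.
    by rewrite -size_eq0 -lt0n -has_predT => /hasP[v _ _] _; exists v.
  (* If no letter of positive weight kept [Q] below 1, averaging over the next letter would give
     [Q b >= 1]. *)
  apply: contrapT => /forallNP H.
  have {}H v : v \in W -> ((p v)%:E <= (p v)%:E * Q (rcons b v))%E.
    move=> vW; have := p_ge0 v; rewrite le_eqVlt => /predU1P[<-|pv].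
      by rewrite mul0e.
    rewrite -[leLHS]mule1 lee_pmul2l ?lte_fin // leNgt; apply/negP => Qv.
    by apply: (H v) => _; split.
  have : (1 <= Q b)%E.
    apply: (@le_trans _ _ (\sum_(v <- W) (p v)%:E * Q (rcons b v))%E).
      by rewrite -p_sum -sumEFin big_seq [leRHS]big_seq; apply: lee_sum => v /H.
    rewrite /Q (eq_bigr (fun v =>
      (\sum_(0 <= n <oo) (p v * prefix_prob (u n) (rcons b v))%:E)%E)); last first.
      by move=> v _; rewrite -nneseriesZl //; apply: eq_eseriesr => n _; rewrite EFinM.
    rewrite -nneseries_sum; last by move=> *; rewrite lee_fin mulr_ge0 ?prefix_prob_ge0.
    apply: lee_nneseries => [n _ _|n _].
      by apply: sume_ge0 => *; rewrite lee_fin mulr_ge0 ?prefix_prob_ge0.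
    by rewrite sumEFin lee_fin; exact: prefix_prob_rcons.
  by rewrite leNgt Qb.
have /choice[F HF] := step.
pose fix bs k := if k is k'.+1 then rcons (bs k') (F (bs k')) else [::].
have Qbs k : (Q (bs k) < 1)%E by elim: k => //= k /HF[].
pose beta k := F (bs k).
have bsE k : bs k = mkseq beta k by elim: k => //= k IH; rewrite mkseqS -IH.
exists beta; split => [k|n E]; first by have [] := HF _ (Qbs k).
(* A prefix that has been read completely contributes 1 to [Q]. *)
have := Qbs (size (u n)); rewrite bsE E; apply/negP; rewrite -leNgt /Q.
rewrite (@nneseriesD1 _ _ n) // prefix_prob_refl leeDl //; exact: nneseries_ge0.
Qed.

End PrefixAvoidance.

(** * Word sums *)

Section Words.
Variable m : nat.
Local Notation letter := 'I_m.+2.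
Local Notation shift := (@Defs.shift m).
Implicit Types (u v w : seq letter) (x y : symbol_seq m).

Fixpoint words n : seq (seq letter) :=
  if n is n'.+1 then [seq i :: w | i <- enum letter, w <- words n'] else [:: [::]].

Lemma mem_words n w : (w \in words n) = (size w == n).
Proof.
elim: n w => [|n IH] [|i w] //=.
- by apply/allpairsP => -[[j v]] [].
- apply/allpairsP/idP => [[[j v] /= [_ vn [_ ->]]]|sw].
    by rewrite eqSS -IH.
  by exists (i, w); rewrite /= mem_enum IH -eqSS.
Qed.

Lemma uniq_words n : uniq (words n).
Proof.
elim: n => //= n IH; apply: allpairs_uniq => //; first exact: enum_uniq.
by move=> [i u] [j v] _ _ [-> ->].
Qed.

Lemma big_wordsS (V : nmodType) n (f : seq letter -> V) :
  \sum_(w <- words n.+1) f w = \sum_(i : letter) \sum_(w <- words n) f (i :: w).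
Proof. by rewrite /= big_allpairs_dep /= big_enum. Qed.

Lemma big_words_cat (V : nmodType) n r (f : seq letter -> V) :
  \sum_(w <- words (n + r)) f w =
  \sum_(u <- words n) \sum_(v <- words r) f (u ++ v).
Proof.
elim: n f => [|n IH] f; first by rewrite big_seq1.
rewrite addSn !big_wordsS; apply: eq_bigr => i _.
by rewrite IH; apply: eq_bigr.
Qed.

Lemma iter_shiftE k x n : iter k shift x n = x (k + n)%N.
Proof. by elim: k x n => [|k IH] x n //=; rewrite /shift IH addnS. Qed.

Definition prepend w x : symbol_seq m :=
  fun n => if (n < size w)%N then nth ord0 w n else x (n - size w)%N.

Lemma mkseq_prepend w x : mkseq (prepend w x) (size w) = w.
Proof.
apply: (@eq_from_nth _ ord0); rewrite size_mkseq // => i iw.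
by rewrite nth_mkseq // /prepend iw.
Qed.

Lemma cylinder_prepend w x : cylinder w (prepend w x).
Proof. exact: mkseq_prepend. Qed.

Lemma mkseqD (T : Type) (f : nat -> T) n r :
  mkseq f (n + r) = mkseq f n ++ mkseq (fun i => f (n + i)%N) r.
Proof. by rewrite /mkseq iotaD map_cat add0n -{2}[n]addn0 iotaDl -map_comp. Qed.

Lemma take_mkseq (T : Type) (f : nat -> T) n r : (n <= r)%N ->
  take n (mkseq f r) = mkseq f n.
Proof. by move=> nr; rewrite -(subnKC nr) mkseqD take_size_cat ?size_mkseq. Qed.

Lemma mkseq_shift x n r :
  mkseq x (n + r) = mkseq x n ++ mkseq (iter n shift x) r.
Proof. by rewrite mkseqD; congr (_ ++ _); apply: eq_mkseq => i; rewrite iter_shiftE. Qed.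

Lemma mkseq_cons x n : mkseq x n.+1 = x 0%N :: mkseq (shift x) n.
Proof. by rewrite /mkseq /= (iotaDl 1 0) -map_comp. Qed.

Lemma cylinder_cat u v x :
  cylinder (u ++ v) x <-> cylinder u x /\ cylinder v (iter (size u) shift x).
Proof.
rewrite /cylinder /= size_cat mkseq_shift; split => [/eqP|[-> ->] //].
by rewrite eqseq_cat ?size_mkseq // => /andP[/eqP-> /eqP->].
Qed.

Lemma cylinder_mkseq x n : cylinder (mkseq x n) x.
Proof. by rewrite /cylinder /= size_mkseq. Qed.

Section WordSums.
Variable R : realType.

Lemma birkhoffD (f : symbol_seq m -> R) n r x :
  birkhoff f (n + r) x = birkhoff f n x + birkhoff f r (iter n shift x).
Proof.
rewrite /birkhoff big_split_ord /=; congr (_ + _); apply: eq_bigr => i _.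
by rewrite addnC iterD.
Qed.

Lemma esum_words (P : pred (seq letter)) (f : seq letter -> R) : (forall w, 0 <= f w) ->
  (\esum_(w in [set w | P w]) (f w)%:E =
   \sum_(0 <= n <oo) (\sum_(w <- words n | P w) f w)%:E)%E.
Proof.
move=> f0; rewrite (_ : [set w | P w] = \bigcup_n [set w | size w = n /\ P w]); last first.
  by apply/seteqP; split => [w Pw|w [n _ []] //]; exists (size w).
rewrite nneseries_sum_bigcup; last by move=> w; rewrite lee_fin.
  apply: eq_eseriesr => n _.
  rewrite (_ : [set w | _ /\ _] = [set` [seq w <- words n | P w]]); last first.
    apply/seteqP; split => w /=; rewrite mem_filter mem_words.
      by move=> [-> ->]; rewrite eqxx.
    by move=> /andP[-> /eqP].
  rewrite esum_fset; [|exact: finite_seq|by move=> w _; rewrite lee_fin].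
  rewrite -fsbig_seq; last by rewrite filter_uniq // uniq_words.
  by rewrite big_filter sumEFin.
by move=> i j _ _ [w [[<- _] [<- _]]].
Qed.

(* Splitting off the first [N] letters bounds the partial sums over lengths
   below [k * N] recursively in [k]. *)
Lemma submultiplicative_series (f : seq letter -> R) N :
  (forall w, 0 <= f w) -> (forall u v, f (u ++ v) <= f u * f v) ->
  (0 < N)%N -> \sum_(w <- words N) f w < 1 ->
  (\sum_(0 <= n <oo) (\sum_(w <- words n) f w)%:E < +oo)%E.
Proof.
move=> f0 fM N0; set Y := fun n => \sum_(w <- words n) f w.
rewrite -/(Y N) => YN1.
have Y0 n : 0 <= Y n by exact: sumr_ge0.
have YM n r : Y (n + r)%N <= Y n * Y r.
  rewrite /Y big_words_cat mulr_suml; apply: ler_sum => u _.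
  by rewrite mulr_sumr; apply: ler_sum => v _.
pose B := \sum_(0 <= i < N) Y i.
have B0 : 0 <= B by exact: sumr_ge0.
(* The bound is the fixed point of [x |-> B + Y N * x], where [B] collects the lengths below [N]. *)
have HB k : \sum_(0 <= i < k * N) Y i <= B / (1 - Y N).
  elim: k => [|k IH]; first by rewrite big_geq // divr_ge0 // subr_ge0 ltW.
  rewrite mulSn (@big_cat_nat _ _ _ N) //= ?leq_addr // -/B.
  rewrite -{1}[N]add0n big_addn addKn.
  apply: (@le_trans _ _ (B + Y N * (B / (1 - Y N)))).
    rewrite lerD2l; apply: le_trans (ler_wpM2l (Y0 N) IH).
    by rewrite mulr_sumr ler_sum // => i _; rewrite addnC.
  by rewrite le_eqVlt; apply/orP; left; apply/eqP; field; rewrite subr_eq0 gt_eqF.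
apply: (@le_lt_trans _ _ (B / (1 - Y N))%:E); last exact: ltry.
apply: lee_series_bounded => // n; apply: le_trans (HB n).
rewrite [leRHS](@big_cat_nat _ _ _ n) //= ?leq_pmulr // lerDl; exact: sumr_ge0.
Qed.

End WordSums.

Section Walk.
Variables (t : letter -> int) (M : nat).
Hypothesis t_bound : forall i, (`|t i| <= M)%N.

Definition walk w : int := \sum_(i <- w) t i.

Lemma walk_cat u v : walk (u ++ v) = walk u + walk v.
Proof. exact: big_cat. Qed.

Lemma walk_cons i w : walk (i :: w) = t i + walk w.
Proof. exact: big_cons. Qed.

Lemma walk_nseq n i : walk (nseq n i) = t i *+ n.
Proof. by rewrite /walk big_nseq iter_addr_0. Qed.

Lemma walk_bound w : (`|walk w| <= M * size w)%N.
Proof.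
elim: w => [|i w IH]; first by rewrite /walk big_nil.
by rewrite walk_cons /=; have := t_bound i; nia.
Qed.

Lemma walk_mkseqS x n : walk (mkseq x n.+1) = walk (mkseq x n) + t (x n).
Proof. by rewrite -[in LHS](addn1 n) mkseqD walk_cat /= /walk big_seq1 addn0. Qed.

End Walk.

Lemma walkN (t : letter -> int) w : walk (fun i => - t i) w = - walk t w.
Proof. by rewrite /walk sumrN. Qed.

(** * Weighted sums over words *)

Section WeightSums.
Variable R : realType.
Variables (phi : symbol_seq m -> R) (lam D : R).
Hypothesis lam_gt0 : 0 < lam.
Hypothesis phi_le : forall x, phi x <= - lam.
Hypothesis distortion : forall w x y, cylinder w x -> cylinder w y ->
  birkhoff phi (size w) x <= birkhoff phi (size w) y + D.

Local Notation S := (sup_birkhoff phi).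

Lemma birkhoff_le n x : birkhoff phi n x <= - (lam * n%:R).
Proof.
rewrite /birkhoff; apply: (@le_trans _ _ (\sum_(k < n) (- lam))); first exact: ler_sum.
by rewrite sumr_const card_ord mulNrn mulr_natr.
Qed.

Let has_sup_birkhoff w : has_sup [set birkhoff phi (size w) x | x in cylinder w].
Proof.
split; first by exists (birkhoff phi (size w) (prepend w (fun=> ord0)));
  exists (prepend w (fun=> ord0)) => //; exact: cylinder_prepend.
by exists (- (lam * (size w)%:R)) => _ [x _ <-]; exact: birkhoff_le.
Qed.

Lemma birkhoff_le_sup w x : cylinder w x -> birkhoff phi (size w) x <= S w.
Proof. by move=> wx; apply: ub_le_sup; [have [] := has_sup_birkhoff w|exists x]. Qed.

Lemma sup_birkhoff_le w c :
  (forall x, cylinder w x -> birkhoff phi (size w) x <= c) -> S w <= c.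
Proof.
move=> H; apply: ge_sup; first by have [] := has_sup_birkhoff w.
by move=> _ [x wx <-]; exact: H.
Qed.

Lemma sup_birkhoff_le_birkhoff w x : cylinder w x -> S w <= birkhoff phi (size w) x + D.
Proof. by move=> wx; apply: sup_birkhoff_le => y wy; exact: distortion. Qed.

Lemma sup_birkhoff_le_size w : S w <= - (lam * (size w)%:R).
Proof. by apply: sup_birkhoff_le => x _; exact: birkhoff_le. Qed.

Lemma sup_birkhoff_cat_le u v : S (u ++ v) <= S u + S v.
Proof.
apply: sup_birkhoff_le => x /cylinder_cat[ux vx].
by rewrite size_cat birkhoffD lerD // birkhoff_le_sup.
Qed.

Lemma sup_birkhoff_cat_ge u v : S u + S v <= S (u ++ v) + D *+ 2.
Proof.
set x := prepend (u ++ v) (fun=> ord0).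
have xuv : cylinder (u ++ v) x by exact: cylinder_prepend.
have [ux vx] := (cylinder_cat _ _ _).1 xuv.
have := birkhoff_le_sup xuv; rewrite size_cat birkhoffD.
have := sup_birkhoff_le_birkhoff ux; have := sup_birkhoff_le_birkhoff vx.
rewrite mulr2n; lra.
Qed.

Implicit Types (P Q T : pred (seq letter)) (s : R) (n r : nat).

Definition weight_sum s n P := \sum_(w <- words n | P w) expR (s * S w).
Local Notation Z := weight_sum.

Lemma weight_sum_ge0 s n P : 0 <= Z s n P.
Proof. by apply: sumr_ge0 => *; exact: expR_ge0. Qed.

Lemma weight_sum_sub s n P Q : (forall w, size w = n -> P w -> Q w) -> Z s n P <= Z s n Q.
Proof.
move=> PQ; rewrite /Z [leLHS]big_seq_cond [leRHS]big_seq_cond.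
rewrite [leLHS]big_mkcond [leRHS]big_mkcond; apply: ler_sum => w _.
case: ifPn => [/andP[]|_]; last by case: ifP => // _; exact: expR_ge0.
rewrite mem_words => /eqP wn /(PQ _ wn) Qw.
by rewrite wn eqxx Qw.
Qed.

Lemma weight_sum_ge_word s P w : P w -> expR (s * S w) <= Z s (size w) P.
Proof.
move=> Pw; rewrite /Z big_mkcond (bigD1_seq w) ?mem_words ?uniq_words //= Pw.
by rewrite lerDl sumr_ge0 // => v _; case: ifP => // _; exact: expR_ge0.
Qed.

(** Since [S w <= - (lam * n)] on words of length [n], lowering the exponent multiplies every term
    by an exponentially large factor. *)
Lemma weight_sum_gain s s' n P : s <= s' ->
  expR ((s' - s) * lam * n%:R) * Z s' n P <= Z s n P.
Proof.
move=> ss'; rewrite /Z mulr_sumr big_seq_cond [leRHS]big_seq_cond.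
apply: ler_sum => w; rewrite mem_words => /andP[/eqP wn _].
rewrite -expRD ler_expR -subr_ge0.
have := sup_birkhoff_le_size w; rewrite wn => Sw.
have -> : s * S w - ((s' - s) * lam * n%:R + s' * S w) =
  (s' - s) * (- (lam * n%:R) - S w) by ring.
by rewrite mulr_ge0 ?subr_ge0.
Qed.

(** Fixed lengths make the splitting of a word unique, so no word on the right is counted twice. The
    factor is the distortion loss of [sup_birkhoff_cat_ge]. *)
Lemma weight_sum_cat s n r P Q T : 0 <= s ->
  (forall u v, size u = n -> size v = r -> P u -> Q v -> T (u ++ v)) ->
  Z s n P * Z s r Q <= expR (s * D *+ 2) * Z s (n + r) T.
Proof.
move=> s0 H.
rewrite /Z [X in _ <= _ * X]big_mkcond big_words_cat /= mulr_suml [leRHS]mulr_sumr.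
rewrite [leLHS]big_mkcond big_seq [leRHS]big_seq; apply: ler_sum => u.
rewrite mem_words => /eqP un.
case: ifPn => Pu; last first.
  rewrite mulr_ge0 ?expR_ge0 // sumr_ge0 // => v _; case: ifP => // _; exact: expR_ge0.
rewrite mulr_sumr mulr_sumr big_mkcond big_seq [leRHS]big_seq; apply: ler_sum => v.
rewrite mem_words => /eqP vr; case: ifPn => Qv; last first.
  by rewrite mulr_ge0 ?expR_ge0 //; case: ifP => // _; exact: expR_ge0.
rewrite H // -!expRD ler_expR -mulrDr -mulrnAr -mulrDr ler_wpM2l //.
by rewrite addrC [leRHS]addrC addrC; exact: sup_birkhoff_cat_ge.
Qed.

Lemma sup_birkhoff_nil : S [::] = 0.
Proof.
have h (x : symbol_seq m) : birkhoff phi 0 x = 0 by rewrite /birkhoff big_ord0.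
apply/eqP; rewrite eq_le; apply/andP; split; first by apply: sup_birkhoff_le => x _; rewrite h.
by rewrite -(h (fun=> ord0)); exact: (@birkhoff_le_sup [::]).
Qed.

(** If the sums at [s] stayed below [C], those at [s'] would decay geometrically. *)
Lemma weight_sum_unbounded s s' P : s < s' ->
  (\sum_(0 <= n <oo) (Z s' n P)%:E = +oo)%E ->
  forall C, exists n, C <= Z s n P.
Proof.
move=> ss' H C; apply: contrapT => /forallNP nH.
have k0 : 0 < (s' - s) * lam by rewrite mulr_gt0 ?subr_gt0.
suff : (\sum_(0 <= n <oo) (Z s' n P)%:E < +oo)%E by rewrite H ltxx.
apply: (@geometric_series_lt_pinfty _ _ C (expR (- ((s' - s) * lam)))).
- exact: expR_ge0.
- by rewrite expR_lt1 oppr_lt0.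
- by move=> n; exact: weight_sum_ge0.
- move=> n; have /negP := nH n; rewrite -ltNge => /ltW ZC.
  have := weight_sum_gain n P (ltW ss').
  rewrite -expRM_natr mulNr expRN => /le_trans/(_ ZC).
  by rewrite -ler_pdivlMl ?expR_gt0 // mulrC.
Qed.

Section WalkSums.
Variable t : letter -> int.
Variable M : nat.
Hypothesis t_bound : forall i, (`|t i| <= M)%N.

Local Notation W := (walk t).

(* Weighting words by [theta ^ |walk w|] interpolates between the words with
   zero walk ([theta = 0]) and all words, and stays submultiplicative. *)
Lemma weight_sum_zero_steps_ge1 s K : 0 <= s ->
  (forall i, t i <= 0) ->
  (\sum_(0 <= n <oo) (Z s n (fun w => `|W w| <= K)%N)%:E = +oo)%E ->
  forall n, (0 < n)%N -> 1 <= Z s n (fun w => 0 <= W w).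
Proof.
move=> s0 t0 H n n0; rewrite leNgt; apply/negP => Zn1.
have W0 w : W w <= 0 by apply: sumr_le0.
set z := Z s n _ in Zn1; pose A := Z s n predT.
have A0 : 0 <= A by exact: weight_sum_ge0.
(* Small enough that [z + th * A < 1]: at length [n] the words of zero walk contribute [z], and
   every other word carries at least one factor [th]. *)
pose th := (1 - z) / (2 * (A + 1)).
have z0 : 0 <= z by exact: weight_sum_ge0.
have th0 : 0 < th by rewrite divr_gt0 ?subr_gt0 // mulr_gt0 // ltr_wpDl.
have thA : th * A < 1 - z.
  by rewrite /th mulrAC ltr_pdivrMr ?mulr_gt0 ?ltr_wpDl //; nra.
have th1 : th <= 1 by rewrite /th ler_pdivrMr ?mulr_gt0 ?ltr_wpDl //; nra.
pose f w := expR (s * S w) * th ^+ `|W w|%N.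
have f0 w : 0 <= f w by rewrite mulr_ge0 ?expR_ge0 ?exprn_ge0 // ltW.
suff : (\sum_(0 <= r <oo) (\sum_(w <- words r) f w)%:E < +oo)%E.
  move=> Hf; suff : (\sum_(0 <= n <oo) (Z s n (fun w => `|W w| <= K)%N)%:E < +oo)%E.
    by rewrite H ltxx.
  (* Words whose walk has absolute value at most [K] keep at least the fraction [th ^+ K] of their
     weight in [f]. *)
  apply: (@le_lt_trans _ _ (\sum_(0 <= r <oo) ((th ^- K)%:E * (\sum_(w <- words r) f w)%:E))%E).
    apply: lee_nneseries => [r _ _|r _]; first by rewrite lee_fin weight_sum_ge0.
    rewrite -EFinM lee_fin mulr_sumr /Z big_mkcond; apply: ler_sum => w _.
    case: ifPn => WK; last by rewrite mulr_ge0 // invr_ge0 exprn_ge0 // ltW.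
    rewrite /f mulrCA ler_peMr ?expR_ge0 // ler_pdivlMl ?exprn_gt0 // mulr1.
    by rewrite ler_wiXn2l // ltW.
  rewrite nneseriesZl; last by move=> r _; rewrite lee_fin sumr_ge0.
  by rewrite lte_mul_pinfty // lee_fin invr_ge0 exprn_ge0 // ltW.
apply: (@submultiplicative_series _ _ n) => //.
- move=> u v; rewrite /f mulrACA -expRD -mulrDr -exprD.
  (* No step is positive, so walks add up without cancellation. *)
  rewrite (_ : `|W (u ++ v)|%N = (`|W u| + `|W v|)%N); last first.
    by rewrite walk_cat; have := W0 u; have := W0 v; lia.
  rewrite ler_wpM2r ?exprn_ge0 ?(ltW th0) // ler_expR ler_wpM2l //.
  exact: sup_birkhoff_cat_le.
- apply: (@le_lt_trans _ _ (z + th * A)); last by lra.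
  rewrite /z /A /Z [X in _ <= X + _]big_mkcond mulr_sumr -big_split /=.
  apply: ler_sum => w _; rewrite /f; case: ifPn => Ww.
    rewrite (_ : W w = 0); last by apply/eqP; rewrite eq_le W0.
    by rewrite expr0 mulr1 lerDl mulr_ge0 ?expR_ge0 // ltW.
  rewrite add0r mulrC ler_wpM2r ?expR_ge0 //.
  have : (0 < `|W w|)%N by move: Ww; have := W0 w; lia.
  by move=> Wp; rewrite -[leRHS]expr1 ler_wiXn2l // ltW.
Qed.

Lemma weight_sum_le_sum s n (N : nat) (Q : nat -> pred (seq letter)) P :
  (forall w, size w = n -> P w -> exists2 j, (j < N)%N & Q j w) ->
  Z s n P <= \sum_(j < N) Z s n (Q j).
Proof.
move=> H; rewrite /Z; under [leRHS]eq_bigr do rewrite big_mkcond.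
rewrite exchange_big /= big_mkcond big_seq [leRHS]big_seq; apply: ler_sum => w.
rewrite mem_words => /eqP wn; case: ifPn => [Pw|_]; last first.
  by rewrite sumr_ge0 // => j _; case: ifP => // _; exact: expR_ge0.
have [j jN Qj] := H _ wn Pw.
rewrite (bigD1 (Ordinal jN)) //= Qj lerDl sumr_ge0 // => k _.
by case: ifP => // _; exact: expR_ge0.
Qed.

Lemma weight_sum_append_letter s n i P Q : 0 <= s ->
  (forall w, size w = n -> P w -> Q (rcons w i)) ->
  expR (s * S [:: i]) * expR (- (s * D *+ 2)) * Z s n P <= Z s n.+1 Q.
Proof.
move=> s0 H; rewrite mulrAC expRN ler_pdivrMr ?expR_gt0 // mulrC [leRHS]mulrC.
apply: le_trans; last first.
  have := @weight_sum_cat s n 1 P (pred1 [:: i]) Q s0; rewrite addn1; apply.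
  by move=> u v un _ Pu /eqP->; rewrite cats1; exact: H.
rewrite ler_wpM2l ?weight_sum_ge0 //.
by apply: (@weight_sum_ge_word s (pred1 [:: i]) [:: i]); rewrite /= eqxx.
Qed.

(* Appending copies of a letter with positive step costs a bounded factor. *)
Lemma weight_sum_boost s i (K B : int) : 0 <= s -> 0 < t i ->
  (forall C, exists n, C <= Z s n (fun w => K <= W w)) ->
  forall C, exists n, C <= Z s n (fun w => B <= W w).
Proof.
move=> s0 ti H C.
have [BK|] := leP B K.
  have [n Cn] := H C; exists n; apply: le_trans Cn _.
  by apply: weight_sum_sub => w _; exact: le_trans.
move: {2}`|B - K|%N (leqnn `|B - K|%N) => k; elim: k B C => [|k IH] B C Bk KB.
  by exfalso; lia.
have {}IH C' : exists n, C' <= Z s n (fun w => B - 1 <= W w).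
  have [BK|KB1] := leP (B - 1) K; last by apply: IH => //; lia.
  have [n Cn] := H C'; exists n; apply: le_trans Cn _.
  by apply: weight_sum_sub => w _; exact: le_trans.
pose c := expR (s * S [:: i]) * expR (- (s * D *+ 2)).
have c0 : 0 < c by rewrite mulr_gt0 ?expR_gt0.
have [n Cn] := IH (C / c); exists n.+1.
apply: le_trans; last first.
  apply: (@weight_sum_append_letter s n i (fun w => B - 1 <= W w)) => //.
  move=> w _; rewrite -cats1 walk_cat /walk big_seq1; lia.
by rewrite -/c -ler_pdivrMl // mulrC.
Qed.

(** A walk of [N] steps can take at most [M * N] negative values. *)
Lemma weight_sum_pigeonhole s N (C : R) :
  (C * (M * N)%:R < Z s N (fun w => W w <= -1)) ->
  exists2 a : nat, (0 < a)%N & C <= Z s N (fun w => W w == - a%:Z).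
Proof.
move=> H; apply: contrapT => nH.
have : Z s N (fun w => W w <= -1) <=
    \sum_(j < M * N) Z s N (fun w => W w == - j.+1%:Z).
  apply: (@weight_sum_le_sum s N _ (fun j w => W w == - j.+1%:Z)) => w wN w1.
  exists (`|W w|.-1)%N; last by lia.
  by have := walk_bound t_bound w; rewrite wN; lia.
apply/negP; rewrite -ltNge; apply: le_lt_trans H.
apply: (@le_trans _ _ (\sum_(j < M * N) C)); last by rewrite sumr_const card_ord mulr_natr.
apply: ler_sum => j _; rewrite leNgt; apply/negP => CZ; apply: nH.
by exists j.+1 => //; exact: ltW.
Qed.

Section Null.
Variable s : R.
Hypothesis s_ge0 : 0 <= s.

(** Symbolic counterpart of Hausdorff nullity: a cover by cylinders is given as the predicate of its
    words, and [expR (s * S w)] stands for the diameter to the power [s]. *)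
Definition cylinder_null (E : set (symbol_seq m)) := forall eps : R, 0 < eps ->
  exists P : pred (seq letter), (forall x, E x -> exists n, P (mkseq x n)) /\
    (\sum_(0 <= n <oo) (Z s n P)%:E <= eps%:E)%E.

Lemma weight_sum_size_eq N P :
  (\sum_(0 <= n <oo) (Z s n (fun w => (size w == N) && P w))%:E = (Z s N P)%:E)%E.
Proof.
rewrite (@nneseriesD1 _ _ N) //=; last by move=> *; rewrite lee_fin weight_sum_ge0.
rewrite eseries0 ?adde0; last first.
  move=> n _ /= nN; rewrite /Z big_seq_cond big1 // => w.
  by rewrite mem_words => /and3P[/eqP -> /eqP nN']; rewrite nN' eqxx in nN.
congr (_%:E); rewrite /Z big_seq_cond [RHS]big_seq_cond; apply: eq_bigl => w.
by rewrite mem_words; case: eqP.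
Qed.

Lemma cylinder_null_fixed_length (E : set (symbol_seq m)) (P : pred (seq letter)) :
  (forall x n, E x -> P (mkseq x n)) ->
  (forall eps : R, 0 < eps -> exists n, Z s n P <= eps) -> cylinder_null E.
Proof.
move=> EP H eps e0; have [N ZN] := H _ e0.
exists (fun w => (size w == N) && P w); split.
  by move=> x Ex; exists N; rewrite size_mkseq eqxx EP.
by rewrite weight_sum_size_eq lee_fin.
Qed.

Let b n := Z s n (fun w => (`|W w| <= M)%N).
Hypothesis b_summable : (\sum_(0 <= n <oo) (b n)%:E < +oo)%E.

(** Appending copies of the descending letter [i] carries a fixed level down into the window of
    radius [M] at a bounded cost, so each level inherits summability from [b]. *)
Lemma summable_window (i : letter) (k : nat) : t i < 0 ->
  (\sum_(0 <= n <oo) (Z s n (fun w => (0 <= W w) && (W w <= k%:Z)))%:E < +oo)%E.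
Proof.
move=> ti.
have level (j : nat) :
    (\sum_(0 <= n <oo) (Z s n (fun w => W w == j%:Z))%:E < +oo)%E.
  (* The remainder left after [r] descents is smaller than the size of [t i], hence at most [M]. *)
  pose r := (j %/ `|t i|)%N; pose v := nseq r i.
  have vW : W v = - (r * `|t i|)%:Z by rewrite walk_nseq; lia.
  have rM : (j - r * `|t i| <= M)%N.
    have := t_bound i; have := divn_eq j `|t i|; have := @ltn_pmod j `|t i|%N.
    rewrite -/r; lia.
  have rj : (r * `|t i| <= j)%N by rewrite /r leq_divM.
  pose c := expR (s * S v) * expR (- (s * D *+ 2)).
  have c0 : 0 < c by rewrite mulr_gt0 ?expR_gt0.
  apply: (@le_lt_trans _ _ (\sum_(0 <= n <oo) (c^-1%:E * (b (n + r))%:E))%E).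
    apply: lee_nneseries => [n _ _|n _]; first by rewrite lee_fin weight_sum_ge0.
    rewrite -EFinM lee_fin ler_pdivlMl // /c mulrAC expRN ler_pdivrMr ?expR_gt0 //.
    rewrite mulrC [leRHS]mulrC; apply: le_trans; last first.
      apply: (@weight_sum_cat s n r (fun w => W w == j%:Z) (pred1 v)) => //.
      move=> u v' _ _ /eqP Wu /eqP->; rewrite walk_cat Wu vW; lia.
    rewrite ler_wpM2l ?weight_sum_ge0 //.
    rewrite (_ : r = size v); last by rewrite size_nseq.
    by apply: (@weight_sum_ge_word s (pred1 v)); rewrite /= eqxx.
  rewrite nneseriesZl; last by move=> *; rewrite lee_fin weight_sum_ge0.
  rewrite lte_mul_pinfty // ?lee_fin ?invr_ge0 ?(ltW c0) //.
  apply: le_lt_trans b_summable; apply: series_shift_le => n.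
  exact: weight_sum_ge0.
elim: k => [|k IH].
  apply: le_lt_trans (level 0%N); apply: lee_nneseries => [n _ _|n _].
    by rewrite lee_fin weight_sum_ge0.
  by rewrite lee_fin; apply: weight_sum_sub => w _; lia.
apply: (@le_lt_trans _ _ (\sum_(0 <= n <oo) ((Z s n (fun w => (0 <= W w) && (W w <= k%:Z)))%:E +
   (Z s n (fun w => W w == k.+1%:Z))%:E))%E).
  apply: lee_nneseries => [n _ _|n _]; first by rewrite lee_fin weight_sum_ge0.
  rewrite -EFinD lee_fin.
  apply: (@le_trans _ _ (\sum_(j < 2) Z s n (if j == 0 :> nat
      then fun w => (0 <= W w) && (W w <= k%:Z) else fun w => W w == k.+1%:Z))).
    apply: (@weight_sum_le_sum s n 2 (fun j => if j == 0%N
      then fun w => (0 <= W w) && (W w <= k%:Z) else fun w => W w == k.+1%:Z)).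
    move=> w _ kw; have [wk|wk] := boolP (W w <= k%:Z).
      by exists 0%N => //=; move: kw => /andP[-> _].
    by exists 1%N => //=; lia.
  by rewrite !big_ord_recl big_ord0 addr0.
rewrite nneseriesD => [|n _ _|n _ _]; try by rewrite lee_fin weight_sum_ge0.
by rewrite lte_add_pinfty.
Qed.

Lemma cylinder_null_bounded_walk (i : letter) (k : nat) : t i < 0 ->
  cylinder_null [set x | forall n, 0 <= W (mkseq x n) <= k%:Z].
Proof.
move=> ti.
apply: (@cylinder_null_fixed_length _ (fun w => (0 <= W w) && (W w <= k%:Z))) => [x n|].
  exact.
apply: small_term; last exact: (summable_window k ti).
by move=> n; exact: weight_sum_ge0.
Qed.

(** The threshold [expR (s * D *+ 2)] is exactly the loss of one concatenation, so repeating the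
    descent never lets the weight fall below 1. *)
Lemma weight_sum_pow N (a : nat) j :
  expR (s * D *+ 2) <= Z s N (fun w => W w == - a%:Z) ->
  1 <= Z s (j * N) (fun w => W w == - (j * a)%:Z).
Proof.
move=> H; elim: j => [|j IH].
  have := @weight_sum_ge_word s (fun w => W w == - (0 * a)%:Z) [::].
  by rewrite sup_birkhoff_nil mulr0 expR0; apply; rewrite /walk big_nil.
have := @weight_sum_cat s N (j * N) (fun w => W w == - a%:Z)
  (fun w => W w == - (j * a)%:Z) (fun w => W w == - (j.+1 * a)%:Z) s_ge0.
rewrite -mulSn => HZ.
rewrite -(ler_pM2l (expR_gt0 (s * D *+ 2))) mulr1.
apply: le_trans H _; apply: le_trans (HZ _).
  by rewrite ler_peMr // weight_sum_ge0.
move=> u v _ _ /eqP Wu /eqP Wv; rewrite walk_cat Wu Wv; lia.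
Qed.

(* Concatenating a word reaching level [j a] with one descending by [j a]
   gives a word returning to a neighbourhood of 0; hence the words reaching
   high levels are controlled by the tail of the convergent series [b]. *)
Lemma cylinder_null_unbounded_walk N (a : nat) : (0 < N)%N -> (0 < a)%N ->
  expR (s * D *+ 2) <= Z s N (fun w => W w == - a%:Z) ->
  cylinder_null [set x | forall k : nat, exists n, k%:Z <= W (mkseq x n)].
Proof.
move=> N0 a0 HZ eps e0.
pose c := expR (s * D *+ 2); have c0 : 0 < c by exact: expR_gt0.
have [|J HJ] := @series_tail_small _ b (eps / c) _ b_summable (divr_gt0 e0 c0).
  by move=> n; exact: weight_sum_ge0.
(* At the first passage through level [J * a] the overshoot is at most [M]. *)
pose P w := ((J * a)%:Z <= W w) && (W w <= (J * a + M)%:Z).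
exists P; split.
  move=> x /(_ (J * a)%N) hx.
  have ex : exists n, ((J * a)%:Z <= W (mkseq x n)) by [].
  case: (ex_minnP ex) => n nW nmin; exists n; rewrite /P nW /=.
  case: n nW nmin => [|n] nW nmin; first by rewrite /walk big_nil.
  have : ~~ ((J * a)%:Z <= W (mkseq x n)).
    by apply/negP => /nmin; rewrite ltnn.
  rewrite walk_mkseqS; have := t_bound (x n); lia.
apply: (@le_trans _ _ (\sum_(0 <= n <oo) (c%:E * (b (n + J * N)%N)%:E))%E).
  apply: lee_nneseries => [n _ _|n _]; first by rewrite lee_fin weight_sum_ge0.
  rewrite -EFinM lee_fin.
  have := @weight_sum_cat s n (J * N) P (fun w => W w == - (J * a)%:Z)
    (fun w => (`|W w| <= M)%N) s_ge0.
  rewrite -/c => H; apply: le_trans (H _).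
    by rewrite ler_peMr ?weight_sum_ge0 // weight_sum_pow.
  move=> u v _ _ /andP[Wu1 Wu2] /eqP Wv; rewrite walk_cat Wv; lia.
rewrite nneseriesZl; last by move=> n _; rewrite lee_fin weight_sum_ge0.
have -> : eps = c * (eps / c) by field; rewrite gt_eqF.
rewrite EFinM lee_wpmul2l ?lee_fin ?(ltW c0) //; apply: HJ.
by rewrite leq_pmulr.
Qed.

End Null.

End WalkSums.

(** * Weights of a Gibbs measure *)

Section Gibbs.
Variables (p : seq letter -> R) (delta c : R).
Hypothesis p_nil : p [::] = 1.
(** For cylinder probabilities, [p_cons] is shift invariance and [p_rcons] is additivity. *)
Hypothesis p_cons : forall w, \sum_i p (i :: w) = p w.
Hypothesis p_rcons : forall w, \sum_i p (rcons w i) = p w.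
Hypothesis c_gt0 : 0 < c.
Hypothesis p_ge : forall w, c^-1 * expR (delta * S w) <= p w.
Hypothesis p_le : forall w, p w <= c * expR (delta * S w).

Lemma gibbs_gt0 w : 0 < p w.
Proof. by apply: lt_le_trans (p_ge w); rewrite mulr_gt0 ?invr_gt0 ?expR_gt0. Qed.

Lemma sum_gibbs_cat u n : \sum_(w <- words n) p (u ++ w) = p u.
Proof.
elim: n u => [|n IH] u; first by rewrite big_seq1 cats0.
rewrite big_wordsS -[RHS]p_rcons; apply: eq_bigr => i _.
by rewrite -IH; apply: eq_bigr => w _; rewrite cat_rcons.
Qed.

Lemma sum_gibbs n : \sum_(w <- words n) p w = 1.
Proof. by rewrite -[RHS]p_nil -(sum_gibbs_cat [::] n). Qed.

Definition mean_step (t : letter -> int) : R := \sum_i (t i)%:~R * p [:: i].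

(** By invariance each letter of the word has the same distribution; the induction removes the first
    letter with [p_cons]. *)
Lemma sum_gibbs_walk t n :
  \sum_(w <- words n) (walk t w)%:~R * p w = n%:R * mean_step t.
Proof.
elim: n => [|n IH]; first by rewrite mul0r big_seq1 /walk big_nil mul0r.
rewrite big_wordsS -natr1 mulrDl mul1r addrC -IH /mean_step.
rewrite (eq_bigr (fun i => (t i)%:~R * p [:: i] +
   \sum_(w <- words n) (walk t w)%:~R * p (i :: w))); last first.
  move=> i _; rewrite -(sum_gibbs_cat [:: i] n) mulr_sumr -big_split /=.
  by apply: eq_bigr => w _; rewrite walk_cons intrD mulrDl.
rewrite big_split /=; congr (_ + _); rewrite exchange_big /=.
by apply: eq_bigr => w _; rewrite -mulr_sumr p_cons.
Qed.

Lemma mean_stepN t : mean_step (fun i => - t i) = - mean_step t.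
Proof. by rewrite /mean_step -sumrN; apply: eq_bigr => i _; rewrite mulrNz mulNr. Qed.

Lemma weight_sum_le_gibbs n : Z delta n predT <= c.
Proof.
rewrite -[leRHS]mulr1 -(sum_gibbs n) mulr_sumr /Z; apply: ler_sum => w _.
by rewrite -ler_pdivrMl //; exact: p_ge.
Qed.

Lemma weight_sum_ge_gibbs n P : c^-1 * \sum_(w <- words n | P w) p w <= Z delta n P.
Proof.
rewrite mulr_sumr; apply: ler_sum => w _.
by rewrite ler_pdivrMl //; exact: p_le.
Qed.

Lemma weight_sum_decay s : delta < s -> forall eps : R, 0 < eps ->
  exists n, Z s n predT <= eps.
Proof.
move=> ds eps e0.
have k0 : 0 < (s - delta) * lam by rewrite mulr_gt0 ?subr_gt0.
have [n Hn] := @linear_le_expR _ _ (c / eps) k0; exists n.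
have := weight_sum_gain n predT (ltW ds).
have {}Hn : c / eps <= expR ((s - delta) * lam * n%:R).
  apply: le_trans Hn; rewrite ler_peMr ?divr_ge0 ?(ltW c_gt0) ?(ltW e0) //.
  by rewrite exprn_ege1 // ler1n.
move=> /le_trans/(_ (weight_sum_le_gibbs n)) Hz.
rewrite -(ler_pM2l (expR_gt0 ((s - delta) * lam * n%:R))).
by apply: le_trans Hz _; rewrite -ler_pdivrMr.
Qed.

(* By invariance the mean of the walk after [n] steps is [n * mean_step t >= 0]
   and the walk is integer-valued, so the event [0 <= walk] has Gibbs
   probability at least of order [1 / n]. *)
Lemma weight_sum_nonneg_walk_growth (t : letter -> int) (M : nat) s :
  (forall i, `|t i| <= M)%N -> 0 <= mean_step t -> s < delta ->
  forall C, exists n, C * n.+1%:R <= Z s n (fun w => 0 <= walk t w).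
Proof.
move=> tM m0 sd C.
have k0 : 0 < (delta - s) * lam by rewrite mulr_gt0 ?subr_gt0.
(* The constant collects the Gibbs comparison [c] and the factor [M.+1] of the probability bound
   [q1]. *)
have [n Hn] := @linear_le_expR _ _ (`|C| * c * M.+1%:R) k0; exists n.
pose q := \sum_(w <- words n | 0 <= walk t w) p w.
(* The walk is at most [M * n] where it is nonnegative and at most -1 elsewhere, so its mean is at
   most [M * n * q - (1 - q)]. *)
have q1 : 1 <= (M.+1 * n.+1)%:R * q.
  have : 0 <= (M * n)%:R * q - (1 - q).
    apply: (@le_trans _ _ (\sum_(w <- words n) (walk t w)%:~R * p w)).
      by rewrite sum_gibbs_walk mulr_ge0.
    have -> : 1 - q = \sum_(w <- words n | ~~ (0 <= walk t w)) p w.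
      by rewrite -(sum_gibbs n) (bigID (fun w => 0 <= walk t w)) /= -/q addrAC subrr add0r.
    rewrite (bigID (fun w => 0 <= walk t w)) /=; apply: lerD.
      rewrite mulr_sumr big_seq_cond [leRHS]big_seq_cond; apply: ler_sum => w.
      rewrite mem_words => /andP[/eqP wn w0]; rewrite ler_wpM2r ?(ltW (gibbs_gt0 w)) //.
      rewrite -[leRHS]/((M * n)%:Z%:~R) ler_int; have := walk_bound tM w; rewrite wn; lia.
    rewrite -sumrN; apply: ler_sum => w w0.
    rewrite -[leRHS]mulN1r ler_wpM2r ?(ltW (gibbs_gt0 w)) //.
    rewrite (_ : -1 = (-1)%:~R) // ler_int; lia.
  have q0 : 0 <= q by apply: sumr_ge0 => w _; exact: ltW (gibbs_gt0 w).
  rewrite !natrM -!natr1; have : 0 <= M%:R :> R by []; have : 0 <= n%:R :> R by [].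
  nra.
apply: le_trans (weight_sum_gain n _ (ltW sd)).
apply: le_trans (ler_wpM2l (expR_ge0 _) (weight_sum_ge_gibbs n _)).
rewrite -/q; set E := expR _ in Hn *.
have q0 : 0 <= q by apply: sumr_ge0 => w _; exact: ltW (gibbs_gt0 w).
apply: (@le_trans _ _ (`|C| * n.+1%:R)); first by rewrite ler_wpM2r // ler_norm.
rewrite mulrA; apply: (@le_trans _ _ ((`|C| * M.+1%:R * n.+1%:R ^+ 2) * q)).
  have -> : `|C| * M.+1%:R * n.+1%:R ^+ 2 * q = `|C| * n.+1%:R * ((M.+1 * n.+1)%:R * q).
    by rewrite natrM; ring.
  by rewrite ler_peMr // mulr_ge0.
rewrite ler_wpM2r // ler_pdivlMr //; apply: le_trans Hn.
by rewrite le_eqVlt; apply/orP; left; apply/eqP; ring.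
Qed.

(** At exponent [delta] the Gibbs bounds keep every sum above [c^-1], so the terms cannot tend to
    0. *)
Lemma pressure_zero_series s : s <= delta ->
  (\sum_(0 <= n <oo) (Z s n predT)%:E = +oo)%E.
Proof.
move=> sd; apply/eqP; rewrite eq_le leey leNgt; apply/negP => h.
have ci0 : 0 < c^-1 by rewrite invr_gt0.
have [|n] := small_term _ h (divr_gt0 ci0 (@ltr0Sn R 1)).
  by move=> n; exact: weight_sum_ge0.
apply/negP; rewrite -ltNge; apply: (@lt_le_trans _ _ c^-1); first by lra.
apply: (@le_trans _ _ (Z delta n predT)).
  by apply: le_trans (weight_sum_ge_gibbs n _); rewrite sum_gibbs mulr1.
apply: le_trans (weight_sum_gain n _ sd); rewrite ler_peMl ?weight_sum_ge0 //.
rewrite -[leLHS]expR0 ler_expR !mulr_ge0 ?subr_ge0 //; exact: ltW.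
Qed.

Section UpperBound.
Variables (t : letter -> int) (M : nat) (s : R) (i : letter).
Hypothesis t_bound : forall i, (`|t i| <= M)%N.
Hypothesis s_ge0 : 0 <= s.
Hypothesis s_lt : s < delta.
Hypothesis mean_le0 : mean_step t <= 0.
Hypothesis ti_lt0 : t i < 0.

(** The reflected step has nonnegative mean, so the words of nonpositive walk have weight outgrowing
    their length. One further letter [i] makes the walk negative, and the number of possible levels
    is only linear in the length. *)
Lemma exists_descending_level : exists N (a : nat),
  [/\ (0 < N)%N, (0 < a)%N &
   expR (s * D *+ 2) <= Z s N (fun w => walk t w == - a%:Z)].
Proof.
pose c1 := expR (s * S [:: i]) * expR (- (s * D *+ 2)).
have c10 : 0 < c1 by rewrite mulr_gt0 ?expR_gt0.
have tN j : (`|- t j| <= M)%N by rewrite abszN.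
have mN : 0 <= mean_step (fun i => - t i) by rewrite mean_stepN oppr_ge0.
(* [c1] pays for appending [i], [M] for the pigeonhole, and the summand 1 makes the inequality
   strict. *)
have [n Hn] := weight_sum_nonneg_walk_growth tN mN s_lt
   ((expR (s * D *+ 2) * M%:R + 1) / c1).
have : expR (s * D *+ 2) * (M * n.+1)%:R < Z s n.+1 (fun w => walk t w <= -1).
  apply: (@lt_le_trans _ _ ((expR (s * D *+ 2) * M%:R + 1) * n.+1%:R)).
    by rewrite natrM mulrA mulrDl ltrDl mul1r.
  apply: le_trans; last first.
    apply: (@weight_sum_append_letter s n i (fun w => 0 <= walk (fun i => - t i) w)) => //.
    by move=> w _; rewrite walkN -cats1 walk_cat /walk big_seq1 -/(walk t w); lia.
  rewrite -/c1 -ler_pdivrMl // mulrC mulrAC; exact: Hn.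
move=> /(weight_sum_pigeonhole t_bound)[a a0 Ha].
by exists n.+1, a.
Qed.

End UpperBound.
End Gibbs.

(** * Coded sets: covers by cylinders and Cantor sets of blocks *)

Section Coding.
Variables (pi : symbol_seq m -> R) (Cg Lam : R).
Hypothesis Cg_gt0 : 0 < Cg.
Hypothesis phi_ge : forall x, - Lam <= phi x.
Hypothesis pi_le : forall w x y, cylinder w x -> cylinder w y ->
  `|pi x - pi y| <= Cg * expR (birkhoff phi (size w) x).
Hypothesis pi_ge : forall w x y, cylinder w x -> cylinder w y ->
  Cg^-1 * expR (birkhoff phi (size w) x) *
    `|pi (iter (size w) shift x) - pi (iter (size w) shift y)| <= `|pi x - pi y|.

Lemma cylinder_null_hausdorff_null s (E : set (symbol_seq m)) : 0 < s ->
  cylinder_null s E -> hausdorff_null s (pi @` E).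
Proof.
move=> s0 H; apply: (@hausdorff_null_countable_cover _ (seq letter)) => // eps e0.
have Cs : 0 < Cg `^ s by exact: powR_gt0.
have [P [EP SP]] := H _ (divr_gt0 e0 Cs).
exists (fun w => if P w then pi @` cylinder w else set0).
exists (fun w => if P w then Cg * expR (S w) else 0); split.
- move=> _ [x Ex <-]; have [n Pn] := EP _ Ex; exists (mkseq x n) => //.
  by rewrite Pn; exists x => //; exact: cylinder_mkseq.
- by move=> w; case: ifP => // _; rewrite mulr_ge0 ?expR_ge0 // ltW.
- move=> w x y; case: ifP => // _ [x' wx <-] [y' wy <-].
  apply: le_trans (pi_le wx wy) _; rewrite ler_wpM2l ?(ltW Cg_gt0) // ler_expR.
  exact: birkhoff_le_sup.
- rewrite (_ : [set: seq letter] = [set w | predT w]); last exact/seteqP.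
  rewrite (eq_esum (b := fun w => (if P w then Cg `^ s * expR (s * S w) else 0)%:E)); last first.
    move=> w _; case: ifP => _; last by rewrite powR0 ?gt_eqF.
    by rewrite powRM ?expR_ge0 ?(ltW Cg_gt0) // -expRM mulrC [S w * s]mulrC mulrC.
  rewrite esum_words; last by move=> w; case: ifP => // _; rewrite mulr_ge0 ?expR_ge0 ?ltW.
  rewrite (@eq_eseriesr _ _ (fun n => (Cg `^ s)%:E * (Z s n P)%:E)%E); last first.
    move=> n _; rewrite -EFinM mulr_sumr /Z; congr (_%:E).
    by rewrite -big_mkcond.
  rewrite nneseriesZl; last by move=> n _; rewrite lee_fin weight_sum_ge0.
  rewrite -[eps](divfK (lt0r_neq0 Cs)) mulrC EFinM lee_wpmul2l ?lee_fin ?(ltW Cs) //.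
Qed.

Definition block N (x : symbol_seq m) k : seq letter := mkseq (iter (k * N) shift x) N.

Definition block_set N (V : pred (seq letter)) : set (symbol_seq m) :=
  [set x | forall k, V (block N x k)].

Lemma mkseq_block N x k : mkseq x (k.+1 * N) = mkseq x (k * N) ++ block N x k.
Proof. by rewrite mulSn addnC mkseq_shift. Qed.

Definition concat_blocks N (beta : nat -> seq letter) : symbol_seq m :=
  fun i => nth ord0 (beta (i %/ N)%N) (i %% N)%N.

Lemma block_concat N beta : (0 < N)%N -> (forall k, size (beta k) = N) ->
  block N (concat_blocks N beta) =1 beta.
Proof.
move=> N0 sb k; apply: (@eq_from_nth _ ord0); rewrite /block size_mkseq ?sb // => i iN.
rewrite nth_mkseq // iter_shiftE /concat_blocks.
by rewrite divnMDl // divn_small // addn0 modnMDl modn_small.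
Qed.

Lemma birkhoff_anti n k x : birkhoff phi (n + k) x <= birkhoff phi n x.
Proof.
rewrite birkhoffD gerDl; apply: le_trans (birkhoff_le _ _) _.
by rewrite oppr_le0 mulr_ge0 // ltW.
Qed.

Lemma birkhoff_ge n x : - (Lam * n%:R) <= birkhoff phi n x.
Proof.
apply: (@le_trans _ _ (\sum_(k < n) (- Lam))); last exact: ler_sum.
by rewrite sumr_const card_ord mulNrn mulr_natr.
Qed.

Lemma first_difference x y : x <> y -> exists n, mkseq x n = mkseq y n /\ x n != y n.
Proof.
move=> xy; have ex : exists n, x n != y n.
  by apply: contrapT => /forallNP h; apply: xy; apply/funext => n;
    apply/eqP; have /negP := h n; rewrite negbK.
case: (ex_minnP ex) => n xn nmin; exists n; split => //.
apply: (@eq_from_nth _ ord0); rewrite !size_mkseq // => i iN.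
rewrite !nth_mkseq //; apply: contraTeq iN => /nmin; by rewrite -leqNgt.
Qed.

(** Normalising the weights of the words in [V] gives Bernoulli weights for which a prefix of blocks
    has probability at most its contraction to the power [s]; [expR (s * D)] pays for the distortion
    inside each block. Separation turns each set of a cover into a common prefix of its points, of
    probability comparable to its cost. A cheap cover thus forbids prefixes of total probability
    below 1 and misses some point. *)
Lemma block_set_not_null s N (V : pred (seq letter)) (eta : R) :
  0 < s -> (0 < N)%N -> 0 < eta ->
  (forall x y n, block_set N V x -> block_set N V y ->
    mkseq x n = mkseq y n -> x n != y n ->
    eta <= `|pi (iter n shift x) - pi (iter n shift y)|) ->
  expR (s * D) <= Z s N V ->
  ~ hausdorff_null s (pi @` block_set N V).
Proof.
move=> s0 N0 eta0 sep ZV null.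
have Z0 : 0 < Z s N V by apply: lt_le_trans ZV; exact: expR_gt0.
pose p v := if V v then expR (s * S v) / Z s N V else 0.
have p0 v : 0 <= p v by rewrite /p; case: ifP => // _; rewrite divr_ge0 ?expR_ge0 // ltW.
have psum : \sum_(v <- words N) p v = 1.
  rewrite -(divff (lt0r_neq0 Z0)) [in X in _ = X / _]/Z mulr_suml.
  by rewrite -big_mkcond.
have p_le x k : p (block N x k) <= expR (s * birkhoff phi N (iter (k * N) shift x)).
  rewrite /p; case: ifP => [Vb|_]; last exact: expR_ge0.
  rewrite ler_pdivrMr //; apply: le_trans (ler_wpM2l (expR_ge0 _) ZV).
  rewrite -expRD ler_expR -mulrDr ler_wpM2l ?(ltW s0) //.
  have := @sup_birkhoff_le_birkhoff (block N x k) (iter (k * N) shift x).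
  by rewrite /block size_mkseq; apply; exact: cylinder_mkseq.
have prod_le x j : \prod_(v <- mkseq (block N x) j) p v <= expR (s * birkhoff phi (j * N) x).
  elim: j => [|j IH]; first by rewrite big_nil mul0n /birkhoff big_ord0 mulr0 expR0.
  rewrite mkseqS big_rcons /= mulSn addnC birkhoffD mulrDr expRD.
  by rewrite ler_pM // prodr_ge0.
pose c0 := Cg^-1 * eta.
have c00 : 0 < c0 by rewrite mulr_gt0 ?invr_gt0.
(* Points parting at a position [k < n] are at distance at least [c0] times the contraction along
   [k] letters, and the contraction factor only decreases with length. *)
have close x y n (d : R) : block_set N V x -> block_set N V y -> `|pi x - pi y| <= d ->
    d < c0 * expR (birkhoff phi n x) -> mkseq x n = mkseq y n.
  move=> Ex Ey xyd dn; have [->//|/eqP/first_difference[k [xyk xk]]] := eqVneq x y.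
  have [nk|kn] := leqP n k.
    by rewrite -(take_mkseq _ nk) -(take_mkseq y nk) xyk.
  exfalso; move: dn; apply/negP; rewrite -leNgt; apply: le_trans xyd.
  apply: le_trans (@pi_ge (mkseq x k) x y (cylinder_mkseq _ _) _); last first.
    by rewrite xyk; exact: cylinder_mkseq.
  rewrite size_mkseq; apply: (@le_trans _ _ (Cg^-1 * expR (birkhoff phi k x) * eta)).
    rewrite /c0 mulrAC ler_wpM2r ?(ltW eta0) // ler_wpM2l ?invr_ge0 ?(ltW Cg_gt0) //.
    by rewrite ler_expR -(subnKC (ltnW kn)); exact: birkhoff_anti.
  by rewrite ler_wpM2l ?sep // mulr_ge0 ?invr_ge0 ?expR_ge0 // ltW.
(* [c0] comes from [close]; the exponential pays for the one block by which the shared prefix may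
   fall short. *)
pose A := expR (s * (Lam * N%:R)) / (c0 `^ s).
have A0 : 0 < A by rewrite divr_gt0 ?expR_gt0 ?powR_gt0.
(* The costs of the cover and the added [e n] sum to at most [eps] each, so the total probability is
   at most [2 * A * eps = 1/2]. *)
pose eps := (4 * A)^-1.
have e0 : 0 < eps by rewrite invr_gt0 mulr_gt0.
have [U [d [EU d0 Ud Sd]]] := null _ e0.
pose e n := eps / (2 ^ n.+1)%:R.
have en n : 0 < e n by rewrite divr_gt0 // ltr0n expn_gt0.
(* The enlarged radius is positive even when [d n = 0], so finitely many blocks contract below
   it. *)
pose r n := (d n `^ s + e n) `^ s^-1.
have ds n : 0 < d n `^ s + e n by rewrite ltr_wpDl ?powR_ge0.
have r0 n : 0 < r n by exact: powR_gt0.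
have rs n : r n `^ s = d n `^ s + e n.
  by rewrite -powRrM mulVf ?gt_eqF // powRr1 // ltW.
have dr n : d n < r n.
  rewrite ltNge; apply/negP => /(ge0_ler_powR (ltW s0)).
  rewrite !nnegrE rs => /(_ (ltW (r0 n)) (d0 n)); rewrite leNgt => /negP; apply.
  by rewrite ltrDl.
have /choice[om Hom] : forall n, exists x, (exists2 y, block_set N V y & U n (pi y)) ->
    block_set N V x /\ U n (pi x).
  move=> n; have [[y Ey Uy]|nE] := pselect (exists2 y, block_set N V y & U n (pi y)).
    by exists y.
  by exists (fun=> ord0).
(* [j n] blocks of [om n] are shared by all points of [U n], and [j n] is
   large enough for the cylinder of these blocks to have weight of order
   [r n `^ s]. *)
have /choice[j Hj] : forall n, exists j,
    (forall y, block_set N V y -> U n (pi y) -> block_set N V (om n) -> U n (pi (om n)) ->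
      mkseq (om n) (j * N) = mkseq y (j * N)) /\
    expR (s * birkhoff phi (j * N) (om n)) <= A * r n `^ s.
  move=> n.
  have ex : exists k, c0 * expR (birkhoff phi (k * N) (om n)) <= r n.
    have lN : 0 < lam * N%:R by rewrite mulr_gt0 // ltr0n.
    have [k Hk] := @linear_le_expR _ _ (c0 / r n) lN; exists k.
    have {}Hk : c0 / r n <= expR (lam * N%:R * k%:R).
      apply: le_trans Hk; rewrite ler_peMr ?divr_ge0 ?(ltW c00) ?(ltW (r0 n)) //.
      by rewrite exprn_ege1 // ler1n.
    rewrite mulrC -ler_pdivlMr // -ler_pV2 ?inE ?unitfE ?gt_eqF ?expR_gt0 ?divr_gt0 //.
    rewrite invf_div -expRN; apply: le_trans Hk _; rewrite ler_expR lerNr.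
    by apply: le_trans (birkhoff_le _ _) _; rewrite natrM -mulrA [N%:R * _]mulrC.
  case: (ex_minnP ex) => k kr kmin.
  have bound i : (k <= i.+1)%N -> expR (s * birkhoff phi (i * N) (om n)) <= A * r n `^ s.
    move=> ki; rewrite /A mulrAC ler_pdivlMr ?powR_gt0 //.
    have : (c0 * expR (birkhoff phi (i.+1 * N) (om n))) `^ s <= r n `^ s.
      apply: ge0_ler_powR; [exact: ltW| |by rewrite nnegrE ltW|].
        by rewrite nnegrE mulr_ge0 ?expR_ge0 // ltW.
      apply: le_trans kr; rewrite ler_wpM2l ?(ltW c00) // ler_expR.
      by rewrite -(subnKC ki) mulnDl; exact: birkhoff_anti.
    rewrite powRM ?expR_ge0 ?(ltW c00) // -expRM => H.
    apply: le_trans (ler_wpM2l (expR_ge0 _) H).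
    rewrite mulrC [leRHS]mulrCA ler_wpM2l ?powR_ge0 // -expRD ler_expR.
    rewrite [X in _ <= _ + X]mulrC -mulrDr ler_wpM2l ?(ltW s0) //.
    rewrite mulSn addnC birkhoffD; have := birkhoff_ge N (iter (i * N) shift (om n)); lra.
  (* [k] is the first number of blocks contracting below [r n]. One block less stays above [d n], so
     it is shared by the points of [U n]; for [k = 0] nothing has to be shared. *)
  exists k.-1; split; last by apply: bound; exact: leqSpred.
  move=> y Ey Uy Eo Uo; case: k kr kmin bound => [|k] kr kmin _ /=; first by [].
  apply: (@close _ _ _ (d n)) => //; first exact: Ud.
  apply: lt_trans (dr n) _; rewrite ltNge; apply/negP => /kmin; by rewrite ltnn.
have [|beta [Hbeta avoid]] := @avoid_prefixes _ _ (words N) p (uniq_words _) p0 psum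
    (fun n => mkseq (block N (om n)) (j n)).
  apply: (@le_lt_trans _ _ (\sum_(0 <= n <oo) (A%:E * ((d n `^ s)%:E + (e n)%:E)))%E).
    apply: lee_nneseries => [n _ _|n _]; first by rewrite lee_fin prodr_ge0.
    rewrite -EFinD -EFinM lee_fin -rs; apply: le_trans (prod_le _ _) _.
    by have [] := Hj n.
  rewrite nneseriesZl; last by move=> n _; rewrite -EFinD lee_fin ltW.
  apply: (@le_lt_trans _ _ (A%:E * (eps + eps)%:E)%E).
    rewrite lee_wpmul2l ?lee_fin ?(ltW A0) // nneseriesD.
    - rewrite EFinD leeD // ; exact: (epsilon_trick0 xpredT (ltW e0)).
    - by move=> *; rewrite lee_fin powR_ge0.
    - by move=> *; rewrite lee_fin ltW.
  rewrite -EFinM lte_fin /eps.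
  have -> : A * ((4 * A)^-1 + (4 * A)^-1) = 2^-1 by field; rewrite gt_eqF.
  lra.
have sb k : size (beta k) = N.
  by have [_] := Hbeta k; rewrite mem_words => /eqP.
pose x := concat_blocks N beta.
have xb : block N x =1 beta by exact: block_concat.
have Ex : block_set N V x.
  by move=> k; rewrite xb; have [] := Hbeta k; rewrite /p; case: ifP; rewrite ?ltxx.
have [|n _ Ux] := EU (pi x); first by exists x.
have [|Eo Uo] := Hom n; first by exists x.
have [/(_ _ Ex Ux Eo Uo) ox _] := Hj n.
apply: (avoid n); rewrite size_mkseq.
apply: (@eq_from_nth _ [::]); rewrite !size_mkseq // => k kj.
rewrite !nth_mkseq // -xb.
have h z : block N z k = drop (k * N) (take (k.+1 * N) (mkseq z (j n * N))).
  by rewrite take_mkseq ?leq_mul2r ?kj ?orbT // mkseq_block drop_size_cat // size_mkseq.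
by rewrite !h ox.
Qed.

End Coding.
End WeightSums.
End Words.

(** * Geometry of the coding *)

Section DeriveWithin.
Variable R : realType.
Implicit Types (A : set R) (f : R -> R) (a b x : R).

Lemma derive_within_dist A f x : derivable_within A f x ->
  forall e : R, 0 < e -> exists2 d : R, 0 < d &
    forall y, A y -> y != x -> `|y - x| < d ->
      `|(f y - f x) / (y - x) - derive_within A f x| < e.
Proof.
move=> Df e e0.
have /cvgrPdist_lt /(_ _ e0) : diff_quotient f x y @[y --> within A x^'] -->
  derive_within A f x by exact: Df.
move=> H; have : nbhs x (fun y => y != x -> A y ->
    `|derive_within A f x - diff_quotient f x y| < e) by exact: H.
move=> /nbhs_ballP[d /= d0 {}H].
exists d => // y Ay yx yd; rewrite distrC; apply: (H y) => //=.
by rewrite /ball /= distrC.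
Qed.

Lemma derivable_within_continuous A f : (forall x, A x -> derivable_within A f x) ->
  {within A, continuous f}.
Proof.
move=> Df; apply/subspace_continuousP => x Ax; apply/cvgrPdist_lt => e e0.
have [d d0 Hd] := derive_within_dist (Df x Ax) ltr01.
pose k := `|derive_within A f x| + 1.
have k0 : 0 < k by rewrite ltr_wpDl.
rewrite near_withinE; apply/nbhs_ballP; exists (Num.min d (e / k)) => /=.
  by rewrite lt_min d0 divr_gt0.
move=> y; rewrite /ball /= lt_min => /andP[xyd xye] Ay.
have [->|yx] := eqVneq y x; first by rewrite subrr normr0.
have yx0 : `|y - x| != 0 by rewrite normr_eq0 subr_eq0.
have := Hd y Ay yx; rewrite distrC => /(_ xyd).
rewrite distrC => Hq.
have {}Hq : `|(f y - f x) / (y - x)| < k.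
  rewrite /k -ltrBlDl; apply: le_lt_trans Hq; rewrite [leRHS]distrC; exact: lerB_dist.
rewrite distrC; move: Hq; rewrite normrM normfV ltr_pdivrMr ?normr_gt0 ?subr_eq0 //.
move=> /lt_le_trans; apply; rewrite -ler_pdivlMl // mulrC ltW //.
by rewrite distrC.
Qed.

Lemma derive_within_is_derive a b f x : a < x < b -> derivable_within `[a, b] f x ->
  is_derive x (1 : R) f (derive_within `[a, b] f x).
Proof.
move=> /andP[ax xb] Df.
have H : (fun h => h^-1 *: ((f \o shift x) (h *: (1 : R)) - f x)) @ 0^' -->
    derive_within `[a, b] f x.
  apply/cvgrPdist_lt => e e0; have [d d0 Hd] := derive_within_dist Df e0.
  suff : nbhs (0 : R) (fun h => h != 0 -> `|derive_within `[a, b] f x -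
      h^-1 *: ((f \o shift x) (h *: (1 : R)) - f x)| < e) by [].
  apply/nbhs_ballP.
  exists (Num.min d (Num.min (x - a) (b - x))) => /=; first by rewrite !lt_min d0 !subr_gt0 ax.
  move=> h; rewrite /ball /= sub0r normrN !lt_min => /and3P[hd ha hb] h0.
  have hE : h + x - x = h by rewrite addrK.
  have := Hd (h + x); rewrite hE /= in_itv /= distrC => Hx.
  have -> : h^-1 *: ((f \o shift x) (h *: (1 : R)) - f x) = (f (h + x) - f x) / h.
    by rewrite /= /GRing.scale /= mulr1 mulrC.
  apply: Hx => //.
    by move: ha hb; rewrite !ltr_norml => /andP[h1 h2] /andP[h3 h4]; apply/andP; split; lra.
  by apply: contra_neq h0 => hx; rewrite -hE hx subrr.
by split; [apply: cvgP H|exact: cvg_lim H].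
Qed.

Lemma mean_value_within a b f x y : (forall z, a <= z <= b -> derivable_within `[a, b] f z) ->
  a <= x -> x < y -> y <= b ->
  exists2 c, x < c < y & f y - f x = derive_within `[a, b] f c * (y - x).
Proof.
move=> Df ax xy yb.
have [||c cxy ->] := @MVT R f (derive_within `[a, b] f) x y xy; last by exists c.
- move=> z; rewrite in_itv /= => /andP[xz zy]; apply: derive_within_is_derive.
    by rewrite (le_lt_trans ax xz) (lt_le_trans zy yb).
  by apply: Df; rewrite (le_trans ax (ltW xz)) (le_trans (ltW zy) yb).
- have : {within `[a, b], continuous f} by apply: derivable_within_continuous => z /=; rewrite in_itv; exact: Df.
  apply: continuous_subspaceW => z /=; rewrite !in_itv /= => /andP[xz zy].
  by rewrite (le_trans ax xz) (le_trans zy yb).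
Qed.

End DeriveWithin.

Lemma interval_closure (R : realType) (A : set R) : is_interval A -> A `<=` `[0, 1] ->
  A° !=set0 -> exists a b : R, [/\ a < b, closure A = `[a, b]%classic & `]a, b[%classic `<=` A].
Proof.
move=> Ai A01 [x0 Ax0].
have lb : has_lbound A by exists 0 => x /A01 /=; rewrite in_itv /= => /andP[].
have ub : has_ubound A by exists 1 => x /A01 /=; rewrite in_itv /= => /andP[].
have AE := interval_bounded_interior Ai lb ub.
have ab : inf A < sup A.
  by move: Ax0; rewrite AE /= => /andP[]; exact: lt_trans.
exists (inf A), (sup A); split => //; last by rewrite -AE; exact: interior_subset.
apply/seteqP; split.
- rewrite closureE => x; apply; split; first exact: interval_closed.
  move=> y Ay /=; rewrite in_itv /=; apply/andP; split.
    exact: ge_inf.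
  exact: ub_le_sup.
- move=> x /=; rewrite in_itv /= => /andP[ax xb] B /nbhs_ballP[e /= e0 Be].
  pose s := inf A; pose t := sup A.
  pose d := Num.min e (t - s) / 4.
  have d0 : 0 < d by rewrite divr_gt0 // lt_min e0 subr_gt0.
  have de : d * 4 <= e by rewrite /d divfK // ge_min lexx.
  have dst : d * 4 <= t - s by rewrite /d divfK // ge_min lexx orbT.
  pose y := if x <= (s + t) / 2 then x + d else x - d.
  exists y; split.
    apply: (@interior_subset _ A); rewrite AE /= -/s -/t /y.
    rewrite -/s -/t in ax xb.
    by have [hx|hx] := leP x ((s + t) / 2); apply/andP; split; lra.
  apply: Be; rewrite /ball /= /y; case: ifP => _.
    by rewrite opprD addNKr normrN gtr0_norm //; lra.
  by rewrite opprB addrC subrK gtr0_norm //; lra.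
Qed.

Section PowerBound.
Variable R : realType.

Lemma exp_lt_pos (q C e : R) : 0 <= q -> q < 1 -> 0 < e -> exists k, C * q ^+ k < e.
Proof.
move=> q0 q1 e0.
have := @cvg_expr R q; rewrite ger0_norm // => /(_ q1) /cvgrPdist_lt.
have k0 : 0 < `|C| + 1 by rewrite ltr_wpDl.
move=> /(_ (e / (`|C| + 1))) /(_ (divr_gt0 e0 k0)) [k _ /(_ k (leqnn k))].
rewrite /= sub0r normrN ger0_norm ?exprn_ge0 // ltr_pdivlMr // => H.
exists k; apply: le_lt_trans H; rewrite mulrC ler_wpM2l ?exprn_ge0 //.
by apply: le_trans (ler_norm _) _; rewrite lerDl.
Qed.

Lemma exp_bound_eq0 (q C x : R) : 0 <= q -> q < 1 -> (forall k, `|x| <= C * q ^+ k) -> x = 0.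
Proof.
move=> q0 q1 H; apply/eqP; rewrite -normr_eq0 eq_le normr_ge0 andbT leNgt.
apply/negP => /(exp_lt_pos C q0 q1)[k]; apply/negP; rewrite -leNgt; exact: H.
Qed.

End PowerBound.

Lemma ln_lipschitz (R : realType) (u v : R) : 1 <= u -> 1 <= v -> `|ln u - ln v| <= `|u - v|.
Proof.
wlog uv : u v / u <= v => [W u1 v1|].
  have [uv|/ltW vu] := leP u v; first exact: W.
  by rewrite distrC [leRHS]distrC W.
move=> u1 v1; have u0 : 0 < u by exact: lt_le_trans u1.
have v0 : 0 < v by exact: lt_le_trans v1.
rewrite distrC ger0_norm ?subr_ge0 ?ler_ln //.
rewrite [leRHS]distrC ger0_norm ?subr_ge0 // -ln_div //.
have -> : v / u = 1 + (v - u) / u by field; rewrite gt_eqF.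
apply: (@le_trans _ _ ((v - u) / u)).
  by apply: le_ln1Dx; rewrite (@lt_le_trans _ _ 0) // divr_ge0 ?subr_ge0 // ltW.
by rewrite ler_pdivrMr // ler_peMr ?subr_ge0.
Qed.

Lemma fin_uniform_bound (R : realType) (T : finType) (P : T -> R -> Prop) (x0 : T) :
  (forall i c d, P i c -> c <= d -> P i d) -> (forall i, exists c, P i c) ->
  exists c, forall i, P i c.
Proof.
move=> mono /choice[f Pf]; exists (\sum_i `|f i|) => i; apply: (mono i (f i)) => //.
rewrite (bigD1 i) //=; apply: le_trans (ler_norm _) _.
by rewrite lerDl sumr_ge0.
Qed.

Lemma absz1_sqr (z : int) : `|z|%N = 1%N -> z * z = 1.
Proof. nia. Qed.

Lemma absz_le_oppz (z : int) (p q : nat) : (`|z| <= p)%N -> (p <= q)%N -> - q%:Z <= z.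
Proof. lia. Qed.

Lemma absz_shift (z : int) (p : nat) : - p%:Z <= z -> z = `|(z + p%:Z)%R|%N%:Z - p%:Z.
Proof. lia. Qed.

Lemma zero_letters (m : nat) (t : 'I_m.+2 -> int) w :
  (forall i, t i <= 0) -> 0 <= walk t w -> forall i, i \in w -> t i = 0.
Proof.
move=> t0; have W0 v : walk t v <= 0 by apply: sumr_le0.
elim: w => [//|j w IH]; rewrite walk_cons => jw i.
have tj := t0 j; have Ww := W0 w.
by rewrite inE => /predU1P[->|/IH]; [lia|apply; lia].
Qed.

(** In blocks made of [r] letters followed by [k] letters, the second part of block [q] starts at
    [q * (r + k) + r]; this is the first such start after position [n]. *)
Lemma block_index (n r k : nat) : (0 < r + k)%N ->
  let q := ((n + k) %/ (r + k))%N in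
  (n < q * (r + k) + r)%N && (q * (r + k) + r <= n + (r + k))%N.
Proof.
move=> rk /=; have := divn_eq (n + k) (r + k); have := ltn_pmod (n + k) rk.
move: (_ %/ _ * _)%N (_ %% _)%N => p q; lia.
Qed.

(** * Inverse branches, coding map and bounded distortion *)

Section Geometry.
Variables (R : realType) (m : nat).
Local Notation letter := 'I_m.+2.
Local Notation shift := (@Defs.shift m).
Variables (I_ : letter -> set R) (F : R -> R) (H : letter -> R -> R).
Variables (a b : letter -> R).
Hypothesis expanding : expanding_map I_ F H.
Hypothesis ab : forall i, a i < b i.
Hypothesis closure_I : forall i, closure (I_ i) = `[a i, b i]%classic.
Hypothesis itv_sub : forall i, `]a i, b i[%classic `<=` I_ i.

Local Notation dH i x := (derive_within (closure (I_ i)) (H i) x).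
Local Notation h := (inv_branch I_ H).
Local Notation hs := (inv_branches I_ H).
Local Notation pi := (coding I_ H).
Local Notation phi := (geometric_potential I_ H).

Lemma in_closure i x : a i <= x <= b i <-> closure (I_ i) x.
Proof. by rewrite closure_I /= in_itv. Qed.

Lemma branch_bij i : set_bij (closure (I_ i)) `[0, 1] (H i).
Proof. by case: expanding => _ _ _ _ _ [eps _ /(_ i)[]]. Qed.

Lemma closure01 i x : a i <= x <= b i -> 0 <= x <= 1.
Proof.
move=> /in_closure.
have : closure (I_ i) `<=` `[0, 1].
  rewrite closureE => y; apply; split; first exact: interval_closed.
  exact: branch_sub expanding _.
by move=> /[apply] /=; rewrite in_itv.
Qed.

Lemma a_ge0 i : 0 <= a i.
Proof. have ai : a i <= a i <= b i by rewrite lexx ltW.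
by case/andP: (closure01 ai). Qed.

Lemma b_le1 i : b i <= 1.
Proof. have bi : a i <= b i <= b i by rewrite lexx ltW.
by case/andP: (closure01 bi). Qed.

Lemma branch_derivable i x : a i <= x <= b i -> derivable_within `[a i, b i] (H i) x.
Proof.
move=> /in_closure; case: expanding => _ _ _ _ _ [eps _ /(_ i)[_ [+ _] _]] _.
by rewrite closure_I; apply.
Qed.

Lemma inv_branchP i y : 0 <= y <= 1 -> a i <= h i y <= b i.
Proof.
move=> y01; apply/in_closure; have [_ _ surj] := branch_bij i.
by apply: (surjpinv_image_sub surj); exists y => //=; rewrite in_itv.
Qed.

Lemma branchK i y : 0 <= y <= 1 -> H i (h i y) = y.
Proof.
move=> y01; have [_ _ surj] := branch_bij i.
by apply: (surjpK _ surj (mem_set _)); rewrite /= in_itv.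
Qed.

Lemma inv_branchK i x : a i <= x <= b i -> h i (H i x) = x.
Proof.
move=> /in_closure x01; have [_ inj _] := branch_bij i.
by apply: (pinvKV _ inj (mem_set _)).
Qed.

Lemma branch01 i x : a i <= x <= b i -> 0 <= H i x <= 1.
Proof.
move=> /in_closure xi; have [f _ _] := branch_bij i.
by have /= := f _ xi; rewrite in_itv.
Qed.

Lemma branch_inj i x y : a i <= x <= b i -> a i <= y <= b i -> H i x = H i y -> x = y.
Proof. by move=> xi yi E; rewrite -(inv_branchK xi) E inv_branchK. Qed.

Lemma branch_mean_value i x y : a i <= x <= b i -> a i <= y <= b i ->
  exists c, [/\ a i <= c <= b i, `|c - x| <= `|x - y|, `|c - y| <= `|x - y| &
    `|H i x - H i y| = `|dH i c| * `|x - y| ].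
Proof.
wlog xy : x y / x <= y.
  move=> W xi yi; have [xy|/ltW yx] := leP x y; first exact: W.
  have [c [ci cy cx E]] := W _ _ yx yi xi.
  exists c; rewrite [`|x - y|]distrC; split => //.
  by rewrite [LHS]distrC.
move=> xi yi; move: xy; rewrite le_eqVlt => /predU1P[<-|xy].
  by exists x; rewrite !subrr normr0 mulr0.
move: (xi) (yi) => /andP[ax xb] /andP[ay yb].
have [|c /andP[xc cy] E] := @mean_value_within R (a i) (b i) (H i) x y _ ax xy yb.
  exact: branch_derivable.
exists c; split.
- by rewrite (le_trans ax (ltW xc)) (le_trans (ltW cy) yb).
- by rewrite [leRHS]distrC !gtr0_norm ?subr_gt0 // lerD2r ltW.
- by rewrite !ltr0_norm ?subr_lt0 // lerN2 lerD2r ltW.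
- by rewrite distrC E closure_I normrM [`|y - x|]distrC.
Qed.

(** A continuous injection of a segment is monotone, and surjectivity onto the unit interval fixes
    its end values; a branch may reverse orientation. *)
Lemma branch_endpoints i :
  (H i (a i) = 0 /\ H i (b i) = 1) \/ (H i (a i) = 1 /\ H i (b i) = 0).
Proof.
have cont : {within `[a i, b i], continuous (H i)}.
  by apply: derivable_within_continuous => x /=; rewrite in_itv /=; exact: branch_derivable.
have inj : {in `[a i, b i] &, injective (H i)}.
  by move=> x y; rewrite !in_itv /= => xi yi; exact: branch_inj.
have ai : a i <= a i <= b i by rewrite lexx ltW.
have bi : a i <= b i <= b i by rewrite lexx ltW.
have [H0 H1] : 0 <= (0 : R) <= 1 /\ 0 <= (1 : R) <= 1 by rewrite !lexx ler01.
have [p0 p1] := (inv_branchP i H0, inv_branchP i H1).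
have /andP[Ha0 Ha1] := branch01 ai; have /andP[Hb0 Hb1] := branch01 bi.
have [Hab|/ltW Hba] := leP (H i (a i)) (H i (b i)); [left|right].
- have mono := segment_continuous_inj_le Hab cont inj.
  split; apply/eqP; rewrite eq_le.
    rewrite Ha0 andbT -[leRHS](branchK i H0) mono ?in_itv //=.
    by case/andP: p0.
  rewrite Hb1 /= -[leLHS](branchK i H1) mono ?in_itv //=.
  by case/andP: p1.
- have mono := segment_continuous_inj_ge Hba cont inj.
  split; apply/eqP; rewrite eq_le.
    rewrite Ha1 /= -[leLHS](branchK i H1) mono ?in_itv //=.
    by case/andP: p1.
  rewrite Hb0 andbT -[leRHS](branchK i H0) mono ?in_itv //=.
  by case/andP: p0.
Qed.

Lemma hs_cons i w y : hs (i :: w) y = h i (hs w y).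
Proof. by []. Qed.

Lemma hs01 w y : 0 <= y <= 1 -> 0 <= hs w y <= 1.
Proof.
by elim: w => //= i w IH y01; apply: (@closure01 i); apply: inv_branchP; exact: IH.
Qed.

Section Constants.
Variables (rho L Ch eps : R).
Hypothesis rho_gt1 : 1 < rho.
Hypothesis Ch_ge0 : 0 <= Ch.
Hypothesis eps_gt0 : 0 < eps.
Hypothesis dH_ge : forall i x, a i <= x <= b i -> rho <= `|dH i x|.
Hypothesis dH_le : forall i x, a i <= x <= b i -> `|dH i x| <= L.
Hypothesis dH_holder : forall i x y, a i <= x <= b i -> a i <= y <= b i ->
  `| dH i x - dH i y | <= Ch * `|x - y| `^ eps.

Let rho_gt0 : 0 < rho. Proof. exact: lt_trans rho_gt1. Qed.
Let ri_ge0 : 0 <= rho^-1. Proof. by rewrite invr_ge0 ltW. Qed.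
Let ri_lt1 : rho^-1 < 1. Proof. by rewrite invf_lt1. Qed.

Lemma L_gt1 : 1 < L.
Proof.
have ai : a ord0 <= a ord0 <= b ord0 by rewrite lexx ltW.
exact: lt_le_trans rho_gt1 (le_trans (dH_ge ai) (dH_le ai)).
Qed.

Lemma branch_expand_ge i x y : a i <= x <= b i -> a i <= y <= b i ->
  rho * `|x - y| <= `|H i x - H i y|.
Proof.
move=> xi yi; have [c [ci _ _ ->]] := branch_mean_value xi yi.
by rewrite ler_wpM2r // dH_ge.
Qed.

Lemma branch_expand_le i x y : a i <= x <= b i -> a i <= y <= b i ->
  `|H i x - H i y| <= L * `|x - y|.
Proof.
move=> xi yi; have [c [ci _ _ ->]] := branch_mean_value xi yi.
by rewrite ler_wpM2r // dH_le.
Qed.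

Lemma inv_branch_contract i u v : 0 <= u <= 1 -> 0 <= v <= 1 ->
  `|h i u - h i v| <= rho^-1 * `|u - v|.
Proof.
move=> u01 v01; rewrite -[X in _ <= _ * `|X - _|](branchK i u01).
rewrite -[X in _ <= _ * `|_ - X|](branchK i v01) ler_pdivlMl //.
by apply: branch_expand_ge; exact: inv_branchP.
Qed.

Lemma hs_contract w u v : 0 <= u <= 1 -> 0 <= v <= 1 ->
  `|hs w u - hs w v| <= rho^-1 ^+ size w * `|u - v|.
Proof.
move=> u01 v01; elim: w => [|i w IH] /=; first by rewrite mul1r.
apply: le_trans (inv_branch_contract _ (hs01 w u01) (hs01 w v01)) _.
by rewrite exprS -mulrA ler_wpM2l.
Qed.

Lemma hs_cat u v y : hs (u ++ v) y = hs u (hs v y).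
Proof. by rewrite /inv_branches foldr_cat. Qed.

Let c0 : 0 <= (0 : R) <= 1. Proof. by rewrite lexx ler01. Qed.

Let hs_dist w u v : 0 <= u <= 1 -> 0 <= v <= 1 -> `|hs w u - hs w v| <= rho^-1 ^+ size w.
Proof.
move=> u01 v01; apply: le_trans (hs_contract w u01 v01) _.
rewrite ler_piMr ?exprn_ge0 //; move: u01 v01 => /andP[? ?] /andP[? ?].
by rewrite ler_norml; apply/andP; split; lra.
Qed.

(** The intervals of radius [rho^-1 ^+ k] about [hs (mkseq x k) 0] meet pairwise, so the supremum of
    their left ends lies in all of them. *)
Lemma coding_limit (x : symbol_seq m) : exists l : R,
  forall k, `|l - hs (mkseq x k) 0| <= rho^-1 ^+ k.
Proof.
pose c k := hs (mkseq x k) 0.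
have cauchy n k : c n - rho^-1 ^+ n <= c k + rho^-1 ^+ k.
  wlog nk : n k / (n <= k)%N => [W|].
    have [nk|/ltnW kn] := leqP n k; first exact: W.
    have : `|c n - c k| <= rho^-1 ^+ k.
      rewrite /c -(subnKC kn) mkseqD hs_cat.
      have := @hs_dist (mkseq x k) (hs (mkseq (fun i => x (k + i)%N) (n - k)) 0) 0 (hs01 _ c0) c0.
      by rewrite size_mkseq.
    have : 0 <= rho^-1 ^+ n by rewrite exprn_ge0.
    by rewrite ler_norml => ? /andP[? ?]; lra.
  have : `|c n - c k| <= rho^-1 ^+ n.
    rewrite distrC /c -(subnKC nk) mkseqD hs_cat.
    have := @hs_dist (mkseq x n) (hs (mkseq (fun i => x (n + i)%N) (k - n)) 0) 0 (hs01 _ c0) c0.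
    by rewrite size_mkseq.
  have : 0 <= rho^-1 ^+ k by rewrite exprn_ge0.
  by rewrite ler_norml => ? /andP[? ?]; lra.
pose A := [set c n - rho^-1 ^+ n | n in [set: nat]].
have hA : has_sup A.
  split; first by exists (c 0%N - rho^-1 ^+ 0); exists 0%N.
  by exists (c 0%N + rho^-1 ^+ 0) => _ [n _ <-]; exact: cauchy.
exists (sup A) => k; rewrite ler_distl; apply/andP; split.
  by apply: ub_le_sup; [case: hA|exists k].
by apply: ge_sup; [case: hA|move=> _ [n _ <-]; exact: cauchy].
Qed.

(** [coding] is a choice from a nested intersection. The limits of [coding_limit] satisfy the
    recursion, hence lie in the intersection, and contraction leaves room for no other point. *)
Lemma codingP (x : symbol_seq m) : 0 <= pi x <= 1 /\ pi x = h (x 0%N) (pi (shift x)).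
Proof.
have /choice[l Hl] := coding_limit.
have l01 y : 0 <= l y <= 1.
  have c01 k := hs01 (mkseq y k) c0.
  apply/andP; split; rewrite leNgt; apply/negP => neg.
    have e0 : 0 < - l y by rewrite oppr_gt0.
    have [k Hk] := exp_lt_pos 1 ri_ge0 ri_lt1 e0; have := Hl y k; have := c01 k.
    by rewrite ler_norml => /andP[? ?] /andP[? ?]; lra.
  have e0 : 0 < l y - 1 by rewrite subr_gt0.
  have [k Hk] := exp_lt_pos 1 ri_ge0 ri_lt1 e0; have := Hl y k; have := c01 k.
  by rewrite ler_norml => /andP[? ?] /andP[? ?]; lra.
have lS y : l y = h (y 0%N) (l (shift y)).
  apply/eqP; rewrite -subr_eq0; apply/eqP.
  apply: (exp_bound_eq0 (C := 2) ri_ge0 ri_lt1) => k.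
  have := Hl y k.+1; rewrite mkseq_cons hs_cons => H1.
  have H2 : `|h (y 0%N) (hs (mkseq (shift y) k) 0) - h (y 0%N) (l (shift y))| <= rho^-1 ^+ k.+1.
    apply: le_trans (inv_branch_contract _ (hs01 _ c0) (l01 _)) _.
    by rewrite exprS ler_wpM2l // distrC.
  apply: le_trans (ler_distD (h (y 0%N) (hs (mkseq (shift y) k) 0)) _ _) _.
  have : rho^-1 ^+ k.+1 <= rho^-1 ^+ k by rewrite exprS ler_piMl ?exprn_ge0 // ltW.
  lra.
have lE y n : l y = hs (mkseq y n) (l (iter n shift y)).
  elim: n y => [//|n IH] y; rewrite lS (IH (shift y)) -iterSr.
  by rewrite mkseq_cons.
have piE y : pi y = l y.
  apply: get_unique.
    move=> n _ /=; exists (l (iter n shift y)); first by rewrite /= in_itv /= l01.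
    by rewrite -lE.
  move=> z Hz; apply/eqP; rewrite -subr_eq0; apply/eqP.
  apply: (exp_bound_eq0 (C := 1) ri_ge0 ri_lt1) => k; rewrite mul1r.
  have [u /=] := Hz k I; rewrite in_itv /= => u01 <-; rewrite (lE y k).
  by have := hs_dist (mkseq y k) u01 (l01 (iter k shift y)); rewrite size_mkseq.
by rewrite !piE.
Qed.

Lemma coding_branch x : a (x 0%N) <= pi x <= b (x 0%N).
Proof. by have [_ ->] := codingP x; apply: inv_branchP; have [] := codingP (shift x). Qed.

Lemma branch_coding x : H (x 0%N) (pi x) = pi (shift x).
Proof. by have [_ ->] := codingP x; apply: branchK; have [] := codingP (shift x). Qed.

Lemma geometric_potential_le x : phi x <= - ln rho.
Proof.
rewrite /geometric_potential lerN2 ler_ln ?posrE //; first exact/dH_ge/coding_branch.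
exact: lt_le_trans (dH_ge (coding_branch x)).
Qed.

Lemma geometric_potential_ge x : - ln L <= phi x.
Proof.
have r0 := lt_le_trans rho_gt0 (dH_ge (coding_branch x)).
rewrite /geometric_potential lerN2 ler_ln ?posrE //; first exact/dH_le/coding_branch.
exact: lt_trans L_gt1.
Qed.

Lemma coding_dist x y n : mkseq x n = mkseq y n -> `|pi x - pi y| <= rho^-1 ^+ n.
Proof.
elim: n x y => [|n IH] x y.
  have [/andP[? ?] _] := codingP x; have [/andP[? ?] _] := codingP y => _.
  by rewrite ler_norml; apply/andP; split; lra.
rewrite !mkseq_cons => -[xy0 xyn].
rewrite exprS ler_pdivlMl //; apply: le_trans (IH _ _ xyn).
rewrite -!branch_coding -xy0; apply: branch_expand_ge; first exact: coding_branch.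
by rewrite xy0; exact: coding_branch.
Qed.

Let q := rho^-1 `^ eps.
Let q_ge0 : 0 <= q. Proof. exact: powR_ge0. Qed.
Let q_lt1 : q < 1.
Proof.
have : q < 1 `^ eps by apply: gt0_ltr_powR; rewrite ?nnegrE.
by rewrite powR1.
Qed.

Let qX n : (rho^-1 ^+ n) `^ eps = q ^+ n.
Proof. by rewrite -powR_mulrn // powRAC powR_mulrn. Qed.

(** Allowing every [c] as close to [pi x] as [pi y] is serves both [pi y] itself and the mean value
    point. The Hölder bound meets the contraction along the common prefix. *)
Let derivative_distortion x y n c : mkseq x n.+1 = mkseq y n.+1 ->
  a (x 0%N) <= c <= b (x 0%N) -> `|c - pi x| <= `|pi x - pi y| ->
  `|ln `|dH (x 0%N) c| + phi x| <= Ch * q ^+ n.+1.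
Proof.
move=> xy ci cx.
have r1 z : a (x 0%N) <= z <= b (x 0%N) -> 1 <= `|dH (x 0%N) z|.
  by move=> zi; apply: le_trans (ltW rho_gt1) (dH_ge zi).
apply: le_trans (ln_lipschitz (r1 _ ci) (r1 _ (coding_branch x))) _.
apply: le_trans (ler_dist_dist _ _) _.
apply: le_trans (dH_holder ci (coding_branch x)) _.
rewrite ler_wpM2l // -qX; apply: ge0_ler_powR; rewrite ?nnegrE ?exprn_ge0 ?(ltW eps_gt0) //.
exact: le_trans cx (coding_dist xy).
Qed.

(** Distortion accumulated over [n] common letters, a geometric series bounded independently of
    [n]. *)
Let B n := \sum_(k < n) Ch * q ^+ k.+1.

Let B_le n : B n <= Ch / (1 - q).
Proof.
rewrite /B -mulr_sumr ler_wpM2l //.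
apply: (@le_trans _ _ (\sum_(k < n) q ^+ k)).
  by apply: ler_sum => k _; rewrite exprS ler_piMl ?exprn_ge0 // ltW.
rewrite -[leRHS]mul1r ler_pdivlMr ?subr_gt0 //.
rewrite mulrC -opprB mulNr -subrX1 opprB lerBlDr lerDl; exact: exprn_ge0.
Qed.

Let BS n : B n.+1 = B n + Ch * q ^+ n.+1. Proof. exact: big_ord_recr. Qed.

Lemma birkhoffS n x : birkhoff phi n.+1 x = phi x + birkhoff phi n (shift x).
Proof. by rewrite -[n.+1]add1n birkhoffD /birkhoff big_ord1. Qed.

Let birkhoff_dist n x y : mkseq x n = mkseq y n ->
  birkhoff phi n x <= birkhoff phi n y + B n.
Proof.
elim: n x y => [|n IH] x y; first by rewrite /birkhoff !big_ord0 /B big_ord0 addr0.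
move=> xy; move: (xy); rewrite !mkseq_cons => -[xy0 /IH H1].
have yi : a (x 0%N) <= pi y <= b (x 0%N) by rewrite xy0; exact: coding_branch.
have := derivative_distortion xy yi.
rewrite distrC => /(_ (lexx _)); rewrite ler_norml => /andP[_].
have phiy : phi y = - ln `|dH (x 0%N) (pi y)| by rewrite /geometric_potential xy0.
have -> : ln `|dH (x 0%N) (pi y)| = - phi y by rewrite phiy opprK.
rewrite !birkhoffS BS; move: H1 {phiy yi}.
move: (birkhoff phi n (shift x)) (birkhoff phi n (shift y)) (B n) (Ch * _) => u v r e.
move: (phi x) (phi y) => s t; lra.
Qed.

(** At each step the derivative at a mean value point is traded for the derivative along the orbit
    of [x]; the errors add up to [B n] in the exponent. *)
Let expansion n x y : mkseq x n = mkseq y n ->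
  expR (birkhoff phi n x) * `|pi (iter n shift x) - pi (iter n shift y)|
    <= expR (B n) * `|pi x - pi y| /\
  `|pi x - pi y| <= expR (B n) *
    (expR (birkhoff phi n x) * `|pi (iter n shift x) - pi (iter n shift y)|).
Proof.
elim: n x y => [|n IH] x y.
  by rewrite /birkhoff /B !big_ord0 expR0 !mul1r.
move=> xy; move: (xy); rewrite !mkseq_cons => -[xy0 /IH].
rewrite -!iterSr => -[H1 H2].
have yi : a (x 0%N) <= pi y <= b (x 0%N) by rewrite xy0; exact: coding_branch.
have [c [ci cx _ E]] := branch_mean_value (coding_branch x) yi.
have d0 : 0 < `|dH (x 0%N) c| by exact: lt_le_trans rho_gt0 (dH_ge ci).
have := derivative_distortion xy ci cx; rewrite ler_norml => /andP[l1 l2].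
rewrite branch_coding xy0 branch_coding -xy0 in E.
rewrite E in H1 H2; rewrite birkhoffS BS !expRD.
set T := `|pi (iter n.+1 _ x) - _| in H1 H2 *.
set P := `|pi x - pi y| in H1 H2 *.
set S := expR (birkhoff _ _ _) in H1 H2 *.
have e1 : expR (phi x) * `|dH (x 0%N) c| <= expR (Ch * q ^+ n.+1).
  by rewrite -[X in _ * X]lnK ?posrE // -expRD ler_expR; lra.
have e2 : 1 <= expR (Ch * q ^+ n.+1) * (expR (phi x) * `|dH (x 0%N) c|).
  by rewrite -[X in _ * (_ * X)]lnK ?posrE // -!expRD -expR0 ler_expR; lra.
have P0 : 0 <= P by exact: normr_ge0.
have B0 : 0 < expR (B n) by exact: expR_gt0.
have p0 : 0 < expR (phi x) by exact: expR_gt0.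
split.
- apply: (@le_trans _ _ (expR (phi x) * (expR (B n) * (`|dH (x 0%N) c| * P)))).
    by rewrite -mulrA ler_wpM2l // ltW.
  have -> : expR (phi x) * (expR (B n) * (`|dH (x 0%N) c| * P)) =
    (expR (B n) * P) * (expR (phi x) * `|dH (x 0%N) c|) by ring.
  by rewrite [leRHS]mulrAC ler_wpM2l // mulr_ge0 // ltW.
- rewrite -(ler_pM2l d0); apply: le_trans H2 _.
  have -> : `|dH (x 0%N) c| * (expR (B n) * expR (Ch * q ^+ n.+1) * (expR (phi x) * S * T)) =
    (expR (B n) * (S * T)) * (expR (Ch * q ^+ n.+1) * (expR (phi x) * `|dH (x 0%N) c|)) by ring.
  by rewrite ler_peMr // !mulr_ge0 ?expR_ge0 ?normr_ge0.
Qed.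

Definition distortion_bound := Ch / (1 - q).

Let cylE (w : seq letter) x y : cylinder w x -> cylinder w y -> mkseq x (size w) = mkseq y (size w).
Proof. by move=> wx wy; rewrite [LHS]wx -[LHS]wy. Qed.

Lemma birkhoff_distortion w x y : cylinder w x -> cylinder w y ->
  birkhoff phi (size w) x <= birkhoff phi (size w) y + distortion_bound.
Proof.
move=> wx wy; apply: le_trans (birkhoff_dist (cylE wx wy)) _.
by rewrite lerD2l.
Qed.

Lemma coding_cylinder_ge w x y : cylinder w x -> cylinder w y ->
  (expR distortion_bound)^-1 * expR (birkhoff phi (size w) x) *
    `|pi (iter (size w) shift x) - pi (iter (size w) shift y)| <= `|pi x - pi y|.
Proof.
move=> wx wy; have [H1 _] := expansion (cylE wx wy).
rewrite -mulrA ler_pdivrMl ?expR_gt0 //; apply: le_trans H1 _.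
by rewrite ler_wpM2r // ler_expR.
Qed.

Lemma coding_cylinder_le w x y : cylinder w x -> cylinder w y ->
  `|pi x - pi y| <= expR distortion_bound * expR (birkhoff phi (size w) x).
Proof.
move=> wx wy; have [_ H1] := expansion (cylE wx wy); apply: le_trans H1 _.
apply: ler_pM; rewrite ?mulr_ge0 ?expR_ge0 ?normr_ge0 ?ler_expR //.
rewrite ler_piMr ?expR_ge0 //; exact: (@coding_dist _ _ 0).
Qed.

(** End points of a branch are mapped to 0 or 1, and a branch stretches distances at most by [L]. *)
Lemma coding_interior z (eta : R) : eta <= pi (shift z) <= 1 - eta ->
  a (z 0%N) + eta / L <= pi z <= b (z 0%N) - eta / L.
Proof.
move=> /andP[e1 e2]; have L0 : 0 < L by apply: lt_trans L_gt1.
have zi := coding_branch z; have /andP[az zb] := zi.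
set i := z 0%N in zi az zb *.
have ai : a i <= a i <= b i by rewrite lexx ltW.
have bi : a i <= b i <= b i by rewrite lexx ltW.
have far t : a i <= t <= b i -> H i t = 0 \/ H i t = 1 -> eta / L <= `|pi z - t|.
  move=> ti Ht; rewrite ler_pdivrMr // mulrC; apply: le_trans (branch_expand_le zi ti).
  rewrite branch_coding; case: Ht => ->.
    by rewrite subr0; apply: le_trans (ler_norm _).
  by rewrite distrC; apply: le_trans (ler_norm _); lra.
have fa : eta / L <= pi z - a i.
  by rewrite -[leRHS]ger0_norm ?subr_ge0 //; apply: far => //; case: (branch_endpoints i) => -[-> _]; auto.
have fb : eta / L <= b i - pi z.
  rewrite -[leRHS]ger0_norm ?subr_ge0 // distrC; apply: far => //.
  by case: (branch_endpoints i) => -[_ ->]; auto.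
by apply/andP; split; lra.
Qed.

Lemma branch_order i j : i <> j -> b i <= a j \/ b j <= a i.
Proof.
move=> ij; have [?|ba] := leP (b i) (a j); first by left.
have [?|bb] := leP (b j) (a i); first by right.
exfalso; apply: ij; pose l := Num.max (a i) (a j); pose r := Num.min (b i) (b j).
have lr : l < r by rewrite gt_max !lt_min !ab ba bb.
have /andP[l1 l2] : (a i <= l) && (a j <= l) by rewrite !le_max !lexx orbT.
have /andP[r1 r2] : (r <= b i) && (r <= b j) by rewrite !ge_min !lexx orbT.
apply: (branch_disjoint expanding) => //; exists ((l + r) / 2); split; apply: itv_sub => /=;
  rewrite in_itv /=; apply/andP; split; lra.
Qed.

(** The margin [e] is essential: closed branches may touch, so distinct first letters alone give no
    distance. *)
Lemma coding_separation x y (e : R) : 0 < e -> x 0%N <> y 0%N ->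
  a (x 0%N) + e <= pi x <= b (x 0%N) - e ->
  a (y 0%N) + e <= pi y <= b (y 0%N) - e -> e <= `|pi x - pi y|.
Proof.
move=> e0 xy /andP[x1 x2] /andP[y1 y2].
case: (branch_order xy) => o.
  by rewrite distrC; apply: le_trans (ler_norm _); lra.
by apply: le_trans (ler_norm _); lra.
Qed.

(** Let branch [i] lie to the left. If it preserves orientation, a second letter [j] keeps the image
    under [H i] away from 0; if it reverses orientation, a second letter [i] keeps the image away
    from 1. Either way the point stays off 0, and lying in the left branch it stays off 1. Using
    only [i] and [j] allows a word of letters of step 0. *)
Lemma interior_word i j : i <> j -> exists u (eta : R),
  [/\ 0 < eta, {subset u <= [:: i; j]}, size u = 2 &
   forall z, cylinder u z -> eta <= pi z <= 1 - eta].
Proof.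
have L0 : 0 < L by apply: lt_trans L_gt1.
have L1 := L_gt1.
have cyl2 k l z : cylinder [:: k; l] z -> z 0%N = k /\ shift z 0%N = l.
  by move=> [? ?].
wlog ij : i j / b i <= a j => [W ne|ne].
  case: (branch_order ne) => [|ji]; first by move/W; exact.
  have [u [eta [e0 su s2 Hu]]] := W _ _ ji (nesym ne).
  by exists u, eta; split => // l /su; rewrite !inE orbC.
have aj1 : a j < 1 by exact: lt_le_trans (ab j) (b_le1 j).
have bi0 : 0 < b i by exact: le_lt_trans (a_ge0 i) (ab i).
have aj0 : 0 < a j by exact: lt_le_trans ij.
have ai : a i <= a i <= b i by rewrite lexx ltW.
have lower z (d : R) : z 0%N = i -> d <= `|pi (shift z) - H i (a i)| -> d / L <= pi z.
  move=> zi; have := coding_branch z; rewrite zi => zb dz.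
  have : d <= L * `|pi z - a i|.
    apply: le_trans dz _; rewrite -branch_coding zi; exact: branch_expand_le.
  move: zb => /andP[za _]; rewrite ger0_norm ?subr_ge0 // -ler_pdivrMl // mulrC => h1.
  by apply: le_trans h1 _; rewrite gerBl a_ge0.
case: (branch_endpoints i) => -[Ha _].
- exists [:: i; j], (Num.min (a j / L) (1 - a j)); split.
  + by rewrite lt_min divr_gt0 // subr_gt0.
  + by [].
  + by [].
  + move=> z /cyl2[z0 z1]; apply/andP; split.
      rewrite ge_min lower // Ha subr0; apply: le_trans (ler_norm _).
      by have := coding_branch (shift z); rewrite z1 => /andP[].
    have := coding_branch z; rewrite z0 => /andP[_ zb].
    rewrite lerBrDr -lerBrDl; apply: (@le_trans _ _ (1 - a j)).
      by rewrite ge_min lexx orbT.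
    by lra.
- exists [:: i; i], (Num.min ((1 - b i) / L) (1 - b i)); split.
  + by rewrite lt_min divr_gt0 ?subr_gt0 ?(le_lt_trans ij).
  + by move=> l; rewrite !inE orbb => ->.
  + by [].
  + move=> z /cyl2[z0 z1]; apply/andP; split.
      rewrite ge_min lower // Ha distrC; apply: le_trans (ler_norm _).
      have := coding_branch (shift z); rewrite z1 => /andP[]; lra.
    have := coding_branch z; rewrite z0 => /andP[_ zb].
    rewrite lerBrDr -lerBrDl; apply: (@le_trans _ _ (1 - b i)).
      by rewrite ge_min lexx orbT.
    by lra.
Qed.

(** * Dynamics of the lift *)

Section Lift.
Variable Psi : R -> int.
Hypothesis Psi_cst : forall i x y, I_ i x -> I_ i y -> Psi x = Psi y.

Local Notation step := (step_value I_ Psi).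
Local Notation D := (boundary_points I_ H).
Local Notation G := (Defs.lift F Psi).
Local Notation dom := (lift_domain I_ H).

Lemma boundary_points_hs w : D (hs w 0) /\ D (hs w 1).
Proof. by split; [exists w => //; exists 0|exists w => //; exists 1] => //; [left|right]. Qed.

Lemma boundary_points_inv_branch i y : D y -> D (h i y).
Proof.
by move=> [w _ [z z01 <-]]; exists (i :: w) => //; exists z.
Qed.

(** End points of branches are preimages of 0 or 1 and hence boundary points, so a coded point
    outside [D] lies in the open branch. *)
Lemma coding_not_boundary x : ~ D (pi x) ->
  [/\ 0 < pi x < 1, I_ (x 0%N) (pi x) & ~ D (pi (shift x))].
Proof.
move=> nD; have [/andP[x0 x1] xS] := codingP x.
have zi := coding_branch x; set i := x 0%N in zi xS *.
have [D0 D1] := boundary_points_hs [::].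
have [Di0 Di1] := boundary_points_hs [:: i].
have ai : a i <= a i <= b i by rewrite lexx ltW.
have bi : a i <= b i <= b i by rewrite lexx ltW.
have end_D t : a i <= t <= b i -> H i t = 0 \/ H i t = 1 -> D t.
  by move=> ti Ht; rewrite -(inv_branchK ti); case: Ht => ->.
have Da : D (a i) by apply: end_D => //; case: (branch_endpoints i) => -[-> _]; auto.
have Db : D (b i) by apply: end_D => //; case: (branch_endpoints i) => -[_ ->]; auto.
have ne t : D t -> t != pi x by move=> Dt; apply/eqP => E; apply: nD; rewrite -E.
split.
- by rewrite !lt_neqAle x0 x1 (ne 0) //= eq_sym (ne 1).
- apply: itv_sub; rewrite /= in_itv /= !lt_neqAle; case/andP: zi => -> ->.
  by rewrite (ne (a i)) //= andbT eq_sym ne.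
- by move=> DS; apply: nD; rewrite xS; exact: boundary_points_inv_branch.
Qed.

Lemma lift_coding x k : ~ D (pi x) ->
  G (pi x + k%:~R) = (k + step (x 0%N))%:~R + pi (shift x).
Proof.
move=> nD; have [/andP[x0 x1] xI _] := coding_not_boundary nD.
rewrite /Defs.lift -(@fsbig_widen _ _ _ _ [set k]) //; last first.
  move=> j [_ /= jk]; rewrite indicE memNset ?mulr0 //= in_itv /= => /andP[h0 h1].
  apply: jk; apply/eqP; rewrite eq_le -!(ler_int R).
  have e1 : j%:~R < (k + 1)%:~R :> R by rewrite intrD; lra.
  have e2 : k%:~R < (j + 1)%:~R :> R by rewrite intrD; lra.
  by rewrite !ler_int; rewrite !ltr_int !ltzD1 in e1 e2; rewrite e1 e2.
rewrite fsbig_set1 addrK indicE mem_set ?mulr1; last by rewrite /= in_itv /= !ltW.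
rewrite -(branch_extends expanding xI) branch_coding intrD.
rewrite (_ : Psi (pi x) = step (x 0%N)); first by ring.
by apply: (Psi_cst xI); exact: getI xI.
Qed.

Lemma iter_lift_coding x k n : ~ D (pi x) ->
  iter n G (pi x + k%:~R) = (k + walk step (mkseq x n))%:~R + pi (iter n shift x).
Proof.
elim: n x k => [|n IH] x k nD; first by rewrite /walk big_nil addr0 addrC.
have [_ _ nDS] := coding_not_boundary nD.
rewrite iterSr lift_coding // addrC IH // mkseq_cons walk_cons -iterSr.
by rewrite addrA.
Qed.

(** * Transient sets in the direction of a sign *)

Section Sign.
Variables (sg : int) (M : nat).
Hypothesis sg1 : `|sg|%N = 1%N.
Let sgsg : sg * sg = 1. Proof. exact: absz1_sqr. Qed.
Let t i : int := sg * step i.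
Hypothesis t_bound : forall i, (`|t i| <= M)%N.
Let e : R := sg%:~R.
Local Notation T := (transient I_ F H Psi e).

Lemma walk_sign w : walk t w = sg * walk step w.
Proof. by rewrite /walk mulr_sumr. Qed.

Lemma iter_lift_sign x k n : ~ D (pi x) ->
  e * iter n G (pi x + (sg * k)%:~R) =
  (k + walk t (mkseq x n))%:~R + e * pi (iter n shift x).
Proof.
move=> nD; rewrite iter_lift_coding // mulrDr; congr (_ + _).
by rewrite /e -intrM walk_sign mulrDr mulrA sgsg mul1r.
Qed.

Lemma sign_coding_le x : `|e * pi x| <= 1.
Proof.
rewrite normrM (_ : `|e| = 1); last by rewrite /e -intr_norm -abszE sg1.
by have [/andP[? ?] _] := codingP x; rewrite mul1r ger0_norm.
Qed.

(** This common consequence of the three kinds is all that the upper bounds need. *)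
Lemma transient_eventually c y : T c y ->
  exists (C : R) N, forall n, (N <= n)%N -> C <= e * iter n G y.
Proof.
case: c => [[_ /cvgryPge /(_ 0) [N _ HN]]|[_]|r [_ Hr]].
- by exists 0, N => n /HN.
- move=> fin; have [N HN] : exists N, (esups (fun n => (- e * iter n G y)%:E) N < +oo)%E.
    apply: contrapT => /forallNP h; move: fin; rewrite limn_esup_lim.
    rewrite (_ : esups _ = fun=> +oo%E) ?lim_cst ?ltxx //.
    by apply/funext => n; apply/eqP; have /negP := h n; rewrite -leNgt leye_eq.
  have ub n : (N <= n)%N -> ((- e * iter n G y)%:E <= esups (fun n => (- e * iter n G y)%:E) N)%E.
    by move=> Nn; apply: ereal_sup_ubound; exists n.
  move: HN ub; case: (esups _ N) => [C| |] // _ ub.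
    exists (- C), N => n /ub; rewrite lee_fin mulNr; lra.
  by have := ub N (leqnn N).
- by exists r, 0%N => n _; exact: ltW.
Qed.

(** The walk is bounded below, hence minimal at some time [n0], and nonnegative when restarted
    there. The discarded prefix and the integer translate leave countably many cases. *)
Lemma transient_sub_nonneg_walk c : T c `<=`
  \bigcup_(p : (seq letter * int)%type)
    ((fun y => y + p.2%:~R) @` ((hs p.1) @` (pi @` [set x | forall n, 0 <= walk t (mkseq x n)]))).
Proof.
move=> y Ty; have [dy [C [N HC]]] : dom y /\ exists (C : R) N, forall n, (N <= n)%N -> C <= e * iter n G y.
  by split; [case: c Ty => [[]|[]|r []]|exact: transient_eventually Ty].
have [_ [[x _ <-] nD] [k _ yE]] := dy.
have {}yE : y = pi x + (sg * (sg * k))%:~R.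
  by rewrite -yE mulrA sgsg mul1r.
have [Bd HB] : exists Bd : nat, forall n, - Bd%:Z <= walk t (mkseq x n).
  (* From time [N] on, [C] bounds the walk up to the integer translate and a coded point of size at
     most 1; before that the walk is at least [- (M * N)]. *)
  pose Bd := (Num.truncn `|C - (sg * k)%:~R - 1|).+1.
  exists (Bd + M * N)%N => n; have [nN|Nn] := leqP N n.
    have := HC _ nN; rewrite yE iter_lift_sign // intrD.
    have := sign_coding_le (iter n shift x); rewrite ler_norml => /andP[_ h1] h2.
    apply: (@le_trans _ _ (- Bd%:Z)); first by rewrite lerN2 lez_nat leq_addr.
    rewrite -(ler_int R) intrN.
    have : `|C - (sg * k)%:~R - 1| < Bd%:R by exact: truncnS_gt.
    rewrite ltr_norml => /andP[h3 _].
    rewrite (_ : (Bd%:Z)%:~R = Bd%:R :> R) //; lra.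
  apply: (absz_le_oppz (walk_bound t_bound (mkseq x n))).
  rewrite size_mkseq; apply: leq_trans (leq_addl _ _).
  by rewrite leq_mul2l ltnW ?orbT.
have [n0 Hn0] : exists n0, forall n, walk t (mkseq x n0) <= walk t (mkseq x n).
  have ex : exists j : nat, `[< exists n, walk t (mkseq x n) == j%:Z - Bd%:Z >].
    exists `|(walk t (mkseq x 0) + Bd%:Z)%R|%N; apply/asboolP; exists 0%N.
    by rewrite {1}(absz_shift (HB 0%N)).
  case: (ex_minnP ex) => j /asboolP[n0 /eqP n0j] jmin; exists n0 => n.
  rewrite n0j (absz_shift (HB n)) lerD2r lez_nat.
  by apply: jmin; apply/asboolP; exists n; rewrite {1}(absz_shift (HB n)).
exists (mkseq x n0, k) => //=; exists (pi x); last by rewrite yE mulrA sgsg mul1r.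
exists (pi (iter n0 shift x)).
  exists (iter n0 shift x) => // n /=.
  by have := Hn0 (n0 + n)%N; rewrite mkseq_shift walk_cat lerDl.
elim: (n0) (x) => [//|n IH] z; rewrite mkseq_cons hs_cons iterSr IH.
by have [_ <-] := codingP z.
Qed.

Lemma transient_null s c : 0 < s ->
  hausdorff_null s (pi @` [set x | forall n, 0 <= walk t (mkseq x n)]) ->
  hausdorff_null s (T c).
Proof.
move=> s0 H0; apply: (hausdorff_null_subset (@transient_sub_nonneg_walk c)).
apply: hausdorff_null_bigcup => // -[w k] /=.
apply: hausdorff_null_image; first by move=> x y _ _; rewrite /= opprD addrACA subrr addr0.
apply: hausdorff_null_image H0 => _ _ [x _ <-] [y _ <-].
have [x01 _] := codingP x; have [y01 _] := codingP y.
apply: le_trans (hs_contract w x01 y01) _.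
by rewrite ler_piMl // exprn_ile1 // ltW.
Qed.

(** [g] is the guaranteed gain per [N] letters. A positive gain forces divergence; [g = 0] only
    keeps the orbit bounded below, which suffices for [T2], and for [T3] from a large starting
    height [k]. *)
Lemma transient_of_walk c x (g N : nat) : ~ D (pi x) -> (0 < N)%N ->
  (forall n, (g * (n %/ N))%:Z - (M * N)%:Z <= walk t (mkseq x n)) ->
  (c = T1 -> (0 < g)%N) ->
  forall k : nat, (forall r, c = T3 r -> r + (M * N)%:R + 1 < k%:R) ->
  T c (pi x + (sg * k%:Z)%:~R).
Proof.
move=> nD N0 Hw g0 k kr.
have dx : dom (pi x + (sg * k%:Z)%:~R) by exists (pi x); [split => //; exists x|exists (sg * k%:Z)].
have lower n : k%:R + (g * (n %/ N))%:R - (M * N)%:R - 1 <= e * iter n G (pi x + (sg * k%:Z)%:~R).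
  rewrite iter_lift_sign // intrD; have := Hw n; rewrite -(ler_int R) intrB.
  have := sign_coding_le (iter n shift x); rewrite ler_norml => /andP[h1 _] h2.
  rewrite -![_%:R]/(_%:Z%:~R); lra.
case: c g0 kr => [g0 _|_ _|r _ kr]; split => //.
- apply/cvgryPge => A; near=> n; apply: le_trans (lower n).
  have gn : (n %/ N)%:R <= (g * (n %/ N))%:R :> R by rewrite ler_nat leq_pmull // g0.
  suff : A + (M * N)%:R + 1 <= (n %/ N)%:R by have : 0 <= k%:R :> R by []; lra.
  apply: ltW; apply: lt_le_trans (truncnS_gt _) _; rewrite ler_nat.
  rewrite leq_divRL //; near: n; exact: nbhs_infty_ge.
- rewrite limn_esup_lim; apply: (@le_lt_trans _ _ ((M * N)%:R + 1)%:E); last exact: ltry.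
  apply: lime_le; first exact: is_cvg_esups.
  apply: nearW => n; apply: ge_ereal_sup => _ [j _ <-]; rewrite lee_fin mulNr.
  have := lower j; have : 0 <= k%:R :> R by []; have : 0 <= (g * (j %/ N))%:R :> R by [].
  lra.
- move=> n; apply: lt_le_trans (lower n); have := kr r erefl.
  have : 0 <= (g * (n %/ N))%:R :> R by [].
  lra.
Unshelve. all: by end_near.
Qed.

Lemma coding_interior_iter z (eta : R) j : eta <= pi (iter j.+1 shift z) <= 1 - eta ->
  a (z 0%N) + eta / L ^+ j.+1 <= pi z <= b (z 0%N) - eta / L ^+ j.+1.
Proof.
elim: j z => [|j IH] z Hz; first by rewrite expr1; exact: coding_interior.
have := IH (shift z); rewrite -iterSr => /(_ Hz) /andP[h1 h2].
rewrite exprSr invfM mulrA; apply: coding_interior; apply/andP; split.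
  by apply: le_trans h1; rewrite lerDr a_ge0.
by apply: le_trans h2 _; rewrite lerD2r b_le1.
Qed.

(* Blocks in [V] end with the interior word [u], so the orbits stay away from
   the end points of the branches and the Cantor set is strongly separated. *)
Lemma transient_not_null_of_words s c P u (eta : R) (g : nat) :
  0 < s -> 0 < eta -> (0 < size u)%N ->
  (forall z, cylinder u z -> eta <= pi z <= 1 - eta) ->
  (forall C, exists n, C <= weight_sum phi s n P) ->
  (forall w, P w -> g%:Z <= walk t (w ++ u)) ->
  (c = T1 -> (0 < g)%N) ->
  ~ hausdorff_null s (T c).
Proof.
move=> s0 eta0 su Hu grow Pw g0 null.
have lr0 : 0 < ln rho by exact: ln_gt0.
pose Db := distortion_bound.
(* The threshold of [block_set_not_null], the loss of one concatenation, and the weight of the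
   appended [u]. *)
pose C := expR (s * Db) * expR (s * Db *+ 2) / expR (s * sup_birkhoff phi u).
have [n0 Hn0] := grow C.
pose N := (n0 + size u)%N; have N0 : (0 < N)%N by rewrite /N addn_gt0 su orbT.
pose V w := P (take n0 w) && (drop n0 w == u).
have ZV : expR (s * Db) <= weight_sum phi s N V.
  have := @weight_sum_cat _ _ _ _ _ geometric_potential_le birkhoff_distortion s n0 (size u) P
    (pred1 u) V (ltW s0).
  rewrite -/N -/Db => HZ.
  rewrite -(ler_pM2l (expR_gt0 (s * Db *+ 2))) mulrC; apply: le_trans (HZ _); last first.
    by move=> w v wn vn Pw' /eqP ->; rewrite /V take_size_cat // drop_size_cat // Pw' eqxx.
  rewrite -ler_pdivrMr; last first.
    apply: lt_le_trans (expR_gt0 _) _; last exact: (weight_sum_ge_word phi s (P := pred1 u) (eqxx u)).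
  apply: le_trans Hn0; rewrite /C ler_wpM2l ?mulr_ge0 ?expR_ge0 // lef_pV2 ?posrE ?expR_gt0 //.
    exact: (weight_sum_ge_word phi s (P := pred1 u) (eqxx u)).
  apply: lt_le_trans (expR_gt0 _) _; last exact: (weight_sum_ge_word phi s (P := pred1 u) (eqxx u)).
have L0 : 0 < L by apply: lt_trans L_gt1.
(* From any position the next closing word [u] starts at most [N] letters ahead, and each letter
   costs a factor [L] of the margin. *)
pose eta' := eta / L ^+ N.
have eta'0 : 0 < eta' by rewrite divr_gt0 ?exprn_gt0.
have deep x n : block_set N V x -> a (x n) + eta' <= pi (iter n shift x) <= b (x n) - eta'.
  move=> Ex; pose k := ((n + size u) %/ N)%N; pose j := (k * N + n0 - n)%N.
  have /andP[kn kN] := block_index n N0; rewrite -/N -/k in kn kN.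
  have j0 : (0 < j)%N by rewrite /j subn_gt0.
  have jN : (j <= N)%N by rewrite /j leq_subLR.
  have cu : cylinder u (iter (k * N + n0) shift x).
    have /andP[_ /eqP <-] := Ex k; rewrite /block /N mkseqD drop_size_cat ?size_mkseq //.
    by rewrite /cylinder /= size_mkseq; apply: eq_mkseq => i; rewrite !iter_shiftE addnA.
  have := Hu _ cu; rewrite (_ : k * N + n0 = j.-1.+1 + n)%N; last first.
    by rewrite prednK // /j subnK //; move: j0; rewrite /j subn_gt0 => /ltnW.
  rewrite iterD => /coding_interior_iter; rewrite prednK // iter_shiftE addn0 => /andP[h1 h2].
  have le' : eta' <= eta / L ^+ j.
    rewrite /eta' ler_wpM2l ?(ltW eta0) // lef_pV2 ?posrE ?exprn_gt0 //.
    by rewrite ler_weXn2l // ltW // L_gt1.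
  by apply/andP; split; [apply: le_trans h1; rewrite lerD2l|
    apply: le_trans h2 _; rewrite lerD2l lerN2].
have := @block_set_not_null _ _ _ _ _ lr0 geometric_potential_le birkhoff_distortion pi
  (expR Db) (ln L) (expR_gt0 _) geometric_potential_ge coding_cylinder_ge s N V eta' s0 N0 eta'0.
move=> /(_ _ ZV); apply.
  move=> x y n Ex Ey _ xyn; apply: coding_separation => //; rewrite ?iter_shiftE ?addn0 //.
  - exact/eqP.
  - exact: deep.
  - exact: deep.
have block_walk x k : block_set N V x -> (g * k)%:Z <= walk t (mkseq x (k * N)).
  move=> Ex; elim: k => [|k IH]; first by rewrite muln0 mul0n /walk big_nil.
  rewrite mkseq_block walk_cat mulnS; have /andP[/Pw] := Ex k.
  move=> + /eqP Eu; rewrite -[X in walk t (_ ++ X)]Eu cat_take_drop => h.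
  by rewrite addnC PoszD lerD.
have walk_ge x n : block_set N V x -> (g * (n %/ N))%:Z - (M * N)%:Z <= walk t (mkseq x n).
  move=> Ex; rewrite {2}(divn_eq n N) mkseq_shift walk_cat.
  apply: lerD; first exact: block_walk.
  apply: (absz_le_oppz (walk_bound t_bound (mkseq (iter (n %/ N * N) shift x) (n %% N)))).
  by rewrite size_mkseq leq_mul2l ltnW ?orbT // ltn_pmod.
pose k := (Num.truncn (Num.max 0 ((if c is T3 r then r else 0) + (M * N)%:R + 1))).+1.
have kr r : c = T3 r -> r + (M * N)%:R + 1 < k%:R.
  move=> cr; apply: le_lt_trans (truncnS_gt _); by rewrite cr le_max lexx orbT.
(* Boundary points are countable, so they can be removed; the rest of the Cantor set translates into
   [T c]. *)
have DN : hausdorff_null s D.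
  apply: (@hausdorff_null_subset _ _ _ (\bigcup_(w : seq letter) ([set hs w 0] `|` [set hs w 1]))).
    by move=> y [w _ [z [->|->] <-]]; exists w => //; [left|right].
  apply: hausdorff_null_bigcup => // w.
  by apply: hausdorff_nullU => //; exact: hausdorff_null_set1.
have tN : hausdorff_null s ((fun y => y - (sg * k%:Z)%:~R) @` T c).
  apply: hausdorff_null_image null => x y _ _.
  by rewrite /= opprB addrA subrK.
apply: hausdorff_null_subset (hausdorff_nullU s0 DN tN) => _ [x Ex <-].
have [Dx|nD] := pselect (D (pi x)); [by left|right].
exists (pi x + (sg * k%:Z)%:~R); last by rewrite addrK.
by apply: (@transient_of_walk c x g N) => // n; exact: walk_ge.
Qed.

Local Notation Z := (weight_sum phi).

Let lnrho_gt0 : 0 < ln rho. Proof. exact: ln_gt0. Qed.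

Lemma weight_sum_pred1_le1 s n w : 0 <= s -> Z s n (pred1 w) <= 1.
Proof.
move=> s0; have [wn|wn] := boolP (w \in words m n); last first.
  rewrite /weight_sum big_seq_cond big1 // => v /andP[vn /eqP vw].
  by rewrite -vw vn in wn.
rewrite /weight_sum big_mkcond (bigD1_seq w) ?uniq_words //= eqxx big1 ?addr0; last first.
  by move=> v /negbTE ->.
rewrite -[leRHS]expR0 ler_expR mulr_ge0_le0 //.
apply: le_trans (sup_birkhoff_le_size geometric_potential_le w) _.
by rewrite oppr_le0 mulr_ge0 // ltW.
Qed.

(** With at most one letter of step 0, each length has at most one word of nonnegative walk, of
    weight at most 1. *)
Lemma two_zero_letters s : 0 <= s -> (forall i, t i <= 0) ->
  (forall C, exists n, C <= Z s n (fun w => 0 <= walk t w)) ->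
  exists i j, [/\ i <> j, t i = 0 & t j = 0].
Proof.
move=> s0 t0 grow; apply: contrapT => nz2.
have [z Hz] : exists z, forall i, t i = 0 -> i = z.
  have [[z tz]|nz] := pselect (exists z, t z = 0).
    by exists z => i ti; apply: contrapT => iz; apply: nz2; exists i, z.
  by exists ord0 => i ti; case: nz; exists i.
have [n] := grow 2; apply/negP; rewrite -ltNge.
apply: (@le_lt_trans _ _ 1); last by rewrite ltr1n.
apply: le_trans (weight_sum_pred1_le1 n (nseq n z) s0).
apply: weight_sum_sub => w <- Ww; apply/eqP/all_pred1P/allP => i iw.
by apply/eqP/Hz/(zero_letters t0 Ww).
Qed.

Lemma step_gt0 i : (0 < e * (step i)%:~R) = (0 < t i).
Proof. by rewrite /e -intrM ltr0z. Qed.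

(** A positive step lifts words high enough to compensate the separating word [u] and to gain 1 per
    block. Otherwise [u] is made of letters of step 0, two of which exist by growth, and then
    [escapes] excludes [T1]. *)
Lemma transient_not_null_of_growth s c : 0 < s ->
  (c = T1 -> escapes I_ Psi e) ->
  ((exists i, 0 < t i) -> exists B : int, forall C, exists n, C <= Z s n (fun w => B <= walk t w)) ->
  ((forall i, t i <= 0) -> forall C, exists n, C <= Z s n (fun w => 0 <= walk t w)) ->
  ~ hausdorff_null s (T c).
Proof.
move=> s0 esc pos nopos.
have [[i ti]|np] := pselect (exists i, 0 < t i).
  have [B0 grow] := pos (ex_intro _ i ti).
  have [|u [eta [eta0 _ su Hu]]] := @interior_word ord0 ord_max; first by [].
  have grow' := weight_sum_boost lnrho_gt0 geometric_potential_le birkhoff_distortion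
     (1 - walk t u) (ltW s0) ti grow.
  apply: (transient_not_null_of_words s0 eta0 _ Hu grow' (g := 1)) => //; first by rewrite su.
  by move=> w; rewrite walk_cat lerBlDr.
have t0 i : t i <= 0 by rewrite leNgt; apply/negP => ti; apply: np; exists i.
have grow := nopos t0.
have [i [j [ij ti tj]]] := two_zero_letters (ltW s0) t0 grow.
have [u [eta [eta0 uij su Hu]]] := interior_word ij.
have Wu : walk t u = 0.
  rewrite /walk big_seq big1 // => l /uij; rewrite !inE => /orP[]/eqP-> //.
apply: (transient_not_null_of_words s0 eta0 _ Hu grow (g := 0)) => //; first by rewrite su.
  by move=> w; rewrite walk_cat Wu addr0.
move=> /esc[[l]|zz]; first by rewrite step_gt0 => tl; case: np; exists l.
exfalso; apply: ij; apply: zz; apply/eqP.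
- by move: ti => /eqP; rewrite mulf_eq0 => /orP[/eqP sg0|//]; move: sg1; rewrite sg0.
- by move: tj => /eqP; rewrite mulf_eq0 => /orP[/eqP sg0|//]; move: sg1; rewrite sg0.
Qed.

(** * Dimensions as exponents of word sums *)

Section Dimension.
Variables (p : seq letter -> R) (delta c0' K : R).
Hypothesis p_nil : p [::] = 1.
Hypothesis p_cons : forall w, \sum_i p (i :: w) = p w.
Hypothesis p_rcons : forall w, \sum_i p (rcons w i) = p w.
Hypothesis c_gt0 : 0 < c0'.
Hypothesis p_ge : forall w, c0'^-1 * expR (delta * sup_birkhoff phi w) <= p w.
Hypothesis p_le : forall w, p w <= c0' * expR (delta * sup_birkhoff phi w).
Hypothesis delta_gt0 : 0 < delta.
Hypothesis K_ge : M%:R <= K.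

Let near0 w : bool := (`|walk t w|%N%:R <= K).

(** The 0-Poincaré exponent with its sum grouped by word length; replacing the step by [t] changes
    at most the sign of the walk. *)
Definition return_exponent : R :=
  inf [set s | 0 <= s /\ (\sum_(0 <= n <oo) (Z s n near0)%:E < +oo)%E].
Local Notation delta0 := return_exponent.

Lemma weight_sum_anti s s' n P : s <= s' -> Z s' n P <= Z s n P.
Proof.
move=> ss'; apply: le_trans (weight_sum_gain geometric_potential_le n P ss').
rewrite ler_peMl ?weight_sum_ge0 // -[leLHS]expR0 ler_expR.
by rewrite mulr_ge0 // mulr_ge0 ?subr_ge0 // ltW.
Qed.

Let mem_ge s : delta < s -> 0 <= s /\ (\sum_(0 <= n <oo) (Z s n near0)%:E < +oo)%E.
Proof.
move=> ds; split; first exact: ltW (lt_trans delta_gt0 ds).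
have k0 : 0 < (s - delta) * ln rho by rewrite mulr_gt0 ?subr_gt0.
apply: (@geometric_series_lt_pinfty _ _ c0' (expR (- ((s - delta) * ln rho)))).
- exact: expR_ge0.
- by rewrite expR_lt1 oppr_lt0.
- by move=> n; exact: weight_sum_ge0.
- move=> n; apply: (@le_trans _ _ (Z s n predT)); first exact: weight_sum_sub.
  rewrite -expRM_natr mulNr expRN ler_pdivlMr ?expR_gt0 // mulrC.
  apply: le_trans (weight_sum_gain geometric_potential_le n predT (ltW ds)) _.
  exact: (weight_sum_le_gibbs p_nil p_rcons).
Qed.

Let has_inf_exponents :
  has_inf [set s | 0 <= s /\ (\sum_(0 <= n <oo) (Z s n near0)%:E < +oo)%E].
Proof.
split; last by exists 0 => s [].
by exists (delta + 1); apply: mem_ge; rewrite ltrDl.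
Qed.

Lemma return_exponent_ge0 : 0 <= delta0.
Proof. by apply: lb_le_inf; [have [] := has_inf_exponents|move=> s []]. Qed.

Let summable_of_gt s : delta0 < s -> (\sum_(0 <= n <oo) (Z s n near0)%:E < +oo)%E.
Proof.
move=> ds; have [|r [r0 Hr] rs] := @inf_adherent _ _ (s - delta0) _ has_inf_exponents.
  by rewrite subr_gt0.
rewrite subrKC in rs; apply: le_lt_trans Hr.
apply: lee_nneseries => [n _ _|n _]; first by rewrite lee_fin weight_sum_ge0.
by rewrite lee_fin weight_sum_anti // ltW.
Qed.

Let not_summable_of_lt s : 0 <= s -> s < delta0 ->
  (\sum_(0 <= n <oo) (Z s n near0)%:E = +oo)%E.
Proof.
move=> s0 sd; apply/eqP; rewrite eq_le leey leNgt; apply/negP => h.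
move: sd; apply/negP; rewrite -leNgt; apply: ge_inf; first by have [] := has_inf_exponents.
by split.
Qed.

Let near0_nat w : near0 w -> (`|walk t w| <= Num.truncn K)%N.
Proof. by move=> h; rewrite truncn_ge_nat // (le_trans _ h). Qed.

Lemma transient_null_of_lt_delta s c : 0 < s -> delta0 < s -> s < delta ->
  mean_step p t <= 0 -> hausdorff_null s (T c).
Proof.
move=> s0 ds sd mean; apply: transient_null => //.
have bs : (\sum_(0 <= n <oo) (Z s n (fun w => (`|walk t w| <= M)%N))%:E < +oo)%E.
  apply: le_lt_trans (summable_of_gt ds); apply: lee_nneseries => [n _ _|n _].
    by rewrite lee_fin weight_sum_ge0.
  rewrite lee_fin; apply: weight_sum_sub => w _ WM; apply: le_trans K_ge.
  by rewrite ler_nat.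
(* Without a descending letter, a mean at most 0 and positive cylinder weights force [t = 0]. Then
   every word returns, and summability at [s < delta] contradicts [pressure_zero_series]. *)
have [i ti] : exists i, t i < 0.
  apply: contrapT => nneg; have t0 i : 0 <= t i.
    by rewrite leNgt; apply/negP => ti; apply: nneg; exists i.
  have pg w : 0 < p w := gibbs_gt0 c_gt0 p_ge w.
  have tz i : t i = 0.
    apply/eqP; rewrite eq_le t0 andbT leNgt; apply/negP => ti.
    move: mean; apply/negP; rewrite -ltNge /mean_step (bigD1 i) //=.
    rewrite ltr_pwDl ?mulr_gt0 ?ltr0z // sumr_ge0 // => j _.
    by rewrite mulr_ge0 ?ler0z // ltW.
  have := pressure_zero_series lnrho_gt0 geometric_potential_le p_nil p_rcons c_gt0 p_le (ltW sd).
  suff : (\sum_(0 <= n <oo) (Z s n predT)%:E < +oo)%E by move=> + E; rewrite E ltxx.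
  apply: le_lt_trans bs; apply: lee_nneseries => [n _ _|n _].
    by rewrite lee_fin weight_sum_ge0.
  by rewrite lee_fin; apply: weight_sum_sub => w _ _; rewrite /walk big1.
have [N [a0 [N0 a00 Ha]]] := exists_descending_level lnrho_gt0 geometric_potential_le
  birkhoff_distortion p_nil p_cons p_rcons c_gt0 p_ge p_le t_bound (ltW s0) sd mean ti.
have nullE E : cylinder_null phi s E -> hausdorff_null s (pi @` E).
  apply: (cylinder_null_hausdorff_null geometric_potential_le (expR_gt0 _) _ s0).
  exact: coding_cylinder_le.
have n1 := nullE _ (cylinder_null_unbounded_walk lnrho_gt0 geometric_potential_le
   birkhoff_distortion t_bound (ltW s0) bs N0 a00 Ha).
have n2 k := nullE _ (cylinder_null_bounded_walk lnrho_gt0 geometric_potential_le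
   birkhoff_distortion t_bound (ltW s0) bs k ti).
apply: hausdorff_null_subset (hausdorff_nullU s0 n1 (hausdorff_null_bigcup s0 n2)).
move=> _ [x Wx <-].
have [h|h] := pselect (forall k : nat, exists n, k%:Z <= walk t (mkseq x n)).
  by left; exists x.
right; have [k Hk] : exists k : nat, forall n, walk t (mkseq x n) <= k%:Z.
  apply: contrapT => /forallNP unb; apply: h => k; apply: contrapT => /forallNP below.
  by apply: (unb k) => n; rewrite leNgt; apply/negP => /ltW; exact: below.
by exists k => //; exists x => // n; rewrite Wx Hk.
Qed.

Lemma transient_null_of_gt_delta s c : delta < s -> hausdorff_null s (T c).
Proof.
move=> ds; have s0 : 0 < s := lt_trans delta_gt0 ds.
apply: transient_null => //; apply: (@hausdorff_null_subset _ _ _ (pi @` setT)).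
  by apply: image_subset.
apply: (cylinder_null_hausdorff_null geometric_potential_le (expR_gt0 _) _ s0).
  exact: coding_cylinder_le.
apply: (@cylinder_null_fixed_length _ _ _ _ _ predT) => // r r0.
exact: (weight_sum_decay lnrho_gt0 geometric_potential_le p_nil p_rcons c_gt0 p_ge ds r0).
Qed.

Lemma transient_not_null_of_lt_return s c : (c = T1 -> escapes I_ Psi e) ->
  0 < s -> s < delta0 -> ~ hausdorff_null s (T c).
Proof.
move=> esc s0 sd.
(* The gap between [s] and the divergent exponent [s'] turns divergence into unbounded sums. *)
pose s' := (s + delta0) / 2; have ss' : s < s' by rewrite /s'; lra.
have s'd : s' < delta0 by rewrite /s'; lra.
have s'0 : 0 <= s' by lra.
have ns := not_summable_of_lt s'0 s'd.
apply: transient_not_null_of_growth => //.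
- move=> _; exists (- (Num.truncn K)%:Z) => C.
  have [n Hn] := weight_sum_unbounded lnrho_gt0 geometric_potential_le ss' ns C.
  exists n; apply: le_trans Hn _; apply: weight_sum_sub => w _ /near0_nat h.
  exact: absz_le_oppz h (leqnn _).
(* Words in the window need not have nonnegative walk here; instead, at [s'] the words of walk 0
   have total weight at least 1 at every length. *)
- move=> t0; apply: (weight_sum_unbounded lnrho_gt0 geometric_potential_le ss').
  apply/eqP; rewrite eq_le leey leNgt; apply/negP => h.
  have [|[|n]] := small_term _ h (divr_gt0 ltr01 (@ltr0Sn R 1)).
  + by move=> n; exact: weight_sum_ge0.
  + apply/negP; rewrite -ltNge; apply: (@lt_le_trans _ _ 1); first by lra.
    have := @weight_sum_ge_word _ _ phi s' (fun w => 0 <= walk t w) [::].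
    by rewrite (sup_birkhoff_nil geometric_potential_le) mulr0 expR0; apply; rewrite /walk big_nil.
  + apply/negP; rewrite -ltNge; apply: (@lt_le_trans _ _ 1); first by lra.
    apply: (@weight_sum_zero_steps_ge1 _ _ _ _ lnrho_gt0 geometric_potential_le t s' (Num.truncn K)) => //.
    apply/eqP; rewrite eq_le leey -[leLHS]ns; apply: lee_nneseries => [j _ _|j _].
      by rewrite lee_fin weight_sum_ge0.
    by rewrite lee_fin; apply: weight_sum_sub => w _; exact: near0_nat.
Qed.

Lemma transient_not_null_of_lt_delta s c : (c = T1 -> escapes I_ Psi e) ->
  0 <= mean_step p t -> 0 < s -> s < delta -> ~ hausdorff_null s (T c).
Proof.
move=> esc mean s0 sd.
have grow C : exists n, C <= Z s n (fun w => 0 <= walk t w).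
  have [n Hn] := weight_sum_nonneg_walk_growth lnrho_gt0 geometric_potential_le p_nil p_cons
    p_rcons c_gt0 p_ge p_le t_bound mean sd `|C|.
  exists n; apply: le_trans Hn; apply: le_trans (ler_norm _) _.
  by rewrite ler_peMr // ler1n.
apply: transient_not_null_of_growth => // _; by exists 0.
Qed.

Lemma dim_transient_of_mean_ge0 c : (c = T1 -> escapes I_ Psi e) ->
  0 <= mean_step p t -> hausdorff_dim (T c) = delta%:E.
Proof.
move=> esc mean; apply/eqP; rewrite eq_le; apply/andP; split.
  apply: hausdorff_null_dim_le => [|u du]; first exact: ltW.
  by exists u; rewrite ?du ?lexx //; exact: transient_null_of_gt_delta.
by apply: hausdorff_null_dim_ge => s; exact: transient_not_null_of_lt_delta.
Qed.

Lemma dim_transient_of_mean_le0 c : (c = T1 -> escapes I_ Psi e) ->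
  mean_step p t <= 0 -> hausdorff_dim (T c) = delta0%:E.
Proof.
move=> esc mean; apply/eqP; rewrite eq_le; apply/andP; split; last first.
  by apply: hausdorff_null_dim_ge => s; exact: transient_not_null_of_lt_return.
apply: hausdorff_null_dim_le => [|u du]; first exact: return_exponent_ge0.
have d0 := return_exponent_ge0.
(* Nullity just above [delta0] is available only below [delta], so [s] is taken under both [u] and
   [delta]; if [delta <= delta0], the bound above [delta] serves. *)
have [dd|dd] := ltP delta0 delta; last first.
  exists u; rewrite ?du ?lexx //; apply: transient_null_of_gt_delta.
  exact: le_lt_trans dd du.
pose s := (delta0 + Num.min u delta) / 2.
have h1 : delta0 < Num.min u delta by rewrite lt_min du.
have h2 : Num.min u delta <= u by rewrite ge_min lexx.
have h3 : Num.min u delta <= delta by rewrite ge_min lexx orbT.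
have ds : delta0 < s by rewrite /s; lra.
exists s; first by rewrite ds /s; lra.
by apply: transient_null_of_lt_delta => //; rewrite /s; lra.
Qed.

End Dimension.

End Sign.
End Lift.

End Constants.

Lemma expansion_constants : exists rho L Ch eps : R,
  [/\ 1 < rho, 0 <= Ch & 0 < eps] /\
  [/\ forall i x, a i <= x <= b i -> rho <= `|dH i x|,
      forall i x, a i <= x <= b i -> `|dH i x| <= L &
      forall i x y, a i <= x <= b i -> a i <= y <= b i ->
        `| dH i x - dH i y | <= Ch * `|x - y| `^ eps].
Proof.
case: expanding => _ _ _ _ _ [eps eps0 diffeo] exps.
have [C0 HC0] : exists C : R, forall i, forall x y, a i <= x <= b i -> a i <= y <= b i ->
    `| dH i x - dH i y | <= C * `|x - y| `^ eps.
  apply: (@fin_uniform_bound _ _ (fun i C => forall x y, a i <= x <= b i -> a i <= y <= b i ->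
    `| dH i x - dH i y | <= C * `|x - y| `^ eps) ord0).
    move=> i c d Hc cd x y xi yi; apply: le_trans (Hc _ _ xi yi) _.
    by rewrite ler_wpM2r // powR_ge0.
  move=> i; have [_ [_ [C HC]] _] := diffeo i; exists C => x y /in_closure xi /in_closure yi.
  exact: HC.
have HC : forall i x y, a i <= x <= b i -> a i <= y <= b i ->
    `| dH i x - dH i y | <= `|C0| * `|x - y| `^ eps.
  move=> i x y xi yi; apply: le_trans (HC0 _ _ _ xi yi) _.
  by rewrite ler_wpM2r ?powR_ge0 // ler_norm.
have cont i : {within `[a i, b i], continuous (fun x => `|dH i x|)}.
  apply/subspace_continuousP => x; rewrite /= in_itv /= => xi.
  apply/cvgrPdist_lt => e e0.
  have k0 : 0 < `|C0| + 1 by rewrite ltr_wpDl.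
  have d0 : 0 < (e / (`|C0| + 1)) `^ eps^-1 by rewrite powR_gt0 // divr_gt0.
  rewrite near_withinE; apply/nbhs_ballP; exists ((e / (`|C0| + 1)) `^ eps^-1) => //= y.
  rewrite /ball /= in_itv /= => xyd yi.
  apply: le_lt_trans (ler_dist_dist _ _) _.
  apply: le_lt_trans (HC _ _ _ xi yi) _.
  have : `|x - y| `^ eps < ((e / (`|C0| + 1)) `^ eps^-1) `^ eps.
    by apply: gt0_ltr_powR; rewrite ?nnegrE ?powR_ge0.
  rewrite -powRrM mulVf ?gt_eqF // powRr1 ?divr_ge0 ?(ltW e0) ?(ltW k0) // => h1.
  apply: (@le_lt_trans _ _ ((`|C0| + 1) * `|x - y| `^ eps)).
    by rewrite ler_wpM2r ?powR_ge0 // lerDl.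
  by rewrite mulrC -ltr_pdivlMr.
have [L HL] : exists L : R, forall i, forall x, a i <= x <= b i -> `|dH i x| <= L.
  apply: (@fin_uniform_bound _ _ (fun i L => forall x, a i <= x <= b i -> `|dH i x| <= L) ord0).
    by move=> i c d Hc cd x xi; apply: le_trans (Hc _ xi) cd.
  move=> i; have [c _ Hc] := EVT_max (ltW (ab i)) (cont i).
  by exists `|dH i c| => x xi; apply: Hc; rewrite in_itv.
have [r Hr] : exists r : R, forall i, 0 < r /\ forall x, a i <= x <= b i -> 1 + r^-1 <= `|dH i x|.
  apply: (@fin_uniform_bound _ _ (fun i r => 0 < r /\
      forall x, a i <= x <= b i -> 1 + r^-1 <= `|dH i x|) ord0).
    move=> i c d [c0 Hc] cd; have d0 := lt_le_trans c0 cd; split => // x xi.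
    by apply: le_trans (Hc _ xi); rewrite lerD2l lef_pV2.
  move=> i; have [c ci Hc] := EVT_min (ltW (ab i)) (cont i).
  have c1 : 1 < `|dH i c| by apply: exps; apply/in_closure; move: ci; rewrite in_itv.
  exists (`|dH i c| - 1)^-1; rewrite invr_gt0 subr_gt0; split => // x xi.
  by rewrite invrK subrKC; apply: Hc; rewrite in_itv.
exists (1 + r^-1), L, `|C0|, eps; do !split => //.
- by have [r0 _] := Hr ord0; rewrite ltrDl invr_gt0.
- by move=> i x xi; have [_] := Hr i; apply.
Qed.

End Geometry.

(** * Gibbs measures of cylinders *)

Section CylinderMeasure.
Variables (R : realType) (m : nat).
Local Notation letter := 'I_m.+2.
Local Notation shift := (@Defs.shift m).
Variable mu : probability (borel_symbol_seq R m) R.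

Lemma measurable_cylinder (w : seq letter) :
  measurable (cylinder w : set (borel_symbol_seq R m)).
Proof.
(* Cylinders are open: a distance below [expR (1 - n)] forces agreement on more than [n - 1]
   letters. *)
apply: sub_sigma_algebra => x wx; exists (expR (1 - (size w)%:R)); first exact: expR_gt0.
move=> y xy.
have [k xyk wk] : exists2 k : nat, mkseq x k = mkseq y k & (size w <= k)%N.
  pose A := [set expR (- k%:R) | k in [set k : nat | mkseq x k = mkseq y k]] : set R.
  have hA : has_inf A.
    split; first by exists (expR (- 0%:R)); exists 0%N.
    by exists 0 => _ [k _ <-]; exact: expR_ge0.
  have [|_ [k xyk <-]] := @inf_adherent _ A (expR (1 - (size w)%:R) - inf A) _ hA.
    by rewrite subr_gt0.
  rewrite subrKC ltr_expR => lt; exists k => //.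
  by rewrite -ltnS -(ltr_nat R) -natr1; lra.
rewrite /cylinder /= -(take_mkseq y wk) -xyk take_mkseq //.
Qed.

Definition cylinder_prob (w : seq letter) : R := fine (mu (cylinder w)).

Lemma cylinder_probE w : mu (cylinder w) = (cylinder_prob w)%:E.
Proof.
by rewrite /cylinder_prob fineK // fin_num_measure //; exact: measurable_cylinder.
Qed.

Lemma cylinder_prob_nil : cylinder_prob [::] = 1.
Proof.
by rewrite /cylinder_prob (_ : cylinder [::] = setT) ?probability_setT //; exact/seteqP.
Qed.

Lemma sum_cylinder_prob (A : set (borel_symbol_seq R m)) (w : letter -> seq letter) (p : R) :
  mu A = p%:E ->
  (forall x, A x <-> exists i, cylinder (w i) x) ->
  (forall i j x, cylinder (w i) x -> cylinder (w j) x -> i = j) ->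
  \sum_i cylinder_prob (w i) = p.
Proof.
move=> Ap AE disj.
have : mu A = (\sum_(i < m.+2) mu (cylinder (w i)))%E.
  rewrite -(@measure_bigsetU_ord _ _ _ mu _ xpredT (fun i => cylinder (w i))).
  - congr (mu _); apply/seteqP; split => x; rewrite -bigcup_mkord_ord.
      by move=> /AE[i wi]; exists i => /=; rewrite ?inord_val.
    by move=> [i _ wi]; apply/AE; exists (inord i).
  - by move=> i; exact: measurable_cylinder.
  - by move=> i j _ _ [x [wi wj]]; exact: (disj _ _ x).
rewrite Ap; under eq_bigr do rewrite cylinder_probE.
by rewrite sumEFin => -[->].
Qed.

Lemma sum_cylinder_prob_rcons w : \sum_i cylinder_prob (rcons w i) = cylinder_prob w.
Proof.
apply: (sum_cylinder_prob (cylinder_probE w)) => [x|i j x].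
  split => [wx|[i]]; last by rewrite -cats1 => /cylinder_cat[].
  by exists (x (size w)); rewrite /cylinder /= size_rcons mkseqS [X in rcons X]wx.
by rewrite /cylinder /= !size_rcons mkseqS => /rcons_inj[_ <-] /rcons_inj[_ <-].
Qed.

Lemma sum_cylinder_prob_cons :
  (forall A : set (borel_symbol_seq R m), measurable A -> mu (shift @^-1` A) = mu A) ->
  forall w, \sum_i cylinder_prob (i :: w) = cylinder_prob w.
Proof.
move=> inv w.
have E : mu (shift @^-1` (cylinder w)) = (cylinder_prob w)%:E.
  by rewrite inv ?cylinder_probE //; exact: measurable_cylinder.
apply: (sum_cylinder_prob E) => [x|i j x].
  split => [wx|[i]]; last by rewrite /cylinder /= mkseq_cons => -[_].
  by exists (x 0%N); rewrite /cylinder /= mkseq_cons; congr (_ :: _).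
by rewrite /cylinder /= => -[<- _] -[<- _].
Qed.

Lemma integral_first_letter (t : letter -> R) :
  (\int[mu]_x (t (x 0%N))%:E = (\sum_i t i * cylinder_prob [:: i])%:E)%E.
Proof.
rewrite -sumEFin.
rewrite (eq_integral (fun x : borel_symbol_seq R m => \sum_(i : letter)
    ((t i)%:E * (\1_(cylinder [:: i]) x)%:E)%E)%E); last first.
  move=> x _; rewrite (bigD1 (x 0%N)) //= big1 ?adde0 => [|i ix].
    by rewrite indicE mem_set ?mule1 //.
  rewrite indicE memNset ?mule0 // /cylinder /= => -[xi]; by rewrite xi eqxx in ix.
have mi i : mu.-integrable setT (fun x => (\1_(cylinder [:: i] : set (borel_symbol_seq R m)) x)%:E).
  by apply: integrable_indic; exact: measurable_cylinder.
rewrite integral_sum //; last by move=> i; exact: integrableZl.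
apply: eq_bigr => i _; rewrite integralZl // integral_indic ?setIT; last exact: measurable_cylinder.
  by rewrite EFinM -cylinder_probE.
exact: measurableT.
Qed.

End CylinderMeasure.

(** * Identification of the exponents and proof of the theorem *)

Lemma birkhoff_letter (R : realType) (m : nat) (t : 'I_m.+2 -> R) n (x : symbol_seq m) :
  birkhoff (fun x => t (x 0%N)) n x = \sum_(i <- mkseq x n) t i.
Proof.
rewrite /birkhoff -(big_mkord xpredT (fun k => t (iter k (@Defs.shift m) x 0%N))).
rewrite /mkseq big_map /index_iota subn0.
by apply: eq_bigr => k _; rewrite iter_shiftE addn0.
Qed.

Lemma sup_birkhoff_letter (R : realType) (m : nat) (t : 'I_m.+2 -> R) w :
  sup_birkhoff (fun x : symbol_seq m => t (x 0%N)) w = \sum_(i <- w) t i.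
Proof.
rewrite /sup_birkhoff (_ : [set _ | _ in _] = [set \sum_(i <- w) t i]) ?sup1 //.
apply/seteqP; split => [_ [x wx <-]|_ ->] /=; first by rewrite birkhoff_letter wx.
exists (prepend w (fun=> ord0)); first exact: cylinder_prepend.
by rewrite birkhoff_letter mkseq_prepend.
Qed.

Lemma poincare_exponentE (R : realType) (m : nat) (I_ : 'I_m.+2 -> set R) H Psi sg (K : R) :
  `|sg|%N = 1%N ->
  poincare_exponent (geometric_potential I_ H) (symbolic_step I_ Psi) 0 K =
  return_exponent I_ H Psi sg K.
Proof.
move=> sg1; rewrite /poincare_exponent /return_exponent.
pose t i := sg * step_value I_ Psi i; pose near0 w := `|walk t w|%N%:R <= K.
have -> : [set w | `|sup_birkhoff (fun x => symbolic_step I_ Psi x - 0) w| <= K] =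
          [set w | near0 w].
  apply/funext => w; apply/propext; rewrite /= /near0 /symbolic_step.
  rewrite (sup_birkhoff_letter (fun i => (step_value I_ Psi i)%:~R - 0)).
  rewrite /walk -mulr_sumr abszM sg1 mul1n natr_absz intr_norm.
  by rewrite raddf_sum /=; under eq_bigr do rewrite subr0.
congr inf; apply/funext => s; apply/propext => /=.
by rewrite esum_words // => w; exact: expR_ge0.
Qed.

Lemma gibbs_cylinder_prob (R : realType) (m : nat) (phi : symbol_seq m -> R) (lam D delta : R)
    (mu : probability (borel_symbol_seq R m) R) :
  (forall x, phi x <= - lam) ->
  (forall w x y, cylinder w x -> cylinder w y ->
    birkhoff phi (size w) x <= birkhoff phi (size w) y + D) ->
  0 <= delta -> pressure (fun x => delta * phi x) = 0 -> is_gibbs (fun x => delta * phi x) mu ->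
  exists2 c : R, 0 < c &
    (forall w, c^-1 * expR (delta * sup_birkhoff phi w) <= cylinder_prob mu w) /\
    (forall w, cylinder_prob mu w <= c * expR (delta * sup_birkhoff phi w)).
Proof.
move=> phi_le distortion delta0 P0 [_ [c c1 gibbs]].
have c0 : 0 < c := lt_le_trans ltr01 c1.
have gibbsw w x : cylinder w x -> let e := expR (delta * birkhoff phi (size w) x) in
    c^-1 * e <= cylinder_prob mu w <= c * e.
  move=> wx; have := gibbs _ (in_tuple w) x wx.
  rewrite P0 mulr0 subr0 /birkhoff -mulr_sumr cylinder_probE -!EFinM !lee_fin.
  by rewrite ler_pdivlMr ?expR_gt0 // ler_pdivrMr ?expR_gt0.
have D0 : 0 <= D.
  have := distortion [::] (fun=> ord0) (fun=> ord0) erefl erefl.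
  by rewrite /birkhoff !big_ord0 add0r.
(* Passing between a point of the cylinder and the supremum over it costs one distortion factor. *)
exists (c * expR (delta * D)); first by rewrite mulr_gt0 ?expR_gt0.
split => w; have wx := cylinder_prepend w (fun=> ord0);
  have /andP[lo hi] := gibbsw _ _ wx.
- apply: le_trans lo; rewrite invfM -mulrA ler_wpM2l ?invr_ge0 ?(ltW c0) //.
  rewrite -expRN -expRD ler_expR addrC -mulrBr ler_wpM2l // lerBlDr.
  exact: (sup_birkhoff_le_birkhoff phi_le distortion wx).
- apply: le_trans hi _; rewrite -mulrA ler_wpM2l ?(ltW c0) // -expRD ler_expR -mulrDr ler_wpM2l //.
  apply: le_trans (birkhoff_le_sup phi_le wx) _.
  by rewrite lerDr.
Qed.

Theorem theorem1p3 (R : realType) (m : nat) (I_ : 'I_m.+2 -> set R) (F : R -> R)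
    (H : 'I_m.+2 -> R -> R) (Psi : R -> int) (delta : R)
    (mu : probability (borel_symbol_seq R m) R)
    (phi := geometric_potential I_ H) (psi := symbolic_step I_ Psi)
    (T := transient I_ F H Psi) :
  expanding_map I_ F H ->
  (forall i x y, I_ i x -> I_ i y -> Psi x = Psi y) ->
  0 < delta ->
  pressure (fun x => delta * phi x) = 0 ->
  is_gibbs (fun x => delta * phi x) mu ->
  exists2 K0 : R, 0 < K0 & forall K : R, K0 <= K ->
    let delta0 := poincare_exponent phi psi 0 K in
    ((0 <= \int[mu]_x (psi x)%:E)%E ->
      (forall c, (c = T1 -> escapes I_ Psi (-1)) ->
         hausdorff_dim (T (-1) c) = delta0%:E) /\
      (forall c, (c = T1 -> escapes I_ Psi 1) ->
         hausdorff_dim (T 1 c) = delta%:E)) /\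
    ((\int[mu]_x (psi x)%:E <= 0)%E ->
      (forall c, (c = T1 -> escapes I_ Psi 1) ->
         hausdorff_dim (T 1 c) = delta0%:E) /\
      (forall c, (c = T1 -> escapes I_ Psi (-1)) ->
         hausdorff_dim (T (-1) c) = delta%:E)).
Proof.
move=> expanding Psi_cst delta_gt0 P0 gibbs.
have [itv sub interior_I _ _ _ _] := expanding.
have /choice[ab Hab] i : exists ab : R * R,
    [/\ ab.1 < ab.2, closure (I_ i) = `[ab.1, ab.2]%classic & `]ab.1, ab.2[%classic `<=` I_ i].
  by have [a [b]] := interval_closure (itv i) (sub i) (interior_I i); exists (a, b).
pose a i := (ab i).1; pose b i := (ab i).2.
have lt_ab i : a i < b i by have [] := Hab i.
have closure_I i : closure (I_ i) = `[a i, b i]%classic by have [] := Hab i.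
have sub_I i : `]a i, b i[%classic `<=` I_ i by have [] := Hab i.
have [rho [L [Ch [eps [[rho_gt1 Ch_ge0 eps_gt0] [dH_ge dH_le dH_holder]]]]]] :=
  expansion_constants expanding lt_ab closure_I.
have phi_le := geometric_potential_le expanding closure_I rho_gt1 dH_ge.
have distortion := birkhoff_distortion expanding closure_I rho_gt1 Ch_ge0 eps_gt0 dH_ge dH_holder.
have [c0 c0_gt0 [p_ge p_le]] := gibbs_cylinder_prob phi_le distortion (ltW delta_gt0) P0 gibbs.
pose M := (\sum_i `|step_value I_ Psi i|)%N.
have step_le sg i : `|sg|%N = 1%N -> (`|(sg * step_value I_ Psi i)%R| <= M)%N.
  by move=> sg1; rewrite abszM sg1 mul1n /M (bigD1 i) //= leq_addr.
have integral_psi : (\int[mu]_x (psi x)%:E)%E =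
    (mean_step (cylinder_prob mu) (step_value I_ Psi))%:E.
  exact: (integral_first_letter mu (fun i => (step_value I_ Psi i)%:~R)).
have p_cons := sum_cylinder_prob_cons gibbs.1.
have ge0 (sg : int) c : `|sg|%N = 1%N -> (c = T1 -> escapes I_ Psi sg%:~R) ->
    0 <= mean_step (cylinder_prob mu) (fun i => sg * step_value I_ Psi i) ->
    hausdorff_dim (T sg%:~R c) = delta%:E.
  move=> sg1 esc mean.
  exact: (dim_transient_of_mean_ge0 expanding lt_ab closure_I sub_I rho_gt1 Ch_ge0 eps_gt0
    dH_ge dH_le dH_holder Psi_cst sg1 (fun i => step_le sg i sg1) (cylinder_prob_nil mu)
    p_cons (sum_cylinder_prob_rcons mu) c0_gt0 p_ge p_le delta_gt0 esc mean).
have le0 (sg : int) K c : `|sg|%N = 1%N -> M%:R <= K -> (c = T1 -> escapes I_ Psi sg%:~R) ->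
    mean_step (cylinder_prob mu) (fun i => sg * step_value I_ Psi i) <= 0 ->
    hausdorff_dim (T sg%:~R c) = (poincare_exponent phi psi 0 K)%:E.
  move=> sg1 KM esc mean; rewrite (poincare_exponentE I_ H Psi K sg1).
  exact: (dim_transient_of_mean_le0 expanding lt_ab closure_I sub_I rho_gt1 Ch_ge0 eps_gt0
    dH_ge dH_le dH_holder Psi_cst sg1 (fun i => step_le sg i sg1) (cylinder_prob_nil mu)
    p_cons (sum_cylinder_prob_rcons mu) c0_gt0 p_ge p_le delta_gt0 KM esc mean).
have mean1 : mean_step (cylinder_prob mu) (fun i => 1 * step_value I_ Psi i) =
    mean_step (cylinder_prob mu) (step_value I_ Psi).
  by congr mean_step; apply/funext => i; rewrite mul1r.
have meanN1 : mean_step (cylinder_prob mu) (fun i => -1 * step_value I_ Psi i) =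
    - mean_step (cylinder_prob mu) (step_value I_ Psi).
  by rewrite -mean_stepN; congr mean_step; apply/funext => i; rewrite mulN1r.
(* [M] may be 0, so 1 is added for positivity; the window of returns only has to satisfy
   [M <= K]. *)
exists (M%:R + 1); first by rewrite ltr_wpDl.
move=> K K0 delta0; have KM : M%:R <= K by apply: le_trans K0; rewrite lerDl.
rewrite integral_psi !lee_fin; split => mean; split => c esc.
- by apply: (le0 (-1)); rewrite ?meanN1 ?oppr_le0.
- by apply: (ge0 1); rewrite ?mean1.
- by apply: (le0 1); rewrite ?mean1.
- by apply: (ge0 (-1)); rewrite ?meanN1 ?oppr_ge0.
Qed.
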